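(* Let $\Gamma$ be a finite simplicial graph and suppose the right-angled Coxeter group $W_\Gamma$ has hypergraph index $h\neq\infty$. Then $W_\Gamma$ is thick of order at most $h$, and the divergence of $W_\Gamma$ is bounded above by a polynomial of degree $h+1$.
   Context: Graphs are finite and simplicial. $W_\Gamma=\langle V(\Gamma)\mid s^2=1\ (s\in V(\Gamma)),\ st=ts\ ((s,t)\in E(\Gamma))\rangle$, with the word metric (Cayley graph) for $V(\Gamma)$. A graph is a join $A\star B$ if its vertex set is $V(A)\cup V(B)$ and every vertex of $A$ is adjacent to every vertex of $B$. A clique is a graph in which any two distinct vertices are adjacent. Hypergraph index. $\Omega(\Gamma)$ (wide subgraphs) is the set of induced subgraphs $L=A\star B$ of $\Gamma$, with $A,B$ induced subgraphs each containing a pair of non-adjacent vertices, that are maximal under inclusion among such subgraphs. $\Psi(\Gamma)$ (strip subgraphs) is the set of induced subgraphs $L=A\star K$, with $A$ two non-adjacent vertices and $K$ a non-empty clique, that are not properly contained in an element of $\Omega(\Gamma)$ or in another induced subgraph of this same form. The hypergraphs $\Lambda_i=\Lambda_i(\Gamma)$, $i\ge0$, have vertex set $V(\Gamma)$. The hyperedges of $\Lambda_0$ are the sets $V(L)$, $L\in\Omega(\Gamma)\cup\Psi(\Gamma)$. For hyperedges of $\Lambda_i$ put $H\equiv_iH'$ if there are hyperedges $H=H_0,\dots,H_n=H'$ of $\Lambda_i$ such that each $H_j\cap H_{j+1}$ ($0\le j<n$) contains a pair of non-adjacent vertices. The hyperedges of $\Lambda_{i+1}$ are the unions of the hyperedges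 in the $\equiv_i$-classes. $W_\Gamma$ has hypergraph index $h\in\{0,1,2,\dots\}$ if $\Omega(\Gamma)\ne\emptyset$, some hyperedge of $\Lambda_h$ contains every vertex of $\Gamma$, and no hyperedge of $\Lambda_{h-1}$ does (void if $h=0$). Otherwise the hypergraph index is $\infty$. Thickness. $N_C(Y)$ is the $C$-neighborhood of $Y$. A subspace $Y$ of a metric space $X$ is $C$-path connected if any $y_1,y_2\in Y$ are joined by a path in $N_C(Y)$. It is $(C,L)$-quasi-convex if any $y_1,y_2\in Y$ are joined by an $(L,L)$-quasi-geodesic in $N_C(Y)$. For $C,L>0$, $X$ is a $(C,L)$-tight network with respect to a collection $\{Y_\alpha\}$ of subsets if: (a) each $Y_\alpha$ with the induced metric is $(C,L)$-quasi-convex; (b) $X=\bigcup_\alpha N_C(Y_\alpha)$; (c) for all $Y,Y'\in\{Y_\alpha\}$ and $x\in X$ such that $N_{3C}(x)$ meets both $Y$ and $Y'$, there is a sequence $Y=Y_1,\dots,Y_n=Y'$ in $\{Y_\alpha\}$ with $n\le L$ such that for $1\le i<n$ the set $N_C(Y_i)\cap N_C(Y_{i+1})$ has infinite diameter, is $L$-path connected and meets $N_L(x)$. A family $\{Y_\alpha\}$ of metric spaces is $(C,L)$-uniformly wide if: (1) every point of every $Y_\alpha$ lies in the $C$-neighborhood of a bi-infinite $(L,L)$-quasi-geodesic in $Y_\alpha$; (2) for any sequence $(Y_i,d_i)$ in the family, ultrafilter $\omega$, scaling constants $s_i$ and basepoints $b_i\in Y_i$, the ultralimit $\lim_\omega(Y_i,b_i,\frac1{s_i}d_i)$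 has no cut-points. A family of metric spaces is $(C,L)$-thick of order (at most) $0$ if it is $(C,L)$-uniformly wide. For $k\ge1$, a metric space $X$ is $(C,L)$-thick of order at most $k$ with respect to $\{Y_\alpha\}$ if $X$ is a $(C,L)$-tight network with respect to $\{Y_\alpha\}$ and the $Y_\alpha$, with the restricted metrics, form a family that is $(C,L)$-thick of order at most $k-1$. (A family is $(C,L)$-thick of order at most $m\ge1$ if each member is a $(C,L)$-tight network with respect to some collection of subsets and all the subsets so obtained, over all members, together form a family that is $(C,L)$-thick of order at most $m-1$.) $X$ is thick of order at most $k$ if this holds for some $C,L$ and some collection. Divergence. For a geodesic space $X$ (here the Cayley graph), $0<\delta<1$, $\gamma\ge0$ and $a,b,c\in X$ with $r=d(c,\{a,b\})$, let $\mathrm{div}_\gamma(a,b,c;\delta)$ be the infimal length of paths from $a$ to $b$ avoiding the ball of radius $\delta r-\gamma$ about $c$ ($\infty$ if there is none). Let $\mathrm{Div}_\gamma(n;\delta)$ be the supremum of $\mathrm{div}_\gamma(a,b,c;\delta)$ over $a,b,c$ with $d(a,b)\le n$. Write $f\preceq g$ if $f(n)\le Kg(Kn+K)+Kn+K$ for some $K\geq 1$ and all $n$, and $f\asymp g$ if $f\preceq g\preceq f$. The divergence is $\mathrm{Div}_\gamma(\cdot;\delta)$ for $\delta$ sufficiently small and $\gamma$ sufficiently large, considered up to $\asymp$. Being bounded above by a polynomial of degree $m$ means $\preceq n^m$. *)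

(* Defs.v *)
From HB Require Import structures.
From mathcomp Require Import all_boot all_order all_algebra.
From mathcomp Require Import generic_quotient ring.
From mathcomp Require Import all_classical all_reals.
From mathcomp Require Import ereal topology normedtype numfun.

Set Implicit Arguments.
Unset Strict Implicit.
Unset Printing Implicit Defensive.

Import Order.TTheory GRing.Theory Num.Theory.
Import numFieldNormedType.Exports.

Local Open Scope classical_set_scope.
Local Open Scope ring_scope.

Section HypergraphIndex.
Context {V : finType} (e : rel V).
Local Open Scope set_scope.
Implicit Types (L A B K H : {set V}) (E : {set {set V}}).

(* An induced subgraph is represented by its set of vertices. *)

Definition has_nonadj A : bool :=
  [exists x in A, exists y in A, (x != y) && ~~ e x y].

Definition is_clique K : bool :=
  [forall x in K, forall y in K, (x != y) ==> e x y].

(* [A] and [B] are disjoint as soon as [e] is irreflexive. *)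
Definition is_join L A B : bool :=
  (L == A :|: B) && [forall a in A, forall b in B, e a b].

Definition wide_form L : bool :=
  [exists A : {set V}, exists B : {set V},
    [&& is_join L A B, has_nonadj A & has_nonadj B]].

Definition Omega : {set {set V}} := [set L | maxset wide_form L].

Definition strip_form L : bool :=
  [exists A : {set V}, exists K : {set V},
    [&& is_join L A K, #|A| == 2%N, has_nonadj A, K != finset.set0 & is_clique K]].

Definition Psi : {set {set V}} :=
  [set L | maxset strip_form L & [forall M in Omega, ~~ (L \proper M)]].

Definition linked E : rel {set V} :=
  [rel H H' | [&& H \in E, H' \in E & has_nonadj (H :&: H')]].

Definition next_hypergraph E : {set {set V}} :=
  [set \bigcup_(H' in E | connect (linked E) H H') H' | H in E].

Definition Lambda (i : nat) : {set {set V}} :=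
  iter i next_hypergraph (Omega :|: Psi).

Definition has_full_hyperedge E : bool := [exists H in E, [set: V] \subset H].

Definition has_hypergraph_index (h : nat) : bool :=
  [&& Omega != finset.set0, has_full_hyperedge (Lambda h)
    & (0 < h)%N ==> ~~ has_full_hyperedge (Lambda h.-1)].

End HypergraphIndex.

Section RightAngledCoxeterGroup.
Context {V : finType} (e : rel V).
Implicit Types (u v w : seq V) (s t : V).

(* Since every generator is an involution, the group presented by the relations
   is the quotient of the free monoid [seq V] by the congruence they
   generate. *)
Inductive racg_eq : seq V -> seq V -> Prop :=
| racg_eq_refl u : racg_eq u u
| racg_eq_sym u v : racg_eq u v -> racg_eq v u
| racg_eq_trans v u w : racg_eq u v -> racg_eq v w -> racg_eq u w
| racg_eq_cat u u' v v' :
    racg_eq u u' -> racg_eq v v' -> racg_eq (u ++ v) (u' ++ v')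
| racg_eq_invol s : racg_eq [:: s; s] [::]
| racg_eq_comm s t : e s t -> racg_eq [:: s; t] [:: t; s].

Definition racg_eqb : rel (seq V) := fun u v => `[< racg_eq u v >].

Lemma racg_eqb_refl : reflexive racg_eqb.
Proof. by move=> u; apply/asboolP; exact: racg_eq_refl. Qed.

Lemma racg_eqb_sym : symmetric racg_eqb.
Proof. by move=> u v; apply/asboolP/asboolP; exact: racg_eq_sym. Qed.

Lemma racg_eqb_trans : transitive racg_eqb.
Proof.
by move=> v u w /asboolP uv /asboolP vw; apply/asboolP; exact: racg_eq_trans vw.
Qed.

Canonical racg_equiv : equiv_rel (seq V) :=
  EquivRel racg_eqb racg_eqb_refl racg_eqb_sym racg_eqb_trans.

Local Open Scope quotient_scope.

Definition racg : Type := {eq_quot racg_equiv}.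

HB.instance Definition _ := Choice.on racg.
HB.instance Definition _ := EqQuotient.on racg.

Lemma racgP u v : reflect (racg_eq u v) (u == v %[mod racg]).
Proof. by rewrite eqmodE; exact: asboolP. Qed.

Lemma racg_repr u : racg_eq (repr (\pi_racg u)) u.
Proof. by apply/racgP; rewrite reprK. Qed.

Definition racg_one : racg := \pi_racg [::].
Definition racg_mul (g h : racg) : racg := \pi_racg (repr g ++ repr h).
Definition racg_inv (g : racg) : racg := \pi_racg (rev (repr g)).

Definition racg_gen (s : V) : racg := \pi_racg [:: s].

Lemma racg_mulE u v : racg_mul (\pi u) (\pi v) = \pi_racg (u ++ v).
Proof. by apply/eqP/racgP; apply: racg_eq_cat; exact: racg_repr. Qed.

Lemma racg_eq_rev u v : racg_eq u v -> racg_eq (rev u) (rev v).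
Proof.
elim=> {u v}.
- by move=> u; exact: racg_eq_refl.
- by move=> u v _; exact: racg_eq_sym.
- by move=> v u w _ uv _ vw; exact: racg_eq_trans uv vw.
- by move=> u u' v v' _ uu' _ vv'; rewrite !rev_cat; exact: racg_eq_cat.
- by move=> s; exact: racg_eq_invol.
- by move=> s t st; apply: racg_eq_sym; exact: racg_eq_comm.
Qed.

Lemma racg_invE u : racg_inv (\pi u) = \pi_racg (rev u).
Proof. by apply/eqP/racgP; apply: racg_eq_rev; exact: racg_repr. Qed.

Lemma racg_mulA : associative racg_mul.
Proof.
by elim/quotW=> u; elim/quotW=> v; elim/quotW=> w; rewrite !racg_mulE catA.
Qed.

Lemma racg_mul1g : left_id racg_one racg_mul.
Proof. by elim/quotW=> u; rewrite racg_mulE. Qed.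

Lemma racg_mulg1 : right_id racg_one racg_mul.
Proof. by elim/quotW=> u; rewrite racg_mulE cats0. Qed.

Lemma racg_eq_rev_cat u : racg_eq (rev u ++ u) [::].
Proof.
elim: u => [|s u IHu]; first exact: racg_eq_refl.
rewrite rev_cons cat_rcons; apply: racg_eq_trans IHu.
apply: racg_eq_cat; first exact: racg_eq_refl.
rewrite -[X in racg_eq _ X]cat0s -[s :: s :: u]/([:: s; s] ++ u).
by apply: racg_eq_cat; [exact: racg_eq_invol | exact: racg_eq_refl].
Qed.

Lemma racg_mulVg : left_inverse racg_one racg_inv racg_mul.
Proof.
elim/quotW=> u; rewrite racg_invE racg_mulE.
by apply/eqP/racgP; exact: racg_eq_rev_cat.
Qed.

Lemma racg_mulgV : right_inverse racg_one racg_inv racg_mul.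
Proof.
elim/quotW=> u; rewrite racg_invE racg_mulE.
by apply/eqP/racgP; rewrite -{1}[u]revK; exact: racg_eq_rev_cat.
Qed.

HB.instance Definition _ := isGroup.Build racg
  racg_mulA racg_mul1g racg_mulg1 racg_mulVg racg_mulgV.

End RightAngledCoxeterGroup.

Arguments racg {V} e.
Arguments racg_gen {V} e s.

Section CayleyGraph.
Context (R : realType) {V : finType} (e : rel V).
Local Notation W := (racg e).
Implicit Types (g h : W) (s : V) (t : R).

(* A point of the geometric realization of the Cayley graph (edges of length 1)
   is given by its barycentric coordinates: [vertex_coord g] for the vertex [g],
   and [edge_coord g s t] for the point at distance [t] from [g] on the edge
   from [g] to [g * s]. On vertices, [cayley_dist] is the word metric. *)

Definition vertex_coord g : W -> R := fun x => (x == g)%:R.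

Definition edge_coord g s t : W -> R := fun x =>
  (1 - t) * vertex_coord g x + t * vertex_coord (g * racg_gen e s)%g x.

Record cayley := CayleyPoint {
  coord : W -> R;
  coordP : (exists g, coord = vertex_coord g) \/
           (exists g s t, 0 <= t <= 1 /\ coord = edge_coord g s t)
}.

HB.instance Definition _ := gen_eqMixin cayley.
HB.instance Definition _ := gen_choiceMixin cayley.

Lemma coord_inj : injective coord.
Proof.
case=> p pP [q qP] /= pq; rewrite pq in pP *; congr CayleyPoint.
exact: Prop_irrelevance.
Qed.

Definition cayley_vertex g : cayley :=
  CayleyPoint (or_introl (ex_intro _ g erefl)).

(* [cayley_route p q l]: some concatenation of finitely many segments, each of
   them contained in one edge, goes from [p] to [q] and has length [l]. *)
Inductive cayley_route : cayley -> cayley -> R -> Prop :=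
| cayley_route_nil p : cayley_route p p 0
| cayley_route_cons p q r g s t t' l :
    0 <= t <= 1 -> 0 <= t' <= 1 ->
    coord p = edge_coord g s t -> coord q = edge_coord g s t' ->
    cayley_route q r l -> cayley_route p r (`|t - t'| + l).

Definition cayley_dist (p q : cayley) : R := inf [set l | cayley_route p q l].

Lemma cayley_route_ge0 p q l : cayley_route p q l -> 0 <= l.
Proof. by elim=> // *; rewrite addr_ge0. Qed.

Lemma cayley_route_cat p q r l l' :
  cayley_route p q l -> cayley_route q r l' -> cayley_route p r (l + l').
Proof.
move=> pq; elim: pq => {p q l} [p|p q r0 g s t t' l t01 t'01 pE qE _ IH] qr.
  by rewrite add0r.
by rewrite -addrA; apply: cayley_route_cons t01 t'01 pE qE (IH qr).
Qed.

Lemma cayley_route_rev p q l : cayley_route p q l -> cayley_route q p l.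
Proof.
elim=> {p q l} [p|p q r g s t t' l t01 t'01 pE qE _ rq].
  exact: cayley_route_nil.
rewrite addrC; apply: (cayley_route_cat rq).
rewrite distrC -[X in cayley_route _ _ X]addr0.
exact: cayley_route_cons t'01 t01 qE pE (cayley_route_nil _).
Qed.

Lemma cayley_route_coord p q l : cayley_route p q l ->
  forall x, `|coord p x - coord q x| <= l.
Proof.
elim=> {p q l} [p x|p q r g s t t' l _ _ pE qE _ IH x].
  by rewrite subrr normr0.
rewrite -[coord p x](subrK (coord q x)) -addrA (le_trans (ler_normD _ _))//.
rewrite lerD// pE qE /edge_coord.
set a := vertex_coord g x; set b := vertex_coord _ x.
have -> : (1 - t) * a + t * b - ((1 - t') * a + t' * b) = (t - t') * (b - a).
  by ring.
rewrite normrM ler_piMr// /a /b /vertex_coord.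
by case: (_ == _); case: (_ == _); rewrite /= ?subrr ?subr0 ?sub0r ?normrN
  ?normr0 ?normr1 ?ler01.
Qed.

Lemma vertex_coord0 g s : vertex_coord g = edge_coord g s 0.
Proof. by apply/funext => x; rewrite /edge_coord subr0 mul1r mul0r addr0. Qed.

Lemma vertex_coord1 g s :
  vertex_coord (g * racg_gen e s)%g = edge_coord g s 1.
Proof. by apply/funext => x; rewrite /edge_coord subrr mul1r mul0r add0r. Qed.

Lemma cayley_route_one g :
  exists l, cayley_route (cayley_vertex 1%g) (cayley_vertex g) l.
Proof.
rewrite -[g](@reprK _ (racg e)); elim/last_ind: (repr g) => [|w s [l IH]].
  by exists 0; exact: cayley_route_nil.
exists (l + (`|0 - 1| + 0)); apply: (cayley_route_cat IH).
apply: (cayley_route_cons (g := (\pi_(racg e) w)%qT) (s := s) (t := 0)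
  (t' := 1) _ _ _ _ (cayley_route_nil _)).
- by rewrite lexx ler01.
- by rewrite lexx ler01.
- exact: vertex_coord0.
- by rewrite -vertex_coord1 -cats1 -racg_mulE.
Qed.

Lemma cayley_route_vertex p :
  exists g l, cayley_route p (cayley_vertex g) l.
Proof.
case: (coordP p) => [[g pg]|[g [s [t [t01 pE]]]]]; exists g.
  exists 0; suff -> : p = cayley_vertex g by exact: cayley_route_nil.
  exact: coord_inj.
exists (`|t - 0| + 0); apply: cayley_route_cons t01 _ pE _ (cayley_route_nil _).
  by rewrite lexx ler01.
exact: vertex_coord0.
Qed.

Lemma cayley_route_exists p q : exists l, cayley_route p q l.
Proof.
have [g [a pg]] := cayley_route_vertex p.
have [h [b qh]] := cayley_route_vertex q.
have [c gc] := cayley_route_one g; have [d hd] := cayley_route_one h.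
exists (a + (c + (d + b))); apply: (cayley_route_cat pg).
apply: (cayley_route_cat (cayley_route_rev gc)); apply: (cayley_route_cat hd).
exact: cayley_route_rev.
Qed.

Lemma has_inf_cayley_route p q : has_inf [set l | cayley_route p q l].
Proof.
split; first by have [l pq] := cayley_route_exists p q; exists l.
by exists 0 => l; exact: cayley_route_ge0.
Qed.

Lemma cayley_distxx p : cayley_dist p p = 0.
Proof.
apply/eqP; rewrite eq_le; apply/andP; split.
  apply: ge_inf; first by have [] := has_inf_cayley_route p p.
  exact: cayley_route_nil.
apply: lb_le_inf; first by have [] := has_inf_cayley_route p p.
by move=> l; exact: cayley_route_ge0.
Qed.

Lemma cayley_dist_sym p q : cayley_dist p q = cayley_dist q p.
Proof.
congr inf; apply/seteqP; split=> l /=; exact: cayley_route_rev.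
Qed.

Lemma cayley_dist_positivity p q : cayley_dist p q = 0 -> p = q.
Proof.
move=> pq0; apply: coord_inj; apply/funext => x; apply/eqP.
rewrite -subr_eq0 -normr_eq0 eq_le normr_ge0 andbT -pq0.
apply: lb_le_inf; first by have [] := has_inf_cayley_route p q.
by move=> l /cayley_route_coord.
Qed.

Lemma cayley_dist_triangle q p r :
  cayley_dist p r <= cayley_dist p q + cayley_dist q r.
Proof.
have infP a b : has_inf [set l | cayley_route a b l].
  exact: has_inf_cayley_route.
apply/ler_addgt0Pl => eps eps0; rewrite [eps]splitr addrACA.
have eps20 : 0 < eps / 2 by rewrite divr_gt0.
have [a /= pa aE] := inf_adherent eps20 (infP p q).
have [b /= qb bE] := inf_adherent eps20 (infP q r).
rewrite ![eps / 2 + _]addrC; apply: le_trans (lerD (ltW aE) (ltW bE)).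
by apply: ge_inf; [have [] := infP p r | exact: cayley_route_cat pa qb].
Qed.

HB.instance Definition _ := isMetric.Build R cayley cayley_distxx
  cayley_dist_positivity cayley_dist_sym cayley_dist_triangle.

End CayleyGraph.

Arguments cayley R {V} e.

Section MetricSpaces.
Context {R : realType}.
Implicit Types (X : metricType R) (C L : R).

Definition metric_nbhd X C (Y : set X) : set X := \bigcup_(y in Y) ball y C.

Definition is_path X (f : R -> X) (x y : X) : Prop :=
  [/\ {within `[0, 1], continuous f}, f 0 = x & f 1 = y].

(* A list [s] in [itv_partition 0 1] omits the first point of the partition. *)
Definition path_length X (f : R -> X) : \bar R :=
  ereal_sup [set (\sum_(0 <= i < size s)
      mdist (f (nth 1 (0 :: s) i)) (f (nth 1 s i)))%:E
    | s in itv_partition 0 1].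

Definition path_connected_in X C (Y : set X) : Prop :=
  forall x y, Y x -> Y y ->
  exists2 f : R -> X, is_path f x y & f @` `[0, 1] `<=` metric_nbhd C Y.

Definition quasi_geodesic_on X L (D : set R) (f : R -> X) : Prop :=
  forall t u, D t -> D u ->
  `|t - u| / L - L <= mdist (f t) (f u) <= L * `|t - u| + L.

Definition quasi_convex X C L (Y : set X) : Prop :=
  forall x y, Y x -> Y y ->
  exists (l : R) (f : R -> X),
    [/\ 0 <= l, quasi_geodesic_on L `[0, l] f, f 0 = x, f l = y
      & f @` `[0, l] `<=` metric_nbhd C Y].

Definition infinite_diameter X (Y : set X) : Prop :=
  forall M : R, exists x y, [/\ Y x, Y y & M < mdist x y].

(* In the third clause, the sequence [Y_1, ..., Y_n] of the definition is
   [Y (a 0), ..., Y (a m)] with [n = m.+1]. *)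
Definition tight_network X C L (J : Type) (Y : J -> set X) : Prop :=
  [/\ forall j, quasi_convex C L (Y j),
      \bigcup_j metric_nbhd C (Y j) = [set: X]
    & forall (j k : J) (x : X),
        ball x (3 * C) `&` Y j !=set0 -> ball x (3 * C) `&` Y k !=set0 ->
        exists (m : nat) (a : nat -> J),
          [/\ m.+1%:R <= L, a 0%N = j, a m = k
            & forall i, (i < m)%N ->
              let N := metric_nbhd C (Y (a i)) `&` metric_nbhd C (Y (a i.+1)) in
              [/\ infinite_diameter N, path_connected_in L N
                & N `&` ball x L !=set0]]].

End MetricSpaces.

Section Subspaces.
Context {R : realType} {X : metricType R} (Y : set X).

Definition metric_subspace : Type := {x : X | Y x}.

HB.instance Definition _ := gen_eqMixin metric_subspace.
HB.instance Definition _ := gen_choiceMixin metric_subspace.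

Let sdist (x y : metric_subspace) : R := mdist (sval x) (sval y).

Let sdistxx x : sdist x x = 0. Proof. exact: mdistxx. Qed.

Let sdist_positivity x y : sdist x y = 0 -> x = y.
Proof.
case: x y => [x xY] [y yY]; rewrite /sdist /= => /mdist_positivity xy.
by rewrite -xy in yY *; congr exist; exact: Prop_irrelevance.
Qed.

Let sdist_sym x y : sdist x y = sdist y x. Proof. exact: metric_sym. Qed.

Let sdist_triangle y x z : sdist x z <= sdist x y + sdist y z.
Proof. exact: metric_triangle. Qed.

HB.instance Definition _ := isMetric.Build R metric_subspace
  sdistxx sdist_positivity sdist_sym sdist_triangle.

End Subspaces.

Section Ultralimit.
Context {R : realType} (Y : nat -> metricType R) (w : set_system nat).
Context (wU : UltraFilter w) (s : nat -> {posnum R}) (b : forall i, Y i).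

Definition scaled_dist (x y : forall i, Y i) (i : nat) : R :=
  mdist (x i) (y i) / (s i)%:num.

(* The sequences at [w]-bounded rescaled distance from the base points; those at
   distance 0 from each other are identified in [ultralimit]. *)
Definition ultra_seq : Type :=
  {x : forall i, Y i | exists M : R, \forall i \near w, scaled_dist b x i <= M}.

HB.instance Definition _ := gen_eqMixin ultra_seq.
HB.instance Definition _ := gen_choiceMixin ultra_seq.

Implicit Types x y z : ultra_seq.

Definition ultra_dist x y : R :=
  lim (scaled_dist (sval x) (sval y) i @[i --> w]).

Lemma scaled_dist_ge0 u v i : 0 <= scaled_dist u v i.
Proof. by rewrite divr_ge0 ?mdist_ge0. Qed.

Lemma scaled_dist_sym u v i : scaled_dist u v i = scaled_dist v u i.
Proof. by rewrite /scaled_dist metric_sym. Qed.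

Lemma scaled_dist_triangle u v u' i :
  scaled_dist u u' i <= scaled_dist u v i + scaled_dist v u' i.
Proof. by rewrite -mulrDl ler_pM2r ?invr_gt0// metric_triangle. Qed.

Lemma cvg_ultra_dist x y :
  scaled_dist (sval x) (sval y) i @[i --> w] --> ultra_dist x y.
Proof.
have wP : ProperFilter w by exact: ultra_proper.
have [M xM] := svalP x; have [N yN] := svalP y.
set f := scaled_dist _ _.
have fMN : \forall i \near w, `[0, M + N]%classic (f i).
  near=> i; rewrite /= in_itv /= scaled_dist_ge0 /=.
  apply: le_trans (scaled_dist_triangle _ b _ _) _; rewrite scaled_dist_sym.
  by apply: lerD; near: i.
have fU : UltraFilter (f @ w).
  split=> [|G GP fG]; first exact: fmap_proper_filter.
  apply/seteqP; split=> // A GA.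
  have [//|wA] := in_ultra_setVsetC (f @^-1` A) wU.
  have /fG GA' : (f @ w) (~` A) by [].
  by have [] := filter_not_empty G; rewrite -(setICr A); exact: filterI.
have := @segment_compact R 0 (M + N); rewrite compact_ultra.
move=> /(_ _ fU fMN)[l [_ fl]].
exact: (cvgP l fl).
Unshelve. all: by end_near. Qed.

Lemma ultra_distxx x : ultra_dist x x = 0.
Proof.
have wP : ProperFilter w by exact: ultra_proper.
apply: cvg_lim; first exact: Rhausdorff.
rewrite (_ : scaled_dist _ _ = cst 0); first exact: cvg_cst.
by apply/funext => i; rewrite /scaled_dist mdistxx mul0r.
Qed.

Lemma ultra_dist_sym x y : ultra_dist x y = ultra_dist y x.
Proof.
rewrite /ultra_dist; congr (lim (_ @ w)).
by apply/funext => i; exact: scaled_dist_sym.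
Qed.

Lemma ultra_dist_ge0 x y : 0 <= ultra_dist x y.
Proof.
have wP : ProperFilter w by exact: ultra_proper.
apply: (cvgr_to_ge (@cvg_ultra_dist x y)).
by apply: nearW => i; exact: scaled_dist_ge0.
Qed.

Lemma ultra_dist_triangle y x z :
  ultra_dist x z <= ultra_dist x y + ultra_dist y z.
Proof.
have wP : ProperFilter w by exact: ultra_proper.
apply: ler_cvg_to (@cvg_ultra_dist x z)
  (cvgD (@cvg_ultra_dist x y) (@cvg_ultra_dist y z)) _.
by apply: nearW => i; exact: scaled_dist_triangle.
Qed.

Definition ultra_eq : rel ultra_seq := fun x y => ultra_dist x y == 0.

Lemma ultra_eq_refl : reflexive ultra_eq.
Proof. by move=> x; rewrite /ultra_eq ultra_distxx. Qed.

Lemma ultra_eq_sym : symmetric ultra_eq.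
Proof. by move=> x y; rewrite /ultra_eq ultra_dist_sym. Qed.

Lemma ultra_eq_trans : transitive ultra_eq.
Proof.
move=> y x z /eqP xy /eqP yz; rewrite /ultra_eq eq_le ultra_dist_ge0 andbT.
by rewrite (le_trans (ultra_dist_triangle y x z))// xy yz addr0.
Qed.

Canonical ultra_equiv : equiv_rel ultra_seq :=
  EquivRel ultra_eq ultra_eq_refl ultra_eq_sym ultra_eq_trans.

Local Open Scope quotient_scope.

Definition ultralimit : Type := {eq_quot ultra_equiv}.

HB.instance Definition _ := Choice.on ultralimit.
HB.instance Definition _ := EqQuotient.on ultralimit.

Definition ultralimit_dist (p q : ultralimit) : R :=
  ultra_dist (repr p) (repr q).

Lemma ultralimit_distE x y :
  ultralimit_dist (\pi x) (\pi y) = ultra_dist x y.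
Proof.
have reprE z : ultra_dist (repr (\pi_ultralimit z)) z = 0.
  by apply/eqP; have /eqP := reprK (\pi_ultralimit z); rewrite eqmodE.
have le_dist u v : ultra_dist u v <=
    ultralimit_dist (\pi_ultralimit u) (\pi_ultralimit v).
  apply: le_trans (ultra_dist_triangle (repr (\pi_ultralimit u)) _ _) _.
  rewrite ultra_dist_sym reprE add0r.
  apply: le_trans (ultra_dist_triangle (repr (\pi_ultralimit v)) _ _) _.
  by rewrite reprE addr0.
apply/eqP; rewrite eq_le le_dist andbT.
apply: le_trans (ultra_dist_triangle x _ _) _; rewrite reprE add0r.
apply: le_trans (ultra_dist_triangle y _ _) _.
by rewrite (ultra_dist_sym y) reprE addr0.
Qed.

Lemma ultralimit_distxx p : ultralimit_dist p p = 0.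
Proof. exact: ultra_distxx. Qed.

Lemma ultralimit_dist_positivity p q : ultralimit_dist p q = 0 -> p = q.
Proof.
elim/quotW: p => x; elim/quotW: q => y; rewrite ultralimit_distE => xy.
by apply/eqP; rewrite eqmodE; apply/eqP.
Qed.

Lemma ultralimit_dist_sym p q : ultralimit_dist p q = ultralimit_dist q p.
Proof. exact: ultra_dist_sym. Qed.

Lemma ultralimit_dist_triangle q p r :
  ultralimit_dist p r <= ultralimit_dist p q + ultralimit_dist q r.
Proof. exact: ultra_dist_triangle. Qed.

HB.instance Definition _ := isMetric.Build R ultralimit ultralimit_distxx
  ultralimit_dist_positivity ultralimit_dist_sym ultralimit_dist_triangle.

End Ultralimit.

Section Thickness.
Context {R : realType}.
Implicit Types (X : metricType R) (C L : R).

Definition has_no_cut_points (T : topologicalType) : Prop :=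
  forall p : T, connected (~` [set p]).

(* As usual for asymptotic cones, the ultrafilter is non-principal and the
   scaling constants tend to infinity along it. *)
Definition uniformly_wide C L (I : Type) (Y : I -> metricType R) : Prop :=
  (forall i (y : Y i), exists2 f : R -> Y i,
     quasi_geodesic_on L [set: R] f & metric_nbhd C (range f) y) /\
  (forall (a : nat -> I) (w : set_system nat) (wU : UltraFilter w)
      (s : nat -> {posnum R}) (b : forall i, Y (a i)),
     (forall n : nat, ~ w [set n]) ->
     (s i)%:num @[i --> w] --> +oo ->
     has_no_cut_points (ultralimit wU s b)).

(* A collection of subsets of each member [Y i] is a family [Z i] indexed by
   [J i]; all these subsets together form a family indexed by [{i : I & J i}],
   each carrying the metric restricted from the [Y i] that contains it. *)
Fixpoint thick_family C L (k : nat) (I : Type) (Y : I -> metricType R) : Prop :=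
  match k with
  | 0%N => uniformly_wide C L Y
  | k'.+1 =>
    exists (J : I -> Type) (Z : forall i, J i -> set (Y i)),
      (forall i, tight_network C L (Z i)) /\
      thick_family C L k' (fun ij : {i : I & J i} =>
        (metric_subspace (Z (projT1 ij) (projT2 ij)) : metricType R))
  end.

Definition thick_of_order_at_most (k : nat) X : Prop :=
  exists C L, [/\ 0 < C, 0 < L & thick_family C L k (fun _ : unit => X)].

End Thickness.

Section Divergence.
Context {R : realType} (X : metricType R).
Local Open Scope ereal_scope.

(* The ball is open, and empty when its radius is not positive. *)
Definition div_points (gam del : R) (a b c : X) : \bar R :=
  let r := Num.min (mdist c a) (mdist c b) in
  ereal_inf [set path_length f | f in [set f : R -> X | is_path f a b /\
    forall t : R, t \in `[0%R, 1%R] -> ~ ball c (del * r - gam)%R (f t)]].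

Definition Div (gam del n : R) : \bar R :=
  ereal_sup [set d | exists a b c : X,
    (mdist a b <= n)%R /\ d = div_points gam del a b c].

Definition dominated (f g : R -> \bar R) : Prop :=
  exists2 K : R, (1 <= K)%R & forall n : R, (0 <= n)%R ->
    f n <= K%:E * g (K * n + K)%R + (K * n + K)%:E.

(* [Div gam del] is antitone in [gam] and monotone in [del], so that a bound at
   one pair is a bound at all smaller [del] and larger [gam]. *)
Definition divergence_bounded_by_degree (m : nat) : Prop :=
  exists del0 gam0 : R, [/\ (0 < del0 < 1)%R, (0 <= gam0)%R &
    forall del gam : R, (0 < del <= del0)%R -> (gam0 <= gam)%R ->
      dominated (Div gam del) (fun n => (n ^+ m)%:E)].

End Divergence.

(* Main.v *)
Require Import Defs.
From mathcomp Require Import all_boot all_order all_algebra.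
From mathcomp Require Import generic_quotient zify ring lra.
From mathcomp Require Import all_classical all_reals.
From mathcomp Require Import ereal topology normedtype numfun.

Set Implicit Arguments.
Unset Strict Implicit.
Unset Printing Implicit Defensive.

Import Order.TTheory GRing.Theory Num.Theory.
Import numFieldNormedType.Exports.

Local Open Scope classical_set_scope.
Local Open Scope ring_scope.

(* Divergence. For two non-adjacent vertices p, q the words pqpq... and qpqp...
   issuing from a vertex x form a bi-infinite geodesic, so one of the two rays
   stays far from any given point. In a wide coset x W_A x W_B one goes from a to
   b far from 1 along such rays in both factors, since the projection to the
   other factor bounds the length from below; this costs a linear length. For a
   hyperedge of Lambda_(k+1), a geodesic from a to b is followed by a chain,
   linear in d(a, b), of cosets of hyperedges of Lambda_k, two consecutive ones
   sharing a pair p, q and hence a ray with a point far from 1; each coset is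
   crossed by induction, which raises the degree by one.

   Thickness. The same chains make a coset graph of a hyperedge of Lambda_(k+1) a
   tight network of coset graphs for Lambda_k. Strips are not wide, but a strip
   A * K has only one pair of non-adjacent vertices: it can be skipped in any
   chain, and only says that g W_H and g s W_H are linked when s in K and A is
   contained in H. The coarse intersection of two linked cosets is a coset of a
   special subgroup, hence path connected. Finally, in the ultralimit of wide
   cosets, a point that differs from the cut-point candidate in one of the two
   factors can be moved freely in the other one. *)

(** * Word length and special subgroups *)

Section WordLength.
Context {V : finType} (e : rel V).
Local Notation W := (racg e).
Local Open Scope nat_scope.
Local Open Scope group_scope.
Implicit Types (u v w : seq V) (x y z : W) (s t : V) (H K : {set V}).

(** No normal form is used. Group elements are separated by maps that respect the defining
    relations: the retractions [kill H] onto special subgroups, an action on the integers through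
    the infinite dihedral group, and the action [link_act]. In the divergence bound the centre of
    the ball is translated to 1, the endpoints [a], [b] are at distance at least [2 m] from 1, and
    the path has to avoid radius [m]. If [|a| >= N + m], a geodesic of length at most [N] is enough;
    otherwise [m < N], so that everything near the ball is linear in [N]. Thickness asks for one
    pair [(C, L)] at all levels of the induction: [C] is always 2, and each level is established for
    every sufficiently large [L], so that the finitely many lower bounds on [L] can be combined.
    They do not depend on the coset, because only its vertex set and the relative position [x^-1 y]
    of linked cosets matter, and these range over finite types. *)

Definition elt u : W := (\pi_W u)%qT.

Lemma elt_eq u v : elt u = elt v <-> racg_eq e u v.
Proof. by split=> [/eqP/racgP|/racgP/eqP]. Qed.

Lemma elt_cat u v : elt (u ++ v) = elt u * elt v.
Proof. by rewrite /elt -racg_mulE. Qed.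

Lemma elt_nil : elt [::] = 1. Proof. by []. Qed.

Lemma elt_cons s u : elt (s :: u) = racg_gen e s * elt u.
Proof. by rewrite -cat1s elt_cat. Qed.

Lemma elt_rcons u s : elt (rcons u s) = elt u * racg_gen e s.
Proof. by rewrite -cats1 elt_cat. Qed.

Lemma elt_rev u : elt (rev u) = (elt u)^-1.
Proof. by rewrite /elt -racg_invE. Qed.

Lemma elt_repr x : elt (repr x) = x.
Proof. exact: reprK. Qed.

Lemma racg_genV s : (racg_gen e s)^-1 = racg_gen e s.
Proof. by rewrite -[racg_gen e s]/(elt [:: s]) -elt_rev. Qed.

Lemma racg_genC s t : e s t ->
  racg_gen e s * racg_gen e t = racg_gen e t * racg_gen e s.
Proof.
move=> st; rewrite -[racg_gen e s]/(elt [:: s]) -[racg_gen e t]/(elt [:: t]).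
by rewrite -!elt_cat; apply/elt_eq; exact: racg_eq_comm.
Qed.

Lemma wlen_subproof x : exists n, `[< exists2 u, size u = n & elt u = x >].
Proof.
by exists (size (repr x)); apply/asboolP; exists (repr x) => //; exact: elt_repr.
Qed.

Definition wlen x : nat := ex_minn (wlen_subproof x).

Lemma wlenP x : exists2 u, size u = wlen x & elt u = x.
Proof. by rewrite /wlen; case: ex_minnP => m /asboolP. Qed.

Lemma wlen_elt u : wlen (elt u) <= size u.
Proof.
by rewrite /wlen; case: ex_minnP => m _; apply; apply/asboolP; exists u.
Qed.

Lemma wlen1 : wlen 1 = 0.
Proof. by apply/eqP; rewrite -leqn0 (leq_trans (wlen_elt [::])). Qed.

Lemma wlen_gen s : wlen (racg_gen e s) <= 1.
Proof. exact: (wlen_elt [:: s]). Qed.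

Lemma wlenM x y : wlen (x * y) <= wlen x + wlen y.
Proof.
have [u <- <-] := wlenP x; have [v <- <-] := wlenP y.
by rewrite -elt_cat -size_cat wlen_elt.
Qed.

Lemma wlenV x : wlen x^-1 = wlen x.
Proof.
suff le y : wlen y^-1 <= wlen y.
  by apply/eqP; rewrite eqn_leq le -{1}(invgK x) le.
by have [u <- <-] := wlenP y; rewrite -elt_rev -(size_rev u) wlen_elt.
Qed.

Lemma wlen_divl x y : wlen x <= wlen (x * y) + wlen y.
Proof. by rewrite -{1}(mulgK y x) -(wlenV y) wlenM. Qed.

Lemma wlen_divr x y : wlen y <= wlen x + wlen (x * y).
Proof. by rewrite -{1}(mulKg x y) -(wlenV x) wlenM. Qed.

Lemma wdist_triangle y x z :
  wlen (x^-1 * z) <= wlen (x^-1 * y) + wlen (y^-1 * z).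
Proof.
have -> : x^-1 * z = (x^-1 * y) * (y^-1 * z) by rewrite -mulgA mulVKg.
exact: wlenM.
Qed.

Lemma wdistC x y : wlen (x^-1 * y) = wlen (y^-1 * x).
Proof. by rewrite -wlenV invgM invgK. Qed.

(** A shortcut between the two prefixes would shorten the geodesic word [u]. *)
Lemma wdist_take u i j : wlen (elt u) = size u -> i <= j <= size u ->
  wlen ((elt (take i u))^-1 * elt (take j u)) = j - i.
Proof.
move=> usize /andP[ij ju].
have iu : i <= size u := leq_trans ij ju.
set m := drop i (take j u).
have takeE : take j u = take i u ++ m.
  by rewrite -{1}(cat_take_drop i (take j u)) take_takel.
have msize : size m = j - i by rewrite size_drop size_takel.
rewrite takeE elt_cat mulKg; apply/eqP; rewrite eqn_leq -{1}msize wlen_elt /=.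
have := wlenM (elt (take i u) * elt m) (elt (drop j u)).
rewrite -!elt_cat -takeE cat_take_drop usize takeE elt_cat.
have := wlenM (elt (take i u)) (elt m).
have := wlen_elt (take i u); have := wlen_elt (drop j u).
rewrite size_drop size_takel //; lia.
Qed.

(** Involutions that satisfy the commutation relations define an action of the group, so words that
    act differently are distinct elements. Used for [link_act] and [line_act]. *)
Lemma racg_eq_foldr (T : Type) (f : V -> T -> T) u v :
  (forall s (k : T), f s (f s k) = k) ->
  (forall s t (k : T), e s t -> f s (f t k) = f t (f s k)) ->
  racg_eq e u v -> forall k, foldr f k u = foldr f k v.
Proof.
move=> fK fC; elim=> {u v} //=.
- by move=> u v w _ uv _ vw k; rewrite uv.
- by move=> u u' v v' _ uu' _ vv' k; rewrite !foldr_cat vv' uu'.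
- by move=> s t st k; exact: fC.
Qed.

(** The retraction of [W] onto the special subgroup [W_H] that sends the generators outside [H] to
    1; by [kill_elt] the chosen representative does not matter. *)
Definition kill H x : W := elt (seq.filter (mem H) (repr x)).

Lemma kill_elt H u : kill H (elt u) = elt (seq.filter (mem H) u).
Proof.
apply/elt_eq; have : racg_eq e (repr (elt u)) u by exact: racg_repr.
move: (repr _) => v; elim=> {u v} //=.
- by move=> u; exact: racg_eq_refl.
- by move=> u v _; exact: racg_eq_sym.
- by move=> v u w _ uv _ vw; exact: racg_eq_trans vw.
- by move=> u u' v v' _ uu' _ vv'; rewrite !filter_cat; exact: racg_eq_cat.
- move=> s; case: (s \in H); [exact: racg_eq_invol|exact: racg_eq_refl].
- move=> s t st; case: (s \in H); case: (t \in H) => /=; try exact: racg_eq_refl.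
  exact: racg_eq_comm.
Qed.

Lemma killM H x y : kill H (x * y) = kill H x * kill H y.
Proof.
rewrite -(elt_repr x) -(elt_repr y) -elt_cat !kill_elt filter_cat.
exact: elt_cat.
Qed.

Lemma kill1 H : kill H 1 = 1.
Proof. by rewrite -elt_nil kill_elt. Qed.

Lemma killV H x : kill H x^-1 = (kill H x)^-1.
Proof.
by rewrite -(elt_repr x) -elt_rev !kill_elt filter_rev elt_rev.
Qed.

Lemma wlen_kill H x : wlen (kill H x) <= wlen x.
Proof.
have [u <- <-] := wlenP x; rewrite kill_elt.
by rewrite (leq_trans (wlen_elt _)) // size_filter count_size.
Qed.

Definition special H x : Prop := exists2 u, all (mem H) u & elt u = x.

Lemma special_elt H u : all (mem H) u -> special H (elt u).
Proof. by exists u. Qed.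

Lemma specialE H x : special H x <-> kill H x = x.
Proof.
split=> [[u uH <-]|<-]; first by rewrite kill_elt; move/all_filterP: uH => ->.
by apply: special_elt; exact: filter_all.
Qed.

Lemma special_kill H x : special H (kill H x).
Proof. by apply: special_elt; exact: filter_all. Qed.

Lemma special1 H : special H 1.
Proof. by exists [::]. Qed.

Lemma specialM H x y : special H x -> special H y -> special H (x * y).
Proof. by move=> /specialE xH /specialE yH; apply/specialE;
  rewrite killM xH yH. Qed.

Lemma specialV H x : special H x -> special H x^-1.
Proof. by move=> /specialE xH; apply/specialE; rewrite killV xH. Qed.

Lemma special_gen H s : s \in H -> special H (racg_gen e s).
Proof. by move=> sH; exists [:: s] => //=; rewrite sH. Qed.

Lemma special_sub H K x : {subset H <= K} -> special H x -> special K x.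
Proof. by move=> HK [u uH <-]; exists u => //; apply: sub_all uH. Qed.

Lemma specialT x : special [set: V] x.
Proof. by exists (repr x); [apply/allP => s _;
  rewrite /= inE | exact: elt_repr]. Qed.

(** Special subgroups are undistorted: erasing the letters outside [H] from a geodesic word of [x]
    does not change [x] and cannot lengthen the word. *)
Lemma specialP H x : special H x ->
  exists u, [/\ all (mem H) u, size u = wlen x & elt u = x].
Proof.
move=> /specialE xH; have [u uE ux] := wlenP x.
have fx : elt (seq.filter (mem H) u) = x by rewrite -kill_elt ux.
exists (seq.filter (mem H) u); split=> //; first exact: filter_all.
apply/eqP; rewrite eqn_leq -{2}fx wlen_elt andbT -uE.
by rewrite size_filter count_size.
Qed.

Lemma special_cosetE H x y z : special H (x^-1 * y) ->
  special H (x^-1 * z) <-> special H (y^-1 * z).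
Proof.
move=> xy; split=> [xz|yz].
  have -> : y^-1 * z = (x^-1 * y)^-1 * (x^-1 * z).
    by rewrite invgM invgK -mulgA mulVKg.
  by apply: specialM => //; exact: specialV.
have -> : x^-1 * z = (x^-1 * y) * (y^-1 * z) by rewrite -mulgA mulVKg.
exact: specialM.
Qed.

Lemma special_cosetC H x y : special H (x^-1 * y) -> special H (y^-1 * x).
Proof. by move=> /specialV; rewrite invgM invgK. Qed.

(** Both retractions fix [x], and their composite erases every letter outside the intersection. *)
Lemma special_setI H K x : special H x -> special K x -> special (H :&: K)%SET x.
Proof.
move=> /specialE xH /specialE xK; rewrite -xK -{}xH -(elt_repr x) !kill_elt.
apply: special_elt; apply/allP => s; rewrite !mem_filter /= inE.
by case/and3P=> -> ->.
Qed.

End WordLength.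

Arguments elt {V} e u.

(* Products elaborated through different structures are only convertible: give
   them the same form, so that [lia] identifies the word lengths. *)
Ltac len_lia :=
  repeat match goal with H : context [@wlen _ _ _] |- _ => revert H end;
  repeat match goal with
  | e : rel _ |- context [@monoid.mul ?M ?x ?y] =>
    lazymatch M with
    | Defs_racg__canonical__monoid_Magma _ => fail
    | _ => change (@monoid.mul M x y) with
        (@monoid.mul (Defs_racg__canonical__monoid_Magma e) x y)
    end
  | e : rel _ |- context [@monoid.inv ?M ?x] =>
    lazymatch M with
    | Defs_racg__canonical__monoid_BaseGroup _ => fail
    | _ => change (@monoid.inv M x) with
        (@monoid.inv (Defs_racg__canonical__monoid_BaseGroup e) x)
    end
  end; lia.
Arguments kill {V} e H x.

(** * Commuting special subgroups and centralizers of generators *)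

Section Joins.
Context {V : finType} (e : rel V).
Hypothesis e_irr : irreflexive e.
Local Notation W := (racg e).
Local Open Scope nat_scope.
Local Open Scope group_scope.
Implicit Types (u v w : seq V) (x y z : W) (s t : V) (A B M P : {set V}).

Definition joined A B := forall a b, a \in A -> b \in B -> e a b.

Lemma joined_notin A B s : joined A B -> s \in A -> s \notin B.
Proof. by move=> AB sA; apply/negP => sB; have := AB _ _ sA sB; rewrite e_irr. Qed.

Lemma gen_commute A s x : (forall a, a \in A -> e a s) -> special A x ->
  x * racg_gen e s = racg_gen e s * x.
Proof.
move=> As [u + <-]; elim: u => [|a u IHu] /=; first by rewrite mul1g mulg1.
case/andP=> aA uA; rewrite elt_cons -mulgA IHu // !mulgA.
by rewrite (racg_genC (As a aA)).
Qed.

Lemma joined_commute A B x y : joined A B -> special A x -> special B y ->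
  x * y = y * x.
Proof.
move=> AB xA [v + <-]; elim: v => [|b v IHv] /=; first by rewrite mul1g mulg1.
case/andP=> bB vB; rewrite elt_cons mulgA.
by rewrite (gen_commute (A := A)) ?mulgA // -?mulgA ?IHv // => a aA; exact: AB.
Qed.

Lemma kill_joined A B x : (forall s, s \in A -> s \notin B) -> special A x ->
  kill e B x = 1.
Proof.
move=> AB [u uA <-]; rewrite kill_elt -elt_nil; congr elt.
apply/eqP; rewrite -[_ == _]negbK -has_filter; apply/hasPn => s us.
by apply: AB; move/allP: uA => /(_ s us).
Qed.

Lemma special_join A B x : joined A B -> special (A :|: B)%SET x ->
  x = kill e A x * kill e B x.
Proof.
move=> AB [u + <-]; elim: u => [|s u IHu] /=; first by rewrite !kill1 mul1g.
case/andP=> sAB uAB; rewrite elt_cons !killM {1}(IHu uAB).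
have : s \in (A :|: B)%SET by [].
rewrite finset.in_setU -[racg_gen e s]/(elt e [:: s]) !kill_elt /=.
have [sA _|sA /= sB] := boolP (s \in A).
  by rewrite (negPf (joined_notin AB sA)) elt_nil mul1g mulgA.
rewrite sB elt_nil mul1g !mulgA; congr (_ * _).
apply/esym; apply: (joined_commute AB); first by apply: special_elt;
  exact: filter_all.
by apply: special_elt; rewrite /= sB.
Qed.

(* A left action on a copy of [W_M] and a copy of [W_P], tagged by [true] and
   [false], where [P] is the link of [s] in [M] and [s] exchanges the two copies
   of [W_P]: if [s] commutes with [x], then [s] moves [(x, true)]. *)
Definition link_act M P s t (z : W * bool) : W * bool :=
  if t == s then (z.1, if `[< special P z.1 >] then ~~ z.2 else z.2)
  else if t \in M then
    (if (t \in P) || z.2 then racg_gen e t * z.1 else z.1, z.2)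
  else z.

(** Both sides of [x s = s x] are applied to [(1, true)]. On the left [s] acts first and flips the
    tag, because 1 lies in [W_P]; the letters of [x] are in [M] and keep it. On the right [s] acts
    last, on [(x, true)], and flips the tag only if [x] lies in [W_P]. *)
Lemma special_centralizer (e_sym : symmetric e) M s x : s \notin M ->
  special M x -> racg_gen e s * x = x * racg_gen e s ->
  special [set t in M | e s t]%SET x.
Proof.
move=> sM xM; set P := [set t in M | e s t]%SET.
pose f := link_act M P s.
have PE t : (t \in P) = (t \in M) && e s t by rewrite finset.inE.
have gP t z : t \in P -> special P (racg_gen e t * z) <-> special P z.
  move=> tP; split=> h; last by apply: specialM => //; exact: special_gen.
  rewrite -(mulKg (racg_gen e t) z) racg_genV.
  by apply: specialM => //; exact: special_gen.
have gK t z : racg_gen e t * (racg_gen e t * z) = z.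
  by rewrite -{1}(racg_genV e t) mulKg.
have fK t (z : W * bool) : f t (f t z) = z.
  rewrite /f /link_act; case: z => z b /=; case: eqP => [_|_] /=.
    by case: asboolP => /=; rewrite ?negbK.
  by case: (t \in M) => //=; case: (_ || b); rewrite //= gK.
(* A letter that commutes with [s] either is outside [M] and acts trivially, or lies in [P] and
   multiplies both copies while preserving [W_P]. *)
have fCs t (z : W * bool) : e s t -> f s (f t z) = f t (f s z).
  move=> st; rewrite /f /link_act eqxx; case: z => z b /=.
  have -> : (t == s) = false by apply/eqP => ts; rewrite ts e_irr in st.
  case tM : (t \in M) => //=; have tP : t \in P by rewrite PE tM.
  rewrite tP /=; congr (_, _).
  by have -> : `[< special P (racg_gen e t * z) >] = `[< special P z >]
    by apply: asbool_equiv_eq; exact: gP.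
have fC t t' (z : W * bool) : e t t' -> f t (f t' z) = f t' (f t z).
  have [->|ts] := eqVneq t s; first exact: fCs.
  have [->|t's] := eqVneq t' s.
    by rewrite e_sym => /fCs ->.
  move=> tt'; rewrite /f /link_act (negPf ts) (negPf t's).
  case tM : (t \in M); case t'M : (t' \in M) => //=.
  case: (t \in P); case: (t' \in P); case: z => z [] //=;
    by rewrite !mulgA (racg_genC tt').
move=> sx.
have [u uM ux] := xM.
have : racg_eq e (s :: u) (rcons u s).
  by apply/elt_eq; rewrite elt_cons elt_rcons ux.
move/(racg_eq_foldr fK fC)/(_ (1, true)); rewrite /= foldr_rcons.
have fu : all (mem M) u -> foldr f (1, true) u = (elt e u, true).
  elim: u {uM ux} => //= t u IHu /andP[tM uM]; rewrite IHu // /f /link_act.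
  have -> : (t == s) = false by apply/eqP => ts; rewrite -ts tM in sM.
  by rewrite tM orbT elt_cons.
have fu2 : all (mem M) u -> (foldr f (1, false) u).2 = false.
  elim: u {uM ux fu} => //= t u IHu /andP[tM uM]; rewrite /f /link_act.
  have -> : (t == s) = false by apply/eqP => ts; rewrite -ts tM in sM.
  by rewrite tM /= IHu.
have fs z b : f s (z, b) = (z, if `[< special P z >] then ~~ b else b).
  by rewrite /f /link_act eqxx.
rewrite fu // ux !fs (asboolT (special1 _ P)) /= => /(congr1 snd) /=.
by rewrite fu2 //; case: asboolP.
Qed.

(** The retraction onto [W_M] fixes [s x s], but it also kills [s] and so maps this element to [x].
    Hence [s x s = x], and [s] centralizes [x]. *)
Lemma special_conj_gen (e_sym : symmetric e) M s x : s \notin M ->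
  special M x -> special M (racg_gen e s * x * racg_gen e s) ->
  special [set t in M | e s t]%SET x.
Proof.
move=> sM xM sxM; apply: (special_centralizer e_sym sM xM).
move/specialE: sxM; rewrite !killM.
have -> : kill e M (racg_gen e s) = 1.
  rewrite -[racg_gen e s]/(elt e [:: s]) kill_elt /=.
  by rewrite (negPf sM).
move/specialE: (xM) => ->; rewrite mul1g mulg1 => {2}->.
by rewrite -!mulgA -{4}(racg_genV e s) mulgV mulg1.
Qed.

End Joins.

(** * Alternating words *)

Section Alternating.
Context {V : finType} (e : rel V).
Hypotheses (e_sym : symmetric e) (e_irr : irreflexive e).
Local Notation W := (racg e).
Local Open Scope nat_scope.
Local Open Scope group_scope.
Implicit Types (u v w : seq V) (x y z : W) (s t p q : V).

Definition alt p q n : seq V := mkseq (fun i => if odd i then q else p) n.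

Lemma size_alt p q n : size (alt p q n) = n. Proof. exact: size_mkseq. Qed.

Lemma altS p q n : alt p q n.+1 = rcons (alt p q n) (if odd n then q else p).
Proof. by rewrite /alt -mkseqS. Qed.

Lemma take_alt p q n i : i <= n -> take i (alt p q n) = alt p q i.
Proof. by move=> le_in;
  rewrite /alt /mkseq -map_take take_iota (minn_idPl le_in). Qed.

Lemma all_alt (H : {set V}) p q n : p \in H -> q \in H -> all (mem H) (alt p q n).
Proof.
by move=> pH qH; elim: n => // n IHn; rewrite altS all_rcons IHn; case: odd => /=;
  rewrite ?pH ?qH.
Qed.

(* [p] and [q] act on the line by reflections: [p] exchanges [2k] and [2k+1],
   [q] exchanges [2k-1] and [2k]. *)
Definition line_act p q t (k : int) : int :=
  (if t == p then if odd `|k|%N then k - 1 else k + 1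
   else if t == q then if odd `|k|%N then k + 1 else k - 1
   else k)%R.

Lemma line_act_dist p q u (k : int) :
  (`|foldl (fun k t => line_act p q t k) k u - k| <= (size u)%:Z)%R.
Proof.
elim: u k => [|t u IHu] k /=; first by rewrite subrr.
have : (`|line_act p q t k - k| <= 1)%R.
  by rewrite /line_act; do ?case: ifP => _; lia.
by have := IHu (line_act p q t k); lia.
Qed.

Lemma foldl_alt p q n : p != q ->
  foldl (fun k t => line_act p q t k) 0%R (alt p q n) = n%:Z /\
  foldl (fun k t => line_act p q t k) 0%R (alt q p n) = (- n%:Z)%R.
Proof.
move=> pq; elim: n => // n [IHp IHq].
rewrite !altS !foldl_rcons IHp IHq /line_act.
have E : (`|(- n%:Z)%R| = n)%N by rewrite abszN.
rewrite E absz_nat; case on : (odd n); rewrite ?eqxx ?(eq_sym q p) ?(negPf pq);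
 by split; lia.
Qed.

(** The group acts on the integers through the infinite dihedral group: the reflections [p] and [q]
    need not commute, since [p] and [q] are not adjacent, and all other generators act trivially.
    Words are read from the left, as a right action, whence the reversal. *)
Lemma foldl_line_act_eq p q u v : p != q -> ~~ e p q -> elt e u = elt e v ->
  forall k, foldl (fun k t => line_act p q t k) k u
          = foldl (fun k t => line_act p q t k) k v.
Proof.
move=> pq epq /elt_eq uv k.
rewrite -(revK u) -(revK v) !foldl_rev.
apply: (racg_eq_foldr (e := e)); last exact: racg_eq_rev.
- move=> s z; rewrite /line_act.
  by case: (s == p); case: (s == q) => //; case zo : (odd `|z|%N);
    case: ifP; lia.
- move=> s t z st; rewrite /line_act.
  case sp : (s == p); case tp : (t == p); case sq : (s == q);
    case tq : (t == q) => //; move: epq;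
    first [by rewrite -(eqP sp) -(eqP tq) st
          |by rewrite -(eqP tp) -(eqP sq) e_sym st].
Qed.

(** The two endpoints move 0 to [i] and to [-j], and each letter of a word joining them moves an
    integer by at most 1. *)
Lemma wdist_alt2 p q i j : p != q -> ~~ e p q ->
  i + j <= wlen ((elt e (alt p q i))^-1 * elt e (alt q p j)).
Proof.
move=> pq epq; have [w <- wE] := wlenP ((elt e (alt p q i))^-1 * elt e (alt q p j)).
have : elt e (alt p q i ++ w) = elt e (alt q p j) by rewrite elt_cat wE mulVKg.
move/(foldl_line_act_eq pq epq)/(_ 0%R); rewrite foldl_cat.
have [-> _] := foldl_alt i pq; have [_ ->] := foldl_alt j pq.
by have := line_act_dist p q w i%:Z; lia.
Qed.

Lemma wdist_alt p q i j : p != q -> ~~ e p q ->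
  `|i%:Z - j%:Z|%N <= wlen ((elt e (alt p q i))^-1 * elt e (alt p q j)).
Proof.
move=> pq epq; have [w <- wE] := wlenP ((elt e (alt p q i))^-1 * elt e (alt p q j)).
have : elt e (alt p q i ++ w) = elt e (alt p q j) by rewrite elt_cat wE mulVKg.
move/(foldl_line_act_eq pq epq)/(_ 0%R); rewrite foldl_cat.
have [-> _] := foldl_alt i pq; have [-> _] := foldl_alt j pq.
by have := line_act_dist p q w i%:Z; lia.
Qed.

Lemma wlen_alt p q n : p != q -> ~~ e p q -> wlen (elt e (alt p q n)) = n.
Proof.
move=> pq epq; apply/eqP; rewrite eqn_leq (leq_trans (wlen_elt _ _)) ?size_alt //=.
have := wdist_alt 0 n pq epq; rewrite [alt p q 0]/alt /= elt_nil invg1 mul1g.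
by apply: leq_trans; lia.
Qed.

End Alternating.

(** * Uniform constants and coarse intersections of subgroups *)

Section Finiteness.
Local Open Scope nat_scope.

(** This makes the constants uniform over subsets of [V], pairs of them, or words of bounded
    length. *)
Lemma fin_bound (T : finType) (P : T -> nat -> Prop) :
  (forall t, exists n, P t n) -> (forall t n m, n <= m -> P t n -> P t m) ->
  exists N, forall t, P t N.
Proof.
move=> /choice[f fP] Pmon; exists (\max_t f t) => t.
by apply: Pmon (fP t); exact: leq_bigmax.
Qed.

Context {V : finType} (e : rel V).
Local Notation W := (racg e).
Local Open Scope group_scope.

(* If [x = a c = b d] with [c] and [d] short, fix one solution [a0 c = b0 d] for
   each of the finitely many pairs [(c, d)]: then [a a0^-1 = b b0^-1]. *)
Lemma coarse_intersection (A B : W -> Prop) :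
  (forall x y, A x -> A y -> A (x * y^-1)) ->
  (forall x y, B x -> B y -> B (x * y^-1)) -> forall n, exists D, forall x,
  (exists2 a, A a & wlen (a^-1 * x) <= n) ->
  (exists2 b, B b & wlen (b^-1 * x) <= n) ->
  exists z, [/\ A z, B z & wlen (z^-1 * x) <= D].
Proof.
move=> AV BV n.
have [|t k l kl [h|[a [b [Aa Bb ab al]]]]|D DP] :=
  @fin_bound (n.-bseq V * n.-bseq V)%type (fun t D =>
  (~ exists a b, [/\ A a, B b & a * elt e t.1 = b * elt e t.2]) \/
  exists a b, [/\ A a, B b, a * elt e t.1 = b * elt e t.2 & wlen a <= D]).
- move=> t; have [[a [b [Aa Bb ab]]]|] :=
    pselect (exists a b, [/\ A a, B b & a * elt e t.1 = b * elt e t.2]).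
    by exists (wlen a); right; exists a, b.
  by exists 0; left.
- by left.
- by right; exists a, b; split=> //; exact: leq_trans kl.
exists (D + n) => x [a Aa ax] [b Bb bx].
have [c cs cE] := wlenP (a^-1 * x); have [d ds dE] := wlenP (b^-1 * x).
rewrite -cs in ax; rewrite -ds in bx.
case: (DP (Bseq ax, Bseq bx)) => /= [[]|[a0 [b0 [Aa0 Bb0 ab0 a0D]]]].
  by exists a, b; split=> //; rewrite cE dE !mulVKg.
exists (a * a0^-1); split; first exact: AV.
- have -> : a * a0^-1 = b * b0^-1; last exact: BV.
  rewrite -(mulgK (elt e c) a) -(mulgK (elt e d) b) -!mulgA -!invgM ab0.
  by rewrite !mulgA cE dE !mulVKg.
- rewrite invgM invgK -mulgA -cE.
  by rewrite (leq_trans (wlenM _ _)) // leq_add // (leq_trans (wlen_elt _ _)).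
Qed.

End Finiteness.

(** * Hyperedges *)

Section Hyperedges.
Context {V : finType} (e : rel V).
Hypotheses (e_sym : symmetric e) (e_irr : irreflexive e).
Local Open Scope nat_scope.
Local Open Scope set_scope.
Implicit Types (p q s k : V) (A B H K L M U : {set V}) (E : {set {set V}}).

Lemma has_nonadjP A : reflect (exists p q, [/\ p \in A, q \in A, p != q & ~~ e p q])
  (has_nonadj e A).
Proof.
apply: (iffP existsP) => [[p /andP[pA /existsP[q /and3P[qA pq epq]]]]|].
  by exists p, q.
by case=> p [q [pA qA pq epq]]; exists p; rewrite pA; apply/existsP; exists q;
  rewrite qA pq.
Qed.

Lemma has_nonadj_sub A B : A \subset B -> has_nonadj e A -> has_nonadj e B.
Proof.
move=> /fintype.subsetP AB /has_nonadjP[p [q [pA qA pq epq]]].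
by apply/has_nonadjP; exists p, q; split=> //; exact: AB.
Qed.

Lemma is_joinP L A B : reflect (L = A :|: B /\ joined e A B) (is_join e L A B).
Proof.
apply: (iffP andP) => [[/eqP -> /forallP AB]|[-> AB]]; split=> //.
- move=> a b aA bB; have /implyP/(_ aA)/forallP/(_ b)/implyP := AB a.
  exact.
- apply/forallP => a; apply/implyP => aA; apply/forallP => b; apply/implyP => bB.
  exact: AB.
Qed.

Lemma wide_formP L : reflect (exists A B,
    [/\ L = A :|: B, joined e A B, has_nonadj e A & has_nonadj e B])
  (wide_form e L).
Proof.
apply: (iffP existsP) => [[A /existsP[B /and3P[/is_joinP[LE AB] nA nB]]]|].
  by exists A, B.
case=> A [B [LE AB nA nB]]; exists A; apply/existsP; exists B.
by rewrite nA nB !andbT; apply/is_joinP.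
Qed.

Definition strip_of L p q K : Prop :=
  [/\ p != q, ~~ e p q, L = [set p; q] :|: K, K != finset.set0 /\ is_clique e K
    & forall k, k \in K -> e p k && e q k].

Lemma is_cliqueP K :
  reflect {in K &, forall k l, k != l -> e k l} (is_clique e K).
Proof.
apply: (iffP forallP) => [Kcl k l kK lK kl|Kcl k].
  have /implyP/(_ kK)/forallP/(_ l)/implyP/(_ lK)/implyP := Kcl k; exact.
apply/implyP => kK; apply/forallP => l; apply/implyP => lK; apply/implyP.
exact: Kcl.
Qed.

Lemma strip_formP L :
  reflect (exists p q K, strip_of L p q K) (strip_form e L).
Proof.
apply: (iffP existsP) => [[A /existsP[K]]|[p [q [K [pq epq LE [K0 Kcl] Kadj]]]]].
  case/and5P=> /is_joinP[LE AK] /cards2P[p [q [pq AE]]] /has_nonadjP.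
  rewrite AE => -[p' [q' [p'A q'A pq' epq']]] K0 Kcl; exists p, q, K; split=> //.
  - have := epq'; have := pq'; move: p'A q'A; rewrite !finset.inE.
    by case/orP=> /eqP -> /orP[] /eqP ->; rewrite ?eqxx // e_sym.
  - by rewrite LE AE.
  - by move=> k kK; rewrite !AK // AE !finset.inE eqxx ?orbT.
exists [set p; q]; apply/existsP; exists K.
rewrite K0 Kcl cards2 pq /= andbT; apply/andP; split.
  apply/is_joinP; split=> // a k; rewrite !finset.inE.
  by case/orP=> /eqP -> /Kadj/andP[].
by apply/has_nonadjP; exists p, q; rewrite !finset.inE !eqxx ?orbT.
Qed.

(** A vertex of [K] is adjacent to every other vertex of the strip, so [p], [q] is the only
    non-adjacent pair. *)
Lemma strip_nonadj L p q K r s : strip_of L p q K ->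
  r \in L -> s \in L -> r != s -> ~~ e r s ->
  (r = p /\ s = q) \/ (r = q /\ s = p).
Proof.
move=> [pq epq -> [_ /is_cliqueP Kcl] Kadj].
rewrite !finset.inE => /orP[rA|rK] /orP[sA|sK] rs ers.
- case/orP: rA => /eqP rE; case/orP: sA => /eqP sE; subst r s;
    by [left|right|rewrite eqxx in rs].
- have /andP[ps qs] := Kadj _ sK.
  by move: ers; case/orP: rA => /eqP ->; rewrite ?ps ?qs.
- have /andP[ps qs] := Kadj _ rK.
  by move: ers; case/orP: sA => /eqP ->; rewrite e_sym ?ps ?qs.
- by rewrite (Kcl _ _ rK sK rs) in ers.
Qed.

(** The hyperedges for which thickness and divergence are established; by [Lambda_good_or_strip]
    every other hyperedge of any [Lambda_i] is still an element of [Psi]. *)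
Definition good H : bool := [exists M in Omega e, M \subset H].

Lemma Omega_wide M : M \in Omega e -> wide_form e M.
Proof. by rewrite finset.inE => /maxsetp. Qed.

Lemma Omega_good M : M \in Omega e -> good M.
Proof. by move=> MO; apply/existsP; exists M; rewrite MO subxx. Qed.

Lemma good_sub H K : H \subset K -> good H -> good K.
Proof.
move=> HK /existsP[M /andP[MO MH]]; apply/existsP; exists M.
by rewrite MO (fintype.subset_trans MH HK).
Qed.

Lemma good_nonadj H : good H -> has_nonadj e H.
Proof.
case/existsP=> M /andP[/Omega_wide/wide_formP[A [B [-> _ nA _]]] MH].
apply: has_nonadj_sub nA; apply: fintype.subset_trans MH; exact: finset.subsetUl.
Qed.

Lemma wide_in_Omega L : wide_form e L -> exists2 M, M \in Omega e & L \subset M.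
Proof. by move=> /maxset_exists[M Mmax LM]; exists M; rewrite ?finset.inE. Qed.

(** A wide subgraph contains two disjoint non-adjacent pairs, one in each factor, and a strip has
    only one such pair. *)
Lemma strip_not_wide L M : strip_form e L -> wide_form e M -> ~~ (M \subset L).
Proof.
move=> /strip_formP[p [q [K Lstr]]] /wide_formP[A [B [ME AB nA nB]]].
apply/negP => /fintype.subsetP ML.
have [a [a' [aA a'A aa' eaa']]] := has_nonadjP _ nA.
have [b [b' [bB b'B bb' ebb']]] := has_nonadjP _ nB.
have AL c : c \in A -> c \in L by move=> cA; apply: ML; rewrite ME finset.inE cA.
have BL c : c \in B -> c \in L.
  by move=> cB; apply: ML; rewrite ME finset.inE cB orbT.
suff bA : b \in A by have := AB _ _ bA bB; rewrite e_irr.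
have := strip_nonadj Lstr (AL _ aA) (AL _ a'A) aa' eaa'.
have := strip_nonadj Lstr (BL _ bB) (BL _ b'B) bb' ebb'.
by move=> [[-> _]|[-> _]] [[pE qE]|[qE pE]]; rewrite -?pE -?qE.
Qed.

Lemma Psi_strip H : H \in Psi e -> strip_form e H.
Proof. by rewrite finset.inE => /andP[/maxsetp]. Qed.

Lemma Psi_not_good H : H \in Psi e -> ~~ good H.
Proof.
move=> /Psi_strip Hs; apply/negP => /existsP[M /andP[/Omega_wide Mw MH]].
by move: (strip_not_wide Hs Mw); rewrite MH.
Qed.

(** Linked strips share their non-adjacent pair, so their union is the join of [{p, q}] with the
    union of [K] and [K']. If the latter is a clique, the union is a strip and maximality gives
    [H = H']. Otherwise the union is wide, and [H] would be properly contained in an element of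
    [Omega]. *)
Lemma Psi_linked H H' : H \in Psi e -> H' \in Psi e ->
  has_nonadj e (H :&: H') -> H = H'.
Proof.
move=> HP H'P /has_nonadjP[r [s [+ + rs ers]]].
rewrite !finset.inE => /andP[rH rH'] /andP[sH sH'].
have [p [q [K Hs]]] := strip_formP _ (Psi_strip HP).
have [p' [q' [K' Hs']]] := strip_formP _ (Psi_strip H'P).
have pqE : [set p; q] = [set p'; q'].
  have rsE : [set r; s] = [set p; q].
    by case: (strip_nonadj Hs rH sH rs ers) => -[-> ->] //; rewrite finset.setUC.
  rewrite -rsE.
  by case: (strip_nonadj Hs' rH' sH' rs ers) => -[-> ->] //; rewrite finset.setUC.
have [pq epq HE [K0 Kcl] Kadj] := Hs; have [_ _ H'E [K'0 K'cl] K'adj] := Hs'.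
have K'adj2 k : k \in K' -> e p k && e q k.
  move=> /K'adj/andP[pk qk].
  have : p \in [set p'; q'] by rewrite -pqE !finset.inE eqxx.
  have : q \in [set p'; q'] by rewrite -pqE !finset.inE eqxx orbT.
  by rewrite !finset.inE => /orP[]/eqP -> /orP[]/eqP ->; rewrite ?pk ?qk.
have UE : H :|: H' = [set p; q] :|: (K :|: K').
  rewrite HE H'E -pqE; apply/finset.setP => x; rewrite !finset.inE.
  by case: (x == p); case: (x == q); case: (x \in K); case: (x \in K').
have joinU : joined e [set p; q] (K :|: K').
  move=> a k; rewrite !finset.inE => aE kE.
  have /andP[pk qk] : e p k && e q k by case/orP: kE => [/Kadj|/K'adj2].
  by case/orP: aE => /eqP ->.
have [Ucl|] := boolP (is_clique e (K :|: K')).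
  have Us : strip_form e (H :|: H').
    apply/strip_formP; exists p, q, (K :|: K'); split=> //.
      split=> //; apply/negP => /eqP K0'; case/finset.set0Pn: K0 => k kK.
      by move/finset.setP/(_ k): K0'; rewrite !finset.inE kK.
    by move=> k kU; rewrite !joinU // !finset.inE eqxx ?orbT.
  move: HP H'P; rewrite !finset.inE => /andP[/maxsetP[_ Hm] _].
  move=> /andP[/maxsetP[_ H'm] _].
  by rewrite -[LHS](Hm _ Us (finset.subsetUl _ _)) -[RHS](H'm _ Us (finset.subsetUr
    _ _)).
move=> /forallPn[k]; rewrite negb_imply => /andP[kU /forallPn[l]].
rewrite !negb_imply => /and3P[lU kl ekl].
have Uw : wide_form e (H :|: H').
  apply/wide_formP; exists [set p; q], (K :|: K'); split=> //.
    by apply/has_nonadjP; exists p, q; rewrite !finset.inE !eqxx ?orbT.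
  by apply/has_nonadjP; exists k, l.
have [M MO UM] := wide_in_Omega Uw.
move: HP; rewrite finset.inE => /andP[_ /forallP/(_ M)]; rewrite MO /=.
case/negP; apply/properP; split.
  by apply: fintype.subset_trans UM; exact: finset.subsetUl.
have nMH := strip_not_wide (introT (strip_formP _) (ex_intro _ p (ex_intro _ q
  (ex_intro _ K Hs)))) (Omega_wide MO).
by have [x xM xH] := fintype.subsetPn nMH; exists x.
Qed.

Lemma linked_sym E : symmetric (linked e E).
Proof. by move=> H H'; rewrite /linked /= finset.setIC andbCA. Qed.

Lemma connect_linked_sym E : connect_sym (linked e E).
Proof. by apply: sym_connect_sym; exact: linked_sym. Qed.

Definition hyperclass E H : {set V} :=
  \bigcup_(H' in E | connect (linked e E) H H') H'.

Definition good_or_strip E := forall H, H \in E -> good H \/ H \in Psi e.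

(** By [Psi_linked] a class made of strips only has a single member. *)
Lemma class_of_strips E H : good_or_strip E -> H \in E ->
  (forall H', H' \in E -> connect (linked e E) H H' -> ~~ good H') ->
  hyperclass E H = H.
Proof.
move=> Egs HE noH.
have inPsi H' : H' \in E -> connect (linked e E) H H' -> H' \in Psi e.
  by move=> H'E HH'; case: (Egs _ H'E) => // gH'; move: (noH _ H'E HH');
    rewrite gH'.
have eqH H' : connect (linked e E) H H' -> H' = H.
  case/connectP=> c; elim/last_ind: c H' => [|c L IHc] H' /=; first by move=> _ ->.
  rewrite rcons_path last_rcons => /andP[Hc lastL] ->.
  have lE := IHc _ Hc erefl; rewrite lE in lastL.
  case/and3P: (lastL) => _ LE nHL; apply/esym/Psi_linked => //.
    by apply: inPsi.
  by apply: inPsi => //; exact: connect1.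
apply/eqP; rewrite finset.eqEsubset; apply/andP; split.
  by apply/bigcupsP => H' /andP[_ /eqH ->].
by apply: (finset.bigcup_sup H); rewrite HE connect0.
Qed.

Lemma hyperclass_in E H H' : H' \in E -> connect (linked e E) H H' ->
  H' \subset hyperclass E H.
Proof. by move=> H'E HH'; apply: (finset.bigcup_sup H'); rewrite H'E. Qed.

(** A class either has a good member, hence a good union, or is a single strip that passes unchanged
    to the next hypergraph. *)
Lemma Lambda_good_or_strip i : good_or_strip (Lambda e i).
Proof.
elim: i => [|i IHi] H; rewrite /Lambda /=.
  by rewrite finset.inE => /orP[/Omega_good|]; [left|right].
case/imsetP=> H0 H0E ->; rewrite -/(Lambda e i) in H0E *.
rewrite -/(hyperclass _ _).
have [/existsP[H1 /and3P[H1E H01 gH1]]|] :=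
  boolP [exists H1, [&& H1 \in Lambda e i, connect (linked e (Lambda e i)) H0 H1
                     & good H1]].
  by left; apply: good_sub gH1; exact: hyperclass_in.
move=> /existsPn noH; rewrite class_of_strips //.
  case: (IHi _ H0E) => // gH0; first by left.
  by right.
move=> H' H'E H0H'; apply/negP => gH'.
by move: (noH H'); rewrite H'E H0H' gH'.
Qed.

(** A class without good member would be a single hyperedge, equal to its union and therefore not
    good. *)
Lemma Lambda_good_succ i H : H \in Lambda e i.+1 -> good H ->
  exists H1, [/\ H1 \in Lambda e i, good H1 & H = hyperclass (Lambda e i) H1].
Proof.
case/imsetP=> H0 H0E; rewrite -/(Lambda e i) in H0E *; set E := Lambda e i.
rewrite -/(hyperclass _ _) => HE gH.
have [/existsP[H1 /and3P[H1E H01 gH1]]|] :=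
  boolP [exists H1, [&& H1 \in E, connect (linked e E) H0 H1 & good H1]].
  exists H1; split=> //; rewrite HE; apply: eq_bigl => H'.
  by rewrite (same_connect (@connect_linked_sym E) H01).
move=> /existsPn noH; have H0U : hyperclass E H0 = H0.
  apply: class_of_strips => //; first exact: Lambda_good_or_strip.
  by move=> H' H'E H0H'; apply/negP => gH'; move: (noH H'); rewrite H'E H0H' gH'.
have gH0 : good H0 by rewrite -H0U -HE.
by move: (noH H0); rewrite H0E connect0 gH0.
Qed.

Lemma Lambda0_good H : H \in Lambda e 0 -> good H -> H \in Omega e.
Proof.
by rewrite /Lambda /= finset.inE => /orP[//|/Psi_not_good/negPf ->].
Qed.

Definition good_linked E : rel {set V} :=
  [rel H H' | [&& linked e E H H', good H & good H']].

(* A strip has a single pair of non-adjacent vertices, hence two good hyperedges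
   that are linked through strips are linked. *)
Lemma connect_good_linked E H1 H : good_or_strip E -> H1 \in E -> good H1 ->
  connect (linked e E) H1 H ->
  exists H0, [/\ H0 \in E, good H0, connect (good_linked E) H1 H0,
    good H -> H0 = H
  & forall r s, r \in H -> s \in H -> r != s -> ~~ e r s -> r \in H0 /\ s \in H0].
Proof.
move=> Egs H1E gH1 /connectP[c]; elim/last_ind: c H => [|c L IHc] H /=.
  by move=> _ ->; exists H1; split=> //; exact: connect0.
rewrite rcons_path last_rcons => /andP[Hc]; set H' := last H1 c => lL ->.
have [H0 [H0E gH0 c0 H0g H0str]] := IHc _ Hc erefl.
case/and3P: lL => H'E LE /has_nonadjP[r [s [+ + rs ers]]].
rewrite !finset.inE => /andP[rH' rL] /andP[sH' sL].
have [rH0 sH0] := H0str _ _ rH' sH' rs ers.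
have nH0L : has_nonadj e (H0 :&: L).
  by apply/has_nonadjP; exists r, s; rewrite !finset.inE rH0 sH0 rL sL.
have [gL|gL] := boolP (good L).
  exists L; split=> //; apply: connect_trans c0 (connect1 _).
  by rewrite /good_linked /linked /= H0E LE nH0L gH0 gL.
(* [L] is a strip: [H0] is kept, since the only non-adjacent pair of [L] is [{r, s}], which lies in
   [H0]. *)
exists H0; split=> [||||r' s' r'L s'L rs' ers'] //.
have LP : L \in Psi e by case: (Egs _ LE) => // gL'; rewrite gL' in gL.
have [p [q [K Ls]]] := strip_formP _ (Psi_strip LP).
case: (strip_nonadj Ls rL sL rs ers) => -[rE sE];
by case: (strip_nonadj Ls r'L s'L rs' ers') => -[-> ->]; rewrite -?rE -?sE.
Qed.

End Hyperedges.

(** * Chains of cosets *)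

Section Chains.
Context (T : Type) (r : T -> T -> Prop).
Local Open Scope nat_scope.

(** The number is only an upper bound for the number of steps, whence [chain_nil] for every [n]. *)
Inductive chain : nat -> T -> T -> Prop :=
| chain_nil n x : chain n x x
| chain_cons n x y z : r x y -> chain n y z -> chain n.+1 x z.

Lemma chain_mon n m x y : n <= m -> chain n x y -> chain m x y.
Proof.
move=> + xy; elim: xy m => {n x y} [n x|n x y z xy _ IH] [|m] // nm.
- exact: chain_nil.
- exact: chain_nil.
- by apply: chain_cons xy _; exact: IH.
Qed.

Lemma chain_trans n m x y z : chain n x y -> chain m y z -> chain (n + m) x z.
Proof.
elim=> {n x y} [n x|n x y w xy _ IH] yz; first exact: chain_mon (leq_addl _ _) yz.
by rewrite addSn; apply: chain_cons xy _; exact: IH.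
Qed.

Lemma chain1 x y : r x y -> chain 1 x y.
Proof. by move=> xy; apply: chain_cons xy (chain_nil _ _). Qed.

Lemma chain_fun n x y : chain n x y -> exists m (a : nat -> T),
  [/\ m <= n, a 0 = x, a m = y & forall i, i < m -> r (a i) (a i.+1)].
Proof.
elim=> {n x y} [n x|n x y z xy _ [m [a [mn a0 am ar]]]].
  by exists 0, (fun=> x).
exists m.+1, (fun i => if i is j.+1 then a j else x); split=> //.
by case=> [|i] /=; [rewrite a0|exact: ar].
Qed.

End Chains.

Section CosetLinks.
Context {V : finType} (e : rel V).
Hypotheses (e_sym : symmetric e) (e_irr : irreflexive e).
Local Notation W := (racg e).
Local Open Scope nat_scope.
Local Open Scope group_scope.
Implicit Types (p q s : V) (H U : {set V}) (E : {set {set V}}) (x y : W).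

(* A pair [(H, x)] stands for the coset [x W_H]. *)
Definition coset_link (cls : pred {set V}) U (a b : {set V} * W) : Prop :=
  [/\ cls a.1, cls b.1 & exists p q, [/\ p != q, ~~ e p q,
    p \in a.1 :&: b.1, q \in a.1 :&: b.1 &
    b.2 = a.2 \/ (a.1 = b.1 /\ exists s,
      [/\ s \in U, b.2 = a.2 * racg_gen e s & s \in a.1 \/ (e p s /\ e q s)])]]%SET.

Definition good_class E H : pred {set V} := fun H' =>
  [&& H' \in E, good e H' & connect (linked e E) H H'].

(** Before each letter [s] of [u], pass at a fixed base point to a good hyperedge for which
    multiplication by [s] is a link. Passing costs at most [c0], a bound over finitely many pairs of
    hyperedges, and the letter costs 1, so [c = c0 + 1]. *)
Lemma coset_chain E H : good_or_strip e E -> H \in E -> good e H ->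
  exists c, forall H1 H2 u x, good_class E H H1 -> good_class E H H2 ->
    all (mem (hyperclass e E H)) u ->
    chain (coset_link (good_class E H) (hyperclass e E H))
      (c * (size u).+1) (H1, x) (H2, x * elt e u).
Proof.
move=> Egs HE gH; set U := hyperclass e E H; set cls := good_class E H.
set lnk := coset_link cls U.
have cls_sub H1 s : cls H1 -> s \in H1 -> s \in U.
  case/and3P=> H1E _ HH1 sH1; have /fintype.subsetP := hyperclass_in H1E HH1.
  exact.
have base : exists c, forall (t : {set V} * {set V}), cls t.1 -> cls t.2 ->
    forall x, chain lnk c (t.1, x) (t.2, x).
  apply: fin_bound => [[H1 H2]|[H1 H2] n m nm h c1 c2 x] /=; last first.
    by apply: chain_mon nm _; exact: h.
  have [/andP[c1 c2]|ncls] := boolP (cls H1 && cls H2); last first.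
    by exists 0 => c1 c2; rewrite c1 c2 in ncls.
  case/and3P: (c1) => H1E gH1 HH1; case/and3P: (c2) => H2E gH2 HH2.
  have H12 : connect (linked e E) H1 H2.
    by apply: connect_trans HH2; rewrite connect_linked_sym.
  have [H0 [_ _ + /(_ gH2) H0E _]] := connect_good_linked e_sym Egs H1E gH1 H12.
  rewrite H0E; case/connectP=> d;
    elim: d H1 c1 {HH1 H12 H1E gH1} => [|L d IHd] H1 c1 /=.
    by move=> _ ->; exists 0 => *; exact: chain_nil.
  case/andP=> /and3P[/and3P[H1E LE nHL] gH1 gL] Ld dE.
  have cL : cls L.
    rewrite /cls /good_class LE gL; case/and3P: (c1) => _ _ HH1.
    by apply: connect_trans HH1 (connect1 _); rewrite /linked /= H1E LE.
  have [n nP] := IHd _ cL Ld dE; exists n.+1 => _ _ x.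
  apply: (@chain_cons _ _ _ _ (L, x)); last exact: nP.
  split=> //=; have [p [q [pHL qHL pq epq]]] := has_nonadjP _ _ nHL.
  by exists p, q; split=> //; left.
case: base => c0 c0P.
have step s : s \in U -> exists H0, cls H0 /\
    forall x, lnk (H0, x) (H0, x * racg_gen e s).
  move=> sU; have := sU; rewrite /U /hyperclass.
  case/finset.bigcupP=> H3 /andP[H3E HH3] sH3.
  have [H0 [H0E gH0 c1 H0g H0str]] := connect_good_linked e_sym Egs HE gH HH3.
  have cls0 : cls H0.
    rewrite /cls /good_class H0E gH0; apply: connect_sub c1 => A B /and3P[AB _ _].
    exact: connect1.
  exists H0; split=> // x; split=> //=.
  case: (Egs _ H3E) => [/H0g H03|].
    have [p [q [pH qH pq epq]]] := has_nonadjP _ _ (good_nonadj gH0).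
    exists p, q; rewrite finset.setIid; split=> //; right; split=> //.
    by exists s; split=> //; left; rewrite H03.
  (* [s] comes from a strip whose pair [p], [q] lies in the good hyperedge [H0]: either [s] is one
     of them, or it lies in the clique and commutes with both. *)
  move=> /Psi_strip/(strip_formP e_sym)[p [q [K [pq epq H3str [_ _] Kadj]]]].
  have [pH0 qH0] : p \in H0 /\ q \in H0.
    by apply: H0str => //; rewrite H3str !finset.inE eqxx ?orbT.
  exists p, q; rewrite finset.setIid; split=> //; right; split=> //.
  exists s; split=> //; move: sH3; rewrite H3str !finset.inE -orbA.
  case/or3P=> [/eqP ->|/eqP ->|/Kadj/andP[]]; by [left|right].
exists (c0 + 1) => H1 H2 u x cH1 cH2; elim: u H1 x cH1 => [|s u IHu] H1 x cH1 /=.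
  move=> _; rewrite elt_nil mulg1 muln1.
  by apply: chain_mon (c0P (H1, H2) cH1 cH2 x); exact: leq_addr.
case/andP=> sU uU; have [H0 [cH0 lH0]] := step s sU.
rewrite elt_cons mulgA mulnS; apply: chain_trans (IHu H0 _ cH0 uU).
by apply: chain_trans (c0P (H1, H0) cH1 cH0 x) (chain1 (lH0 x)).
Qed.

(* The coarse intersection of linked cosets is a coset of a special subgroup. *)
Lemma coset_link_special cls U H1 x H2 y :
  coset_link cls U (H1, x) (H2, y) -> exists P : {set V},
    [/\ P \subset H1,
        forall z, special P z -> special H2 ((x^-1 * y)^-1 * z * (x^-1 * y))
      & forall z, special H1 z -> special H2 ((x^-1 * y)^-1 * z * (x^-1 * y)) ->
        special P z].
Proof.
case=> _ _ [p [q [pq epq _ _]]] /= [->|[<- [s [sU -> sE]]]].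
  rewrite mulVg; exists (H1 :&: H2)%SET; split; first exact: finset.subsetIl.
    move=> z; rewrite invg1 mul1g mulg1; apply: special_sub => t.
    by rewrite finset.inE => /andP[].
  by move=> z zH1; rewrite invg1 mul1g mulg1 => zH2; exact: special_setI.
rewrite mulKg racg_genV.
have [sH1|sH1] := boolP (s \in H1).
  exists H1; split=> // z zH1; have sg := special_gen e sH1.
  by apply: specialM => //; apply: specialM.
(* For [s] outside [H1], the subgroup [W_H1] and its conjugate by [s] meet in the subgroup generated
   by the link of [s] in [H1]. *)
exists [set t in H1 | e s t]%SET; split.
- by apply/fintype.subsetP => t; rewrite finset.inE => /andP[].
- move=> z zP; rewrite -(gen_commute (A := [set t in H1 | e s t]%SET)) //.
    rewrite -mulgA -{2}(racg_genV e s) mulgV mulg1.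
    by apply: special_sub zP => t; rewrite finset.inE => /andP[].
  by move=> t; rewrite finset.inE e_sym => /andP[].
- by move=> z; exact: special_conj_gen.
Qed.

End CosetLinks.

Arguments coset_link {V} e cls U a b.

(** * Words avoiding a ball *)

Section Avoiding.
Context {V : finType} (e : rel V).
Hypotheses (e_sym : symmetric e) (e_irr : irreflexive e).
Local Notation W := (racg e).
Local Open Scope nat_scope.
Local Open Scope group_scope.
Implicit Types (p q s : V) (H U A B : {set V}) (E : {set {set V}}).
Implicit Types (a b x y z : W) (u v w : seq V) (m n : nat).

(** The ball is centred at 1. For [i] beyond the length of [u] the prefix is [u] itself, so the
    endpoint is included. *)
Definition avoids m a u := forall i, m <= wlen (a * elt e (take i u)).

Lemma avoids_nil m a : m <= wlen a -> avoids m a [::].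
Proof. by move=> ma i; rewrite /= elt_nil mulg1. Qed.

Lemma avoids_cat m a u v : avoids m a u -> avoids m (a * elt e u) v ->
  avoids m a (u ++ v).
Proof.
move=> au av i; rewrite take_cat; case: ltnP => _; first exact: au.
by rewrite elt_cat mulgA; exact: av.
Qed.

Lemma avoids_kill A m a u : (forall i, m <= wlen (kill e A (a * elt e (take i u))))
  ->
  avoids m a u.
Proof. by move=> mA i; rewrite (leq_trans (mA i)) // wlen_kill. Qed.

Lemma avoids_far m n a u : n + m <= wlen a -> size u <= n -> avoids m a u.
Proof.
move=> na un i; have := wlen_divl a (elt e (take i u)).
have := wlen_elt e (take i u); rewrite size_take.
by case: ltnP => ? ? ?; len_lia.
Qed.

(* The two rays issuing from [a] form a geodesic, hence they do not both meet the
   ball of radius half the length of [a]. *)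
Lemma ray_avoiding p q m a : p != q -> ~~ e p q -> (2 * m)%N <= wlen a ->
  exists p' q', [/\ [set p'; q']%SET = [set p; q]%SET, p' != q', ~~ e p' q' &
    forall i, m <= wlen (a * elt e (alt p' q' i))].
Proof.
move=> pq epq ma.
have [h|/existsNP[i /negP]] := pselect (forall i, m <= wlen (a * elt e (alt p q
  i))).
  by exists p, q.
rewrite -ltnNge => im; exists q, p.
split; [by rewrite finset.setUC|by rewrite eq_sym|by rewrite e_sym|].
move=> j; rewrite leqNgt; apply/negP => jm.
have := wdist_alt2 e_sym i j pq epq.
have := wdist_triangle a^-1 (elt e (alt p q i)) (elt e (alt q p j)).
rewrite -invgM wlenV invgK.
have := wlen_divl a (elt e (alt p q i)); have := wlen_divl a (elt e (alt q p j)).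
have := wlen_elt e (alt p q i); have := wlen_elt e (alt q p j).
rewrite !size_alt. len_lia.
Qed.

(** The factor 2 between the distance of the endpoints and the radius is what [ray_avoiding] needs.
    Only the endpoints have to lie in one coset of [W_H]; the word [u] may leave it. *)
Definition div_bound H (K k : nat) := forall (N m : nat) a b,
  special H (a^-1 * b) -> wlen (a^-1 * b) <= N -> (2 * m)%N <= wlen a ->
  (2 * m)%N <= wlen b -> exists u,
  [/\ a * elt e u = b, (size u <= K * N.+1 ^ k.+1)%N & avoids m a u].

(* The word [w v0 v w^-1 u0 v^-1] with [w] and [v] long rays in the two factors:
   along [w] and [v] use [ray_avoiding], in between the projection to one of the
   factors is large. *)
Lemma div_bound_wide M : wide_form e M -> div_bound M 26 0.
Proof.
move=> /wide_formP[A [B [ME AB /has_nonadjP[p [q [pA qA pq epq]]]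
  /has_nonadjP[r [s [rB sB rs ers]]]]]] N m a b abM abN ma mb.
have [far|near] := leqP (N + m) (wlen a).
  have [u usz ux] := wlenP (a^-1 * b); exists u; split.
  - by rewrite ux mulVKg.
  - by rewrite usz expn1; move: abN; clear; lia.
  - by apply: avoids_far far _; rewrite usz.
have BA : joined e B A by move=> x y xB yA; rewrite e_sym; exact: AB.
have nAB t : t \in A -> t \notin B by exact: joined_notin.
have nBA t : t \in B -> t \notin A by exact: joined_notin.
rewrite ME in abM; have xE := special_join e_irr AB abM.
have [u0 [u0A u0s u0E]] := specialP (special_kill A (a^-1 * b)).
have [v0 [v0B v0s v0E]] := specialP (special_kill B (a^-1 * b)).
have u0N : size u0 <= N by rewrite u0s (leq_trans (wlen_kill _ _)).
have v0N : size v0 <= N by rewrite v0s (leq_trans (wlen_kill _ _)).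
rewrite -u0E -v0E in xE.
have bE : b = a * (elt e u0 * elt e v0) by rewrite -xE mulVKg.
have [p' [q' [pqE pq' epq' w_ray]]] := ray_avoiding pq epq ma.
have [r' [s' [rsE rs' ers' v_ray]]] := ray_avoiding rs ers mb.
have [p'A q'A] : p' \in A /\ q' \in A.
  have sub t : t \in [set p'; q']%SET -> t \in A.
    by rewrite pqE !finset.inE => /orP[]/eqP ->.
  by split; apply: sub; rewrite !finset.inE eqxx ?orbT.
have [r'B s'B] : r' \in B /\ s' \in B.
  have sub t : t \in [set r'; s']%SET -> t \in B.
    by rewrite rsE !finset.inE => /orP[]/eqP ->.
  by split; apply: sub; rewrite !finset.inE eqxx ?orbT.
(* Here [2 m <= |a| < N + m], so [m < N] and [|a| < 2 N]. A ray of length [6 N] keeps one projection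
   farther than [m] from 1, even after multiplication by the projection of [a] and by [v0], of
   length at most [N]. Four such rays together with [u0] and [v0] have at most [26 N] letters. *)
set w := alt p' q' (6 * N); set v := alt r' s' (6 * N).
have wA : all (mem A) w by exact: all_alt.
have vB : all (mem B) v by exact: all_alt.
have wlenw : wlen (elt e w) = (6 * N)%N by exact: wlen_alt.
have wlenv : wlen (elt e v) = (6 * N)%N by exact: wlen_alt.
have sA u : all (mem A) u -> special A (elt e u) by exact: special_elt.
have sB' u : all (mem B) u -> special B (elt e u) by exact: special_elt.
have comm x y : special A x -> special B y -> x * y = y * x.
  exact: joined_commute.
have killBA u : all (mem A) u -> kill e B (elt e u) = 1.
  by move=> uA; apply: (kill_joined nAB); exact: sA.
have killAB u : all (mem B) u -> kill e A (elt e u) = 1.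
  by move=> uB; apply: (kill_joined nBA); exact: sB'.
have killAA u : all (mem A) u -> kill e A (elt e u) = elt e u.
  by move=> uA; apply/specialE/sA.
have killBB u : all (mem B) u -> kill e B (elt e u) = elt e u.
  by move=> uB; apply/specialE/sB'.
have take_all (H : {set V}) i u : all (mem H) u -> all (mem H) (take i u).
  by move=> /allP uH; apply/allP => t /mem_take; exact: uH.
have loop : elt e w * elt e (v0 ++ v) * elt e (rev w ++ u0) =
    elt e u0 * elt e v0 * elt e v.
  have v0vB : special B (elt e (v0 ++ v)) by apply: sB'; rewrite all_cat v0B.
  rewrite (comm _ _ (sA _ wA) v0vB) [elt e (_ ++ u0)]elt_cat elt_rev -mulgA mulVKg.
  by rewrite -(comm _ _ (sA _ u0A) v0vB) elt_cat mulgA.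
exists (w ++ (v0 ++ v) ++ (rev w ++ u0) ++ rev v); split.
- have -> : w ++ (v0 ++ v) ++ (rev w ++ u0) ++ rev v =
      ((w ++ (v0 ++ v)) ++ (rev w ++ u0)) ++ rev v by rewrite !catA.
  rewrite (elt_cat _ _ (rev v)) (elt_cat _ _ (rev w ++ u0)) (elt_cat _ w).
  by rewrite loop elt_rev mulgK bE.
- rewrite !size_cat !size_rev !size_alt expn1; move: u0N v0N; clear; lia.
- apply: avoids_cat => [i|].
    have [iN|iN] := leqP i (6 * N)%N.
      by rewrite /w take_alt.
    by rewrite take_oversize ?size_alt ?(ltnW iN) //; exact: w_ray.
  apply: avoids_cat.
    apply: (@avoids_kill A) => i.
    rewrite !killM killAA // (killAB (take _ _)) ?mulg1; last first.
      by apply: take_all; rewrite all_cat v0B.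
    have := wlen_divr (kill e A a) (elt e w); have := wlen_kill A a.
    by move: ma near wlenw; clear; len_lia.
  apply: avoids_cat.
    apply: (@avoids_kill B) => i.
    rewrite elt_cat !killM (killBA w wA) (killBB v0 v0B) (killBB v vB) mulg1.
    rewrite (killBA (take _ _)) ?mulg1; last by apply: take_all;
      rewrite all_cat all_rev wA.
    have := wlen_divr (kill e B a * elt e v0) (elt e v).
    have := wlenM (kill e B a) (elt e v0).
    have := wlen_kill B a; have := wlen_elt e v0; rewrite -!mulgA.
    by move: ma near wlenv v0N; clear; len_lia.
  move=> i.
  (* Backwards along [v] the points are those of the ray issuing from [b], chosen to avoid the
     ball. *)
  have -> : a * elt e w * elt e (v0 ++ v) * elt e (rev w ++ u0) = b * elt e v.
    by rewrite bE -!(mulgA a) loop.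
  rewrite take_rev elt_rev.
  set k := (size v - i)%N.
  have {1}-> : elt e v = elt e (take k v) * elt e (drop k v).
    by rewrite -elt_cat cat_take_drop.
  by rewrite !mulgA mulgK /v take_alt // /k size_alt leq_subr.
Qed.


(** The points at distance [n] on the two rays from [x] are [2 n] apart, so they are not both closer
    than [n] to 1. In contrast to [ray_avoiding], [x] may be arbitrary, and only one point of the
    ray is controlled. *)
Lemma far_point p q x n : p != q -> ~~ e p q ->
  exists p' q', [/\ [set p'; q']%SET = [set p; q]%SET, p' != q', ~~ e p' q' &
    n <= wlen (x * elt e (alt p' q' n))].
Proof.
move=> pq epq; have [h|] := leqP n (wlen (x * elt e (alt p q n))).
  by exists p, q.
move=> nn; exists q, p.
split; [by rewrite finset.setUC|by rewrite eq_sym|by rewrite e_sym|].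
have := wdist_alt2 e_sym n n pq epq.
have := wdist_triangle x^-1 (elt e (alt p q n)) (elt e (alt q p n)).
rewrite -invgM wlenV invgK.
by move: nn; clear; len_lia.
Qed.

(* Walk along the chain of cosets given by a geodesic from [a] to [b]; two
   consecutive cosets share a ray, on which there is a point far from [1]. *)
Lemma div_bound_succ E H K k : good_or_strip e E -> H \in E -> good e H ->
  (forall H', good_class e E H H' -> div_bound H' K k) ->
  exists K', div_bound (hyperclass e E H) K' k.+1.
Proof.
move=> Egs HE gH HK; have [c cP] := coset_chain e_sym Egs HE gH.
set U := hyperclass e E H in cP *; set cls := good_class e E H in HK cP.
(* The chain has at most [c (N + 1)] links of cost [T + 1] each, and one more segment leads to [b];
   moreover [T + 1] is at most [(K 5^(k+1) + 1) (N + 1)^(k+1)]. *)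
exists (c.+1 * (K * 5 ^ k.+1).+1)%N => N m a b abU abN ma mb.
have K'0 : (N <= c.+1 * (K * 5 ^ k.+1).+1 * N.+1 ^ k.+2)%N.
  have N1 : (N.+1 <= N.+1 ^ k.+2)%N by rewrite -{1}(expn1 N.+1) leq_pexp2l.
  have K1 : (0 < c.+1 * (K * 5 ^ k.+1).+1)%N by [].
  by have := leq_mul K1 N1; rewrite mul1n; exact: ltnW.
have [far|near] := leqP (N + m) (wlen a).
  have [u usz ux] := wlenP (a^-1 * b); exists u; split.
  - by rewrite ux mulVKg.
  - by rewrite usz (leq_trans abN).
  - by apply: avoids_far far _; rewrite usz.
have mN : m <= N by move: near ma; clear; lia.
(* Points of a coset within [2 m + 1] and [2 m + 2] of its base point are at most
   [4 m + 3 <= 4 N + 4] apart; the 5 in the constant comes from [(4 N + 4) + 1 <= 5 (N + 1)]. *)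
set T := (K * (4 * N + 4).+1 ^ k.+1)%N.
(* The invariant along the chain. The point [z] stays within [2 m + 1] of the base point of the
   coset, so that the cost of a crossing does not depend on the previous ones, and at distance at
   least [2 m] from 1, as [div_bound] requires. *)
pose reach (d : {set V} * W) l := exists z u, [/\ a * elt e u = z /\ avoids m a u,
  special d.1 (d.2^-1 * z), wlen (d.2^-1 * z) <= (2 * m).+1, (2 * m)%N <= wlen z
  & size u <= l].
have seg H1 x y z : cls H1 -> special H1 (x^-1 * y) -> special H1 (x^-1 * z) ->
    wlen (x^-1 * y) <= (2 * m).+1 -> wlen (x^-1 * z) <= (2 * m).+2 ->
    (2 * m)%N <= wlen y -> (2 * m)%N <= wlen z ->
    exists u, [/\ y * elt e u = z, size u <= T & avoids m y u].
  move=> cH1 xy xz xym xzm my mz; apply: (HK _ cH1) => //.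
    exact/(special_cosetE z xy).
  have := wdist_triangle x y z; rewrite (wdistC y x).
  by move: mN xym xzm; clear; len_lia.
have step (d d' : {set V} * W) l : coset_link e cls U d d' -> reach d l -> reach d'
  (l + T.+1).
  case: d d' => [H1 x] [H2 y] [/= cH1 cH2 [p [q [pq epq]]]].
  rewrite !finset.inE => /andP[pH1 pH2] /andP[qH1 qH2] xy.
  case=> z [u [/= [az au] xz xzm mz ul]].
  have sub (A : {set V}) p' q' t : [set p'; q']%SET = [set p; q]%SET ->
      p \in A -> q \in A -> t \in [set p'; q']%SET -> t \in A.
    by move=> -> pA qA; rewrite !finset.inE => /orP[]/eqP ->.
  have altsp (A : {set V}) p' q' : [set p'; q']%SET = [set p; q]%SET ->
      p \in A -> q \in A -> special A (elt e (alt p' q' (2 * m).+1)).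
    move=> pqE pA qA; apply: special_elt; apply: all_alt;
    by apply: (sub _ _ _ _ pqE) => //; rewrite !finset.inE eqxx ?orbT.
  case: xy => [->|[H12 [s [sU yE sH1]]]].
    have [p' [q' [pqE pq' epq' far]]] := far_point x (2 * m).+1 pq epq.
    have [||v [zv vT zav]] := @seg H1 x z (x * elt e (alt p' q' (2 * m).+1))
      cH1 xz _ xzm _ mz (ltnW far).
    - by rewrite mulKg; exact: altsp.
    - by rewrite mulKg (leq_trans (wlen_elt _ _)) // size_alt.
    exists (x * elt e (alt p' q' (2 * m).+1)), (u ++ v); split.
    - by rewrite elt_cat mulgA az; split=> //; apply: avoids_cat; rewrite ?az.
    - by rewrite mulKg; exact: altsp.
    - by rewrite mulKg (leq_trans (wlen_elt _ _)) // size_alt.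
    - exact: ltnW.
    - by rewrite size_cat; move: ul vT; clear; lia.
  rewrite -{}H12 in cH2 pH2 qH2 *; case: sH1 => [sH1|[ps qs]].
    (* For [s] in [H1] the coset does not change, only its base point; the ray issues from the new
       one, so its point can be [2 m + 2] away from [x]. *)
    have [p' [q' [pqE pq' epq' far]]] := far_point y (2 * m).+1 pq epq.
    have [||v [zv vT zav]] := @seg H1 x z (y * elt e (alt p' q' (2 * m).+1))
      cH1 xz _ xzm _ mz (ltnW far).
    - rewrite yE -(mulgA x) mulKg; apply: specialM; last exact: altsp.
      exact: special_gen.
    - rewrite yE -(mulgA x) mulKg.
      have := wlenM (racg_gen e s) (elt e (alt p' q' (2 * m).+1)).
      have := wlen_gen e s; have := wlen_elt e (alt p' q' (2 * m).+1).
      by rewrite size_alt; clear; len_lia.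
    exists (y * elt e (alt p' q' (2 * m).+1)), (u ++ v); split.
    - by rewrite elt_cat mulgA az; split=> //; apply: avoids_cat; rewrite ?az.
    - by rewrite mulKg; exact: altsp.
    - by rewrite mulKg (leq_trans (wlen_elt _ _)) // size_alt.
    - exact: ltnW.
    - by rewrite size_cat; move: ul vT; clear; lia.
  (* When [s] commutes with [p] and [q], the point [z'] is taken on the ray from [x], at distance at
     least [2 m + 1] from 1; then [z' s], the corresponding point of the ray from [y], is still at
     distance at least [2 m]. This extra letter is the reason for [T.+1]. *)
  have [p' [q' [pqE pq' epq' far]]] := far_point x (2 * m).+1 pq epq.
  set z' := x * elt e (alt p' q' (2 * m).+1) in far.
  have [||v [zv vT zav]] := @seg H1 x z z' cH1 xz _ xzm _ mz (ltnW far).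
  - by rewrite mulKg; exact: altsp.
  - by rewrite mulKg (leq_trans (wlen_elt _ _)) // size_alt.
  have z's : z' * racg_gen e s = y * elt e (alt p' q' (2 * m).+1).
    rewrite yE /z' -!mulgA (gen_commute (A := [set p; q]%SET)) //.
      by move=> t; rewrite !finset.inE => /orP[]/eqP ->.
    by apply: altsp => //; rewrite !finset.inE eqxx ?orbT.
  have mz's : (2 * m)%N <= wlen (z' * racg_gen e s).
    have := wlen_divl z' (racg_gen e s); have := wlen_gen e s.
    by move: far; clear; len_lia.
  exists (z' * racg_gen e s), (u ++ v ++ [:: s]); split.
  - rewrite !elt_cat mulgA az mulgA zv; split=> //.
    apply: avoids_cat; rewrite ?az //; apply: avoids_cat; rewrite ?zv // => i.
    case: i => [|i] /=; last by move: mz's; rewrite -[racg_gen e s]/(elt e [:: s]);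
      clear; lia.
    by rewrite elt_nil mulg1; move: far; clear; lia.
  - by rewrite z's mulKg; exact: altsp.
  - by rewrite z's mulKg (leq_trans (wlen_elt _ _)) // size_alt.
  - by [].
  - by rewrite !size_cat /= addn1; move: ul vT; clear; lia.
have steps n d d' l : chain (coset_link e cls U) n d d' -> reach d l ->
    reach d' (l + n * T.+1)%N.
  move=> dd'; elim: dd' l => {n d d'} [n d|n d d1 d' lnk _ IH] l rd.
    have [z [u [h1 h2 h3 h4 ul]]] := rd; exists z, u; split=> //.
    by rewrite (leq_trans ul) ?leq_addr.
  by have := IH _ (step _ _ _ lnk rd); rewrite mulSn addnA.
have [w [wU wsz wE]] := specialP abU.
have cH : cls H by rewrite /cls /good_class HE gH connect0.
have rH : reach (H, a) 0%N.
  exists a, [::]; rewrite /= mulVg wlen1; split=> //.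
  - by rewrite elt_nil mulg1; split=> //; apply: avoids_nil; move: ma; clear; lia.
  - exact: special1.
have := steps _ _ _ _ (cP H H w a cH cH wU) rH; rewrite wE mulVKg.
case=> z [u [/= [az au] bz bzm mz ul]].
have [||v [zv vT zav]] := @seg H b z b cH bz _ bzm _ mz mb.
- by rewrite mulVg; exact: special1.
- by rewrite mulVg wlen1.
exists (u ++ v); split.
- by rewrite elt_cat mulgA az.
- rewrite size_cat (leq_trans (leq_add ul vT)) //.
  rewrite add0n.
  have TN : (T.+1 <= (K * 5 ^ k.+1).+1 * N.+1 ^ k.+1)%N.
    rewrite mulSn -mulnA -expnMn addnC -addn1 leq_add ?expn_gt0 //.
    by rewrite leq_mul2l leq_exp2r //; apply/orP; right; clear; lia.
  have wN : size w <= N by rewrite wsz.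
  have -> : (c.+1 * (K * 5 ^ k.+1).+1 * N.+1 ^ k.+2 =
    c.+1 * N.+1 * ((K * 5 ^ k.+1).+1 * N.+1 ^ k.+1))%N by rewrite [(N.+1 ^
      _)%N]expnS; ring.
  apply: (@leq_trans (c.+1 * N.+1 * T.+1)); last by rewrite leq_mul2l TN orbT.
  rewrite -(mulnA c.+1) mulSn addnC leq_add //; first by rewrite ltnW // leq_pmull.
  by rewrite mulnA leq_mul2r leq_mul2l ltnS wN !orbT.
- by apply: avoids_cat; rewrite ?az.
Qed.

Lemma div_bound_Lambda k H : H \in Lambda e k -> good e H ->
  exists K, div_bound H K k.
Proof.
elim: k H => [|k IHk] H HL gH.
  by exists 26%N; apply/div_bound_wide/Omega_wide/Lambda0_good.
have [H1 [H1L gH1 ->]] := Lambda_good_succ e_sym e_irr HL gH.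
have Egs := @Lambda_good_or_strip _ _ e_sym e_irr k.
have [H'|H' n n' nn' h cH' N m a b ab abN ma mb|K KP] := @fin_bound {set V}
  (fun H' K => good_class e (Lambda e k) H1 H' -> div_bound H' K k).
- have [/and3P[H'L gH' _]|nc] := boolP (good_class e (Lambda e k) H1 H').
    by have [K KP] := IHk _ H'L gH'; exists K.
  by exists 0%N.
- have [u [uE un au]] := h cH' N m a b ab abN ma mb; exists u; split=> //.
  by rewrite (leq_trans un) // leq_mul2r nn' orbT.
exact: div_bound_succ KP.
Qed.

End Avoiding.

(** * Lipschitz paths *)

Section LipschitzPaths.
Context {R : realType} (X : metricType R).
Implicit Types (S : set X) (p q r : X) (l : R) (f : R -> X).

Definition lipschitz1 f := forall x y, mdist (f x) (f y) <= `|x - y|.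

Lemma lipschitz_continuous f (k : R) :
  (forall x y, mdist (f x) (f y) <= k * `|x - y|) -> continuous f.
Proof.
move=> fk x; apply/cvg_ballP => eps eps0.
have k1 : 0 < `|k| + 1 by rewrite ltr_pwDr.
have d0 : 0 < eps / (`|k| + 1) by rewrite divr_gt0.
near=> y.
rewrite ballEmdist /=; apply: le_lt_trans (fk x y) _.
have : `|x - y| < eps / (`|k| + 1).
  by near: y; have := nbhsx_ballx x _ d0; apply: filterS.
rewrite ltr_pdivlMr // => h; apply: le_lt_trans h; rewrite mulrC.
by apply: ler_wpM2l => //; have := ler_norm k; lra.
Unshelve. all: by end_near. Qed.

(** Here [f] is total, and the Lipschitz bound and the membership in [S] hold on the whole line, so
    that concatenation involves no subspace topology. *)
Definition lip_path S p q l := exists f : R -> X,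
  [/\ lipschitz1 f, f 0 = p, f l = q, 0 <= l & forall x, S (f x)].

Lemma lip_path_nil S p : S p -> lip_path S p p 0.
Proof. by move=> Sp; exists (fun=> p); split=> // x y; rewrite mdistxx. Qed.

Lemma lip_path_cat S p q r l m :
  lip_path S p q l -> lip_path S q r m -> lip_path S p r (l + m).
Proof.
move=> [f [fL f0 fl l0 fS]] [g [gL g0 gm m0 gS]].
exists (fun x => if x <= l then f x else g (x - l)); split=> [x y|||| x].
- case: (leP x l) => xl; case: (leP y l) => yl; rewrite ?fL //.
  + apply: le_trans (metric_triangle _ q _) _.
    have := fL x l; have := gL 0 (y - l); rewrite fl g0.
    rewrite (ler0_norm (_ : x - l <= 0)) ?(ler0_norm (_ : 0 - (y - l) <= 0));
      try lra.
    by rewrite (ler0_norm (_ : x - y <= 0)); lra.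
  + apply: le_trans (metric_triangle _ q _) _.
    have := fL l y; have := gL (x - l) 0; rewrite fl g0.
    rewrite (ger0_norm (_ : 0 <= l - y)) ?(ger0_norm (_ : 0 <= x - l - 0));
      try lra.
    by rewrite (ger0_norm (_ : 0 <= x - y)); lra.
  + by apply: le_trans (gL _ _) _; rewrite opprB addrA subrK.
- by rewrite l0.
- case: (leP (l + m) l) => lm; last by rewrite addrAC subrr add0r.
  have m00 : m = 0 by lra.
  by rewrite m00 addr0 fl -gm m00.
- by rewrite addr_ge0.
- by case: ifP.
Qed.

Lemma lip_path_rev S p q l : lip_path S p q l -> lip_path S q p l.
Proof.
move=> [f [fL f0 fl l0 fS]]; exists (fun x => f (l - x)); split=> //.
- move=> x y; apply: le_trans (fL _ _) _.
  by rewrite (_ : l - x - (l - y) = y - x) 1?distrC //; ring.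
- by rewrite subr0.
- by rewrite subrr.
Qed.

Lemma lip_path_sub S S' p q l : (forall x, S x -> S' x) ->
  lip_path S p q l -> lip_path S' p q l.
Proof. by move=> SS' [f [? ? ? ? fS]]; exists f; split=> // x; apply: SS'. Qed.

(** Rescaled to the unit interval the map is [l]-Lipschitz, and the bounds on the pieces of a
    partition telescope to [l]. *)
Lemma lip_path_is_path S p q l : lip_path S p q l -> exists f : R -> X,
  [/\ is_path f p q, forall t, S (f t) & (path_length f <= l%:E)%E].
Proof.
case=> f [fL f0 fl l0 fS]; exists (fun t => f (l * t)).
have gL x y : mdist (f (l * x)) (f (l * y)) <= l * `|x - y|.
  by apply: le_trans (fL _ _) _; rewrite -mulrBr normrM (ger0_norm l0).
split=> //.
  split; [|by rewrite mulr0|by rewrite mulr1].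
  by apply: continuous_subspaceT; exact: lipschitz_continuous gL.
apply: ge_ereal_sup => _ [s [sp /eqP s1] <-]; rewrite lee_fin.
have lE : l = l * (last 0 s - 0) by rewrite s1 subr0 mulr1.
rewrite [leRHS]lE {lE}.
suff sumE x : path <%R x s -> \sum_(0 <= i < size s)
    mdist (f (l * nth 1 (x :: s) i)) (f (l * nth 1 s i)) <= l * (last x s - x).
  exact: sumE.
elim: s x {sp s1} => [|y s IHs] x /=.
  by rewrite big_geq // subrr mulr0.
case/andP=> xy ys; rewrite big_nat_recl //=.
have := IHs y ys; have := gL x y.
rewrite ler0_norm ?subr_le0 1?(ltW xy) // => h1 h2.
have -> : l * (last y s - x) = l * - (x - y) + l * (last y s - y) by ring.
exact: lerD.
Qed.

End LipschitzPaths.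

(** * Geometry of the Cayley graph *)

Section CayleyGeometry.
Context (R : realType) {V : finType} (e : rel V).
Local Notation W := (racg e).
Local Notation X := (cayley R e).
Local Notation vtx := (@cayley_vertex R V e).
Local Notation coord := Defs.coord.
Implicit Types (g x y z : W) (s : V) (H : {set V}) (u : seq V) (p q : X) (t : R).

Definition clamp t : R := Num.max 0 (Num.min t 1).

Lemma clamp_itv t : 0 <= clamp t <= 1.
Proof. by rewrite /clamp le_max lexx ge_max ler01 ge_min lexx orbT. Qed.

Lemma clamp_id t : 0 <= t <= 1 -> clamp t = t.
Proof. by case/andP=> t0 t1; rewrite /clamp (min_idPl t1) (max_idPr t0). Qed.

Lemma clamp_lip t t' : `|clamp t - clamp t'| <= `|t - t'|.
Proof.
have h a b : clamp a - clamp b <= `|a - b|.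
  have := ler_norm (a - b); have := normr_ge0 (a - b); rewrite /clamp.
  by case: (leP a 1) => ?; case: (leP b 1) => ?;
    repeat (rewrite maxEle; case: ifP => /idP ?); lra.
by rewrite ler_norml h andbT lerNl opprB distrC h.
Qed.

(** Clamping defines the point for every real parameter, as total Lipschitz maps require. *)
Definition edge_pt g s t : X :=
  CayleyPoint (or_intror (ex_intro _ g (ex_intro _ s (ex_intro _ (clamp t)
    (conj (clamp_itv t) erefl))))).

Lemma edge_pt_coord g s t : coord (edge_pt g s t) = edge_coord g s (clamp t).
Proof. by []. Qed.

Lemma edge_pt0 g s : edge_pt g s 0 = vtx g.
Proof.
apply: coord_inj; rewrite edge_pt_coord clamp_id ?lexx ?ler01 //.
exact/esym/vertex_coord0.
Qed.

Lemma edge_pt1 g s : edge_pt g s 1 = vtx (g * racg_gen e s)%g.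
Proof.
apply: coord_inj; rewrite edge_pt_coord clamp_id ?lexx ?ler01 //.
exact/esym/vertex_coord1.
Qed.

Lemma edge_ptP p : (exists g, p = vtx g) \/ (exists g s t, p = edge_pt g s t).
Proof.
case: (coordP p) => [[g pE]|[g [s [t [t01 pE]]]]]; [left|right].
  by exists g; apply: coord_inj.
by exists g, s, t; apply: coord_inj; rewrite pE edge_pt_coord clamp_id.
Qed.

Lemma route_dist p q (l : R) : cayley_route p q l -> mdist p q <= l.
Proof.
by move=> pq; apply: ge_inf => //; have [] := has_inf_cayley_route p q.
Qed.

Lemma edge_pt_dist g s t t' : mdist (edge_pt g s t) (edge_pt g s t') <= `|t - t'|.
Proof.
apply: le_trans (clamp_lip t t'); apply: route_dist.
rewrite -[X in cayley_route _ _ X]addr0.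
by apply: (cayley_route_cons (clamp_itv t) (clamp_itv t') _ _ (cayley_route_nil _));
  rewrite edge_pt_coord.
Qed.

Lemma edge_pt_near g s t : mdist (edge_pt g s t) (vtx g) <= 1.
Proof.
have -> : edge_pt g s t = edge_pt g s (clamp t).
  by apply: coord_inj; rewrite !edge_pt_coord (clamp_id (clamp_itv t)).
rewrite -(edge_pt0 g s); apply: le_trans (edge_pt_dist _ _ _ _) _.
by rewrite subr0 ger0_norm; have := clamp_itv t => /andP[].
Qed.

(** The affine extension to an edge of a function on the vertices. Applied to the distance from a
    vertex, it bounds the length of routes from below. *)
Definition edge_mean (f : W -> R) g s t : R := (1 - t) * f g + t * f (g * racg_gen
  e s)%g.

Lemma sum_vertex_coord (f : W -> R) g (r : seq W) : uniq r -> g \in r ->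
  \sum_(x <- r) vertex_coord R g x * f x = f g.
Proof.
move=> r_uniq gr; rewrite (bigD1_seq g) //= /vertex_coord eqxx mul1r big1 ?addr0 //.
by move=> x /negPf ->; rewrite mul0r.
Qed.

(** The extension is the pairing of [f] with the barycentric coordinates, so it depends only on the
    point and not on the edge chosen to describe it. *)
Lemma edge_mean_coord (f : W -> R) g s t g' s' t' :
  edge_coord g s t = edge_coord g' s' t' -> edge_mean f g s t = edge_mean f g' s'
    t'.
Proof.
move=> E.
pose r := undup [:: g; g * racg_gen e s; g'; g' * racg_gen e s']%g.
have sumE h k (c : R) : h \in r -> (h * racg_gen e k)%g \in r ->
    edge_mean f h k c = \sum_(x <- r) edge_coord h k c x * f x.
  move=> hr hkr; rewrite /edge_coord.
  under eq_bigr do rewrite mulrDl -!mulrA.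
  by rewrite big_split -!mulr_sumr /= !sum_vertex_coord ?undup_uniq.
by rewrite !sumE ?E // mem_undup !inE eqxx ?orbT.
Qed.

Lemma route_edge_mean (f : W -> R) p q (l : R) :
  (forall g s, `|f g - f (g * racg_gen e s)%g| <= 1) ->
  cayley_route p q l -> forall g s t g' s' t',
  coord p = edge_coord g s t -> coord q = edge_coord g' s' t' ->
  `|edge_mean f g s t - edge_mean f g' s' t'| <= l.
Proof.
move=> fL; elim=> {p q l} [p g s t g' s' t' pE qE|p q r g s t t' l _ _ pE qE _ IH].
  by rewrite (@edge_mean_coord f g s t g' s' t') ?subrr ?normr0 // -pE.
move=> g0 s0 t0 g1 s1 t1 pE0 rE.
rewrite (@edge_mean_coord f g0 s0 t0 g s t) -?pE //.
have {IH} h := IH _ _ _ _ _ _ qE rE.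
apply: le_trans (ler_distD (edge_mean f g s t') _ _) (lerD _ _) => //.
rewrite /edge_mean.
have -> : (1 - t) * f g + t * f (g * racg_gen e s)%g -
  ((1 - t') * f g + t' * f (g * racg_gen e s)%g) =
  (t' - t) * (f g - f (g * racg_gen e s)%g) by ring.
by rewrite normrM distrC ler_piMr.
Qed.

Lemma wlen_gen_lip x g s :
  `|(wlen (x^-1 * g)%g)%:R - (wlen (x^-1 * (g * racg_gen e s))%g)%:R| <= 1 :> R.
Proof.
rewrite mulgA; move: (x^-1 * g)%g => h.
have := wlenM h (racg_gen e s); have := wlen_divl h (racg_gen e s).
have := wlen_gen e s; rewrite ler_norml lerBlDr lerBrDr -!(ler_nat R) !natrD.
set a := (wlen (racg_gen e s))%:R; set b := (wlen h)%:R; set c := (wlen _)%:R.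
by lra.
Qed.


End CayleyGeometry.

(** * Coset graphs and the divergence of the Cayley graph *)

Section CosetGraphs.
Context (R : realType) {V : finType} (e : rel V).
Local Notation W := (racg e).
Local Notation X := (cayley R e).
Local Notation vtx := (@cayley_vertex R V e).
Local Notation edge_pt := (@edge_pt R V e).
Implicit Types (g x y z : W) (s : V) (H : {set V}) (u : seq V) (p q : X) (t : R).

Lemma vtx_dist g h : mdist (vtx g) (vtx h) = (wlen (g^-1 * h)%g)%:R.
Proof.
apply/eqP; rewrite eq_le; apply/andP; split.
  have [u <- uE] := wlenP (g^-1 * h)%g.
  have {uE} -> : h = (g * elt e u)%g by rewrite uE mulVKg.
  elim: u g => [|s u IHu] g /=; first by rewrite elt_nil mulg1 mdistxx.
  apply: le_trans (metric_triangle _ (vtx (g * racg_gen e s)%g) _) _.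
  rewrite -natr1 addrC; apply: lerD; first by rewrite elt_cons mulgA IHu.
  rewrite -edge_pt1 -(edge_pt0 R g s); apply: le_trans (edge_pt_dist _ _ _ _) _.
  by rewrite sub0r normrN normr1.
apply: lb_le_inf; first by have [] := has_inf_cayley_route (vtx g) (vtx h).
(* A letter [s] is needed to describe [g] and [h] as points of edges; if the geodesic word is empty,
   the bound is just [0 <= l]. *)
move=> l /= gh; have [[|s u] _ uE] := wlenP (g^-1 * h)%g.
  by rewrite -uE wlen1 (cayley_route_ge0 gh).
have := route_edge_mean (f := fun x => (wlen (g^-1 * x)%g)%:R)
  (@wlen_gen_lip R V e g) gh (vertex_coord0 R g s) (vertex_coord0 R h s).
rewrite /edge_mean !subr0 !mul1r !mul0r !addr0 mulVg wlen1 sub0r normrN.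
by rewrite ger0_norm.
Qed.

Definition cgraph g H : set X := [set p | exists2 x, special H (g^-1 * x)%g &
  p = vtx x \/ exists s t, s \in H /\ p = edge_pt x s t].

Lemma cgraph_vtx g H x : special H (g^-1 * x)%g -> cgraph g H (vtx x).
Proof. by exists x => //; left. Qed.

Lemma cgraph_edge g H x s t : special H (g^-1 * x)%g -> s \in H ->
  cgraph g H (edge_pt x s t).
Proof. by exists x => //; right; exists s, t. Qed.

Lemma cgraphT g p : cgraph g [set: V] p.
Proof.
case: (edge_ptP p) => [[x ->]|[x [s [t ->]]]].
  by apply: cgraph_vtx; exact: specialT.
by apply: cgraph_edge; [exact: specialT | rewrite finset.inE].
Qed.

Lemma cgraph_sub g H x H' : special H (g^-1 * x)%g -> H' \subset H ->
  cgraph x H' `<=` cgraph g H.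
Proof.
move=> gx /fintype.subsetP H'H p [y xy pE]; exists y.
  have -> : (g^-1 * y = (g^-1 * x) * (x^-1 * y))%g by rewrite -mulgA mulVKg.
  by apply: specialM => //; exact: special_sub H'H _.
by case: pE => [|[s [t [sH' ->]]]]; [left|right; exists s, t; split=> //;
  exact: H'H].
Qed.

Lemma cgraph_eq g H x : special H (g^-1 * x)%g -> cgraph x H = cgraph g H.
Proof.
move=> gx; apply/seteqP; split; first exact: cgraph_sub.
by apply: cgraph_sub => //; exact: special_cosetC.
Qed.

Lemma lip_seg (S : set X) x s t : (forall t', S (edge_pt x s t')) -> 0 <= t <= 1 ->
  lip_path S (edge_pt x s t) (vtx x) t.
Proof.
move=> Se /andP[t0 t1]; exists (fun v => edge_pt x s (t - v)); split=> //.
- move=> v w; apply: le_trans (edge_pt_dist _ _ _ _) _.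
  by rewrite (_ : t - v - (t - w) = w - v) 1?distrC //; ring.
- by rewrite subr0.
- by rewrite subrr edge_pt0.
Qed.

Lemma lip_word (S : set X) x u : S (vtx x) ->
  (forall u1 s u2 t, u = u1 ++ s :: u2 -> S (edge_pt (x * elt e u1)%g s t)) ->
  lip_path S (vtx x) (vtx (x * elt e u)%g) (size u)%:R.
Proof.
elim: u x => [|s u IHu] x Sx Su; first by rewrite elt_nil mulg1;
  exact: lip_path_nil.
have Ss t : S (edge_pt x s t).
  by have := Su [::] s u t erefl; rewrite elt_nil mulg1.
rewrite /= -nat1r elt_cons mulgA;
  apply: (@lip_path_cat _ _ _ _ (vtx (x * racg_gen e s)%g)).
  rewrite -edge_pt1; apply: lip_path_rev; apply: lip_seg => //.
  by rewrite ler01 lexx.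
apply: IHu; first by rewrite -edge_pt1.
move=> u1 s' u2 t uE; rewrite -mulgA -elt_cons; apply: (Su _ _ u2).
by rewrite uE.
Qed.

Lemma cgraph_near g H p : cgraph g H p -> exists x, [/\ special H (g^-1 * x)%g,
  mdist p (vtx x) <= 1 & exists l : R, l <= 1 /\
  lip_path [set q | cgraph g H q /\ mdist p q <= 1] p (vtx x) l].
Proof.
case=> x gx [->|[s [t [sH ->]]]]; exists x; split=> //.
- by rewrite mdistxx ler01.
- exists 0; split; first exact: ler01.
  by apply: lip_path_nil; split; [exact: cgraph_vtx|rewrite mdistxx ler01].
- exact: edge_pt_near.
- exists (clamp t); have /andP[t0 t1] := clamp_itv t; split=> //.
  have tE : edge_pt x s t = edge_pt x s (clamp t).
    by apply: coord_inj; rewrite !edge_pt_coord (clamp_id (clamp_itv t)).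
  rewrite {2}tE; apply: lip_seg; last exact: clamp_itv.
  move=> t'; split; first exact: cgraph_edge.
  rewrite tE -[edge_pt x s t'](_ : edge_pt x s (clamp t') = _); last first.
    by apply: coord_inj; rewrite !edge_pt_coord (clamp_id (clamp_itv t')).
  apply: le_trans (edge_pt_dist _ _ _ _) _; have /andP[t'0 t'1] := clamp_itv t'.
  by rewrite ler_norml; apply/andP; split; lra.
Qed.

Lemma cayley_divergence k K : div_bound e [set: V] K k ->
  divergence_bounded_by_degree X k.+1.
Proof.
(* The points [a], [b], [c] are replaced by vertices within 1, so [m] is the integer part of
   [(r - 2) / 2] and exceeds [r / 2 - 2]. Returning to [c] and to points inside edges loses 2 more:
   the path stays at distance at least [r / 2 - 4] from [c]. *)
move=> KP; exists 2^-1, 4; split; [by apply/andP; split; lra|by []|].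
move=> del gam /andP[del0 del1] gam4.
have K0 : 0 <= K%:R :> R by [].
(* [N + 1 <= n + 3], and the two end segments add at most 2 to the length. *)
exists (K%:R + 3); first by lra.
move=> n n0; apply: ge_ereal_sup => _ [a [b [c [abn ->]]]].
have [a0 [_ aa0 [la [la1 a_path]]]] := cgraph_near (cgraphT 1%g a).
have [b0 [_ bb0 [lb [lb1 b_path]]]] := cgraph_near (cgraphT 1%g b).
have [c0 [_ cc0 _]] := cgraph_near (cgraphT 1%g c).
rewrite /div_points; set r := Num.min _ _.
have ra : r <= mdist c a by rewrite ge_min lexx.
have rb : r <= mdist c b by rewrite ge_min lexx orbT.
have r0 : 0 <= r by rewrite le_min !mdist_ge0.
pose N := Num.truncn (n + 2); pose m := Num.truncn ((r - 2) / 2).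
have tri (x y z : X) : mdist x z <= mdist x y + mdist y z :> R := @metric_triangle
  R X x y z.
have sym (x y : X) : mdist x y = mdist y x :> R := @metric_sym R X x y.
have ab0 : (wlen ((c0^-1 * a0)^-1 * (c0^-1 * b0))%g <= N)%N.
  rewrite invgM invgK -mulgA mulVKg truncn_ge_nat; last by lra.
  rewrite -vtx_dist; have := tri (vtx a0) a (vtx b0); have := tri a b (vtx b0).
  by rewrite (sym (vtx a0) a); lra.
have m_le (x0 : W) (x : X) : r <= mdist c x -> mdist x (vtx x0) <= 1 ->
    (2 * m <= wlen (c0^-1 * x0)%g)%N.
  move=> rx xx0; have [rlt|rge] := ltP ((r - 2) / 2) 0.
    suff -> : m = 0%N by [].
    by apply/truncn0Pn; rewrite -ltNge; apply: lt_trans rlt _.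
  rewrite -(ler_nat R) natrM.
  have : m%:R <= (r - 2) / 2 by rewrite truncn_le.
  rewrite -vtx_dist; have := tri c (vtx c0) x; have := tri (vtx c0) (vtx x0) x.
  by rewrite (sym (vtx x0) x); lra.
have m_ge : (r - 2) / 2 < m%:R + 1 by rewrite natr1; exact: truncnS_gt.
have [u [uE us um]] := KP N m (c0^-1 * a0)%g (c0^-1 * b0)%g (specialT _)
  ab0 (m_le _ _ ra aa0) (m_le _ _ rb bb0).
rewrite -mulgA in uE; move/mulgI: uE => uE.
have rho : del * r - gam <= r / 2 - 4.
  have : del * r <= 2^-1 * r by apply: ler_wpM2r.
  by lra.
pose S := [set q : X | del * r - gam <= mdist c q].
have a_S : lip_path S a (vtx a0) la.
  apply: lip_path_sub a_path => q [_ aq]; rewrite /S /=.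
  by have := tri c q a; rewrite (sym q a); lra.
have b_S : lip_path S (vtx b0) b lb.
  apply: lip_path_rev; apply: lip_path_sub b_path => q [_ bq]; rewrite /S /=.
  by have := tri c q b; rewrite (sym q b); lra.
have vtxS i : S (vtx (a0 * elt e (take i u))%g) /\ forall s t,
    S (edge_pt (a0 * elt e (take i u))%g s t).
  have : m%:R <= mdist (vtx c0) (vtx (a0 * elt e (take i u))%g).
    by rewrite vtx_dist ler_nat mulgA.
  move=> mi; split=> [|s t]; rewrite /S /=.
    have := tri (vtx c0) c (vtx (a0 * elt e (take i u))%g).
    by rewrite (sym (vtx c0) c); lra.
  have := tri (vtx c0) c (vtx (a0 * elt e (take i u))%g).
  have := tri c (edge_pt (a0 * elt e (take i u))%g s t) (vtx (a0 * elt e (take i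
    u))%g).
  have := @edge_pt_near R _ e (a0 * elt e (take i u))%g s t.
  by rewrite (sym (vtx c0) c); lra.
have u_S : lip_path S (vtx a0) (vtx b0) (size u)%:R.
  rewrite -uE; apply: lip_word.
    by have [] := vtxS 0%N; rewrite take0 elt_nil mulg1.
  move=> u1 s u2 t uE'; have [_] := vtxS (size u1).
  by rewrite uE' take_size_cat.
have [f [f_path fS fl]] := lip_path_is_path
  (lip_path_cat a_S (lip_path_cat u_S b_S)).
apply: le_trans (_ : path_length f <= _)%E.
  apply: ereal_inf_lbound; exists f => //; split=> // t _.
  by rewrite ballEmdist /= => h; have := fS t; rewrite /S /= leNgt h.
apply: le_trans fl _; rewrite -EFinM -EFinD lee_fin.
have NE : N.+1%:R <= (K%:R + 3) * n + (K%:R + 3) :> R.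
  have Nn : N%:R <= n + 2 by rewrite truncn_le; lra.
  have : 0 <= K%:R * n by apply: mulr_ge0.
  by rewrite -natr1; lra.
have : (size u)%:R <= (K%:R + 3) * ((K%:R + 3) * n + (K%:R + 3)) ^+ k.+1 :> R.
  apply: le_trans (_ : (K * N.+1 ^ k.+1)%N%:R <= _); first by rewrite ler_nat.
  rewrite natrM natrX; apply: ler_pM => //; first by lra.
  apply: lerXn2r => //; rewrite nnegrE; last by rewrite (le_trans _ NE).
  by [].
have : 0 <= (K%:R + 3) * n by apply: mulr_ge0 => //; lra.
by move=> Kn us'; rewrite addrCA; apply: lerD => //; lra.
Qed.

End CosetGraphs.

(** * Tight networks of cosets *)

Section CoarseLinks.
Context {V : finType} (e : rel V).
Hypotheses (e_sym : symmetric e) (e_irr : irreflexive e).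
Local Notation W := (racg e).
Local Open Scope nat_scope.
Local Open Scope group_scope.
Implicit Types (H U P : {set V}) (x y z v k : W).

Lemma coset_link_step cls U H1 x H2 y : coset_link e cls U (H1, x) (H2, y) ->
  exists o : option V, (if o is Some s then s \in U else true) /\
    x^-1 * y = if o is Some s then racg_gen e s else 1.
Proof.
case=> _ _ [p [q [_ _ _ _]]] /= [->|[_ [s [sU -> _]]]].
  by exists None; rewrite mulVg.
by exists (Some s); rewrite mulKg.
Qed.

(** Conjugation by [x^-1 y] keeps the words in [p], [q] in [W_H2]: a letter [s] in [x^-1 y] either
    lies in [H1 = H2] or commutes with them. These words give the infinite diameter. *)
Lemma coset_link_alt cls U H1 x H2 y : coset_link e cls U (H1, x) (H2, y) ->
  exists p q, [/\ p != q, ~~ e p q & forall n,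
    special H1 (elt e (alt p q n)) /\
    special H2 ((x^-1 * y)^-1 * elt e (alt p q n) * (x^-1 * y))].
Proof.
case=> _ _ [p [q [pq epq]]] /=.
rewrite !finset.inE => /andP[pH1 pH2] /andP[qH1 qH2] xy.
exists p, q; split=> // n.
have s1 : special H1 (elt e (alt p q n)) by apply: special_elt; exact: all_alt.
split=> //; case: xy => [->|[H12 [s [sU -> sE]]]].
  by rewrite mulVg invg1 mul1g mulg1; apply: special_elt; exact: all_alt.
rewrite mulKg racg_genV -H12; case: sE => [sH1|[ps qs]].
  by have sg := special_gen e sH1; apply: specialM => //; exact: specialM.
rewrite -(gen_commute (A := [set p; q]%SET)) ?mulgK //.
- by rewrite -mulgA -{2}(racg_genV e s) mulgV mulg1.
- by move=> t; rewrite !finset.inE => /orP[]/eqP ->.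
- by apply: special_elt; apply: all_alt; rewrite !finset.inE eqxx ?orbT.
Qed.

(** Only finitely many triples [H1], [H2], [x^-1 y] occur, so [coarse_intersection] yields one [D].
    The 4 is the radius 2 of the neighbourhoods plus 1 for each of two points moved to a vertex; it
    becomes 5 when the second coset is brought to the base point [x]. *)
Lemma coset_link_near : exists D, forall cls U H1 x H2 y,
  coset_link e cls U (H1, x) (H2, y) -> exists P,
  [/\ P \subset H1,
      forall z, special P z -> special H2 ((x^-1 * y)^-1 * z * (x^-1 * y))
    & forall v, (exists2 a, special H1 (x^-1 * a) & wlen (a^-1 * v) <= 4) ->
      (exists2 b, special H2 (y^-1 * b) & wlen (b^-1 * v) <= 4) ->
      exists2 z, special P z & wlen ((x * z)^-1 * v) <= D].
Proof.
pose g (o : option V) := if o is Some s then racg_gen e s else 1.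
have [[[H1 H2] o]|[[H1 H2] o] n m nm h z z1 z2|D DP] :=
  @fin_bound ({set V} * {set V} * option V)%type (fun t D =>
  forall z, (exists2 a, special t.1.1 a & wlen (a^-1 * z) <= 5) ->
  (exists2 b, special t.1.2 ((g t.2)^-1 * b * g t.2) & wlen (b^-1 * z) <= 5) ->
  exists w, [/\ special t.1.1 w, special t.1.2 ((g t.2)^-1 * w * g t.2)
    & wlen (w^-1 * z) <= D]).
- apply: coarse_intersection => /= a b sa sb.
    by apply: specialM => //; exact: specialV.
  have -> : (g o)^-1 * (a * b^-1) * g o =
      ((g o)^-1 * a * g o) * ((g o)^-1 * b * g o)^-1.
    by rewrite !invgM invgK !mulgA mulgK.
  by apply: specialM => //; exact: specialV.
- by have [w [w1 w2 wn]] := h z z1 z2; exists w; split=> //; exact: leq_trans nm.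
exists D => cls U H1 x H2 y lnk.
have [P [PH1 P2 PH]] := coset_link_special e_sym e_irr lnk.
exists P; split=> // v [a xa av] [b yb bv].
have [o [_ oE]] := coset_link_step lnk.
have og : x^-1 * y = g o by [].
have go1 : wlen (g o) <= 1 by rewrite /g; case: (o) => [s|];
  rewrite ?wlen1 ?wlen_gen.
have [||w [w1 w2 wD]] := DP (H1, H2, o) (x^-1 * v).
- exists (x^-1 * a) => //=; rewrite invgM invgK -mulgA mulVKg.
  exact: leq_trans av _.
- exists (g o * (y^-1 * b) * (g o)^-1) => /=.
    by rewrite !mulgA mulVg mul1g mulgVK.
  have -> : (g o * (y^-1 * b) * (g o)^-1)^-1 * (x^-1 * v) = g o * (b^-1 * v).
    have -> : g o * (y^-1 * b) * (g o)^-1 = x^-1 * b * (g o)^-1.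
      by rewrite -{1}og !mulgA mulgK.
    by rewrite !invgM !invgK -!mulgA mulVKg.
  by rewrite (leq_trans (wlenM _ _)) // -[5%N]/(1 + 4)%N leq_add.
exists w; first by apply: PH => //; rewrite og.
by rewrite invgM -mulgA.
Qed.

End CoarseLinks.

(** * Isometric models of coset graphs *)

Section Charts.
Context (R : realType) {V : finType} (e : rel V).
Hypotheses (e_sym : symmetric e) (e_irr : irreflexive e).
Local Notation W := (racg e).
Local Notation X := (cayley R e).
Local Notation vtx := (@cayley_vertex R V e).
Local Notation edge_pt := (@edge_pt R V e).
Local Notation cgraph := (@cgraph R V e).
Implicit Types (g x y z v : W) (s : V) (H U P : {set V}) (u w : seq V) (t L : R).

(** An isometry [phi] onto the coset graph; [psi] is its inverse there and arbitrary elsewhere. *)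
Definition coset_chart (Y : metricType R) g H (phi : Y -> X) (psi : X -> Y) :=
  [/\ forall a b, mdist (phi a) (phi b) = mdist a b,
      forall a, cgraph g H (phi a)
    & forall p, cgraph g H p -> phi (psi p) = p].

Definition coset_model (Y : metricType R) H :=
  exists g (phi : Y -> X) (psi : X -> Y), coset_chart g H phi psi.

Lemma coset_modelT : coset_model X [set: V].
Proof. by exists 1%g, id, id; split=> // a; exact: cgraphT. Qed.

Lemma chart_psiK (Y : metricType R) g H (phi : Y -> X) psi :
  coset_chart g H phi psi -> forall a, psi (phi a) = a.
Proof.
case=> iso ran inv a; apply: mdist_positivity.
by rewrite -iso inv // mdistxx.
Qed.

Lemma coset_model_subspace (Y : metricType R) g H (phi : Y -> X) psi x H' :
  coset_chart g H phi psi -> special H (g^-1 * x)%g -> H' \subset H ->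
  coset_model (metric_subspace (phi @^-1` cgraph x H') : metricType R) H'.
Proof.
case=> iso ran inv gx H'H; have sub := cgraph_sub (R := R) gx H'H.
set Z := phi @^-1` _.
have [f fP] : exists f : X -> metric_subspace Z,
    forall p, cgraph x H' p -> phi (sval (f p)) = p.
  have pt p : exists z : metric_subspace Z, cgraph x H' p -> phi (sval z) = p.
    have [xp|nxp] := pselect (cgraph x H' p).
      have Zp : Z (psi p) by rewrite /Z /= inv //; exact: sub.
      by exists (exist _ (psi p) Zp) => _ /=; rewrite inv //; exact: sub.
    (* Outside the smaller coset graph the inverse takes the base vertex as a default value. *)
    have Zx : Z (psi (vtx x)).
      have xx : cgraph x H' (vtx x) by apply: cgraph_vtx; rewrite mulVg;
        exact: special1.
      by rewrite /Z /= inv //; exact: sub.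
    by exists (exist _ _ Zx).
  by have [f fP] := choice pt; exists f.
exists x, (phi \o sval), f; split=> //=.
by case.
Qed.

(** The additive error 5 is that of [coset_quasi_convex]: 1 at each time for the jump to a vertex, 1
    at each time for capping at the length of the word, and 1 for rounding the parameters. *)
Lemma close_quasi_geodesic (Y : metricType R) L (D : set R) (f : R -> Y) : 5 <= L ->
  (forall t t', D t -> D t' -> `|t - t'| - 5 <= mdist (f t) (f t') <= `|t - t'| +
    5) ->
  quasi_geodesic_on L D f.
Proof.
move=> L5 fD t t' Dt Dt'; have /andP[lo hi] := fD t t' Dt Dt'.
have n0 := normr_ge0 (t - t'); apply/andP; split.
  apply: le_trans lo; apply: lerB => //; rewrite ler_pdivrMr; last by lra.
  by rewrite ler_peMr //; lra.
apply: le_trans hi _; apply: lerD => //; rewrite ler_peMl //; lra.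
Qed.

Lemma truncn_dist t t' : 0 <= t -> 0 <= t' ->
  `|t - t'| - 1 <= `|(Num.truncn t)%:R - (Num.truncn t')%:R : R| <= `|t - t'| + 1.
Proof.
move=> t0 t'0; have /andP[a b] := truncn_itv t0; have /andP[c d] := truncn_itv t'0.
rewrite -!natr1 in b d; move: a b c d.
set u : R := _%:R; set u' : R := _%:R => a b c d.
by have [|] := ler0P (t - t'); have [|] := ler0P (u - u') => ? ?;
  apply/andP; split; lra.
Qed.

(* A point of a coset graph is moved to a vertex, a geodesic of vertices is
   followed by jumps, and the last jump is to the second point. *)
Lemma coset_quasi_convex (Y : metricType R) g H (phi : Y -> X) psi x H' L :
  coset_chart g H phi psi -> special H (g^-1 * x)%g -> H' \subset H -> 5 <= L ->
  quasi_convex 2 L (phi @^-1` cgraph x H').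
Proof.
case=> iso ran inv gx H'H L5; have sub := cgraph_sub (R := R) gx H'H.
move=> a b /= Za Zb.
have [a0 [xa0 aa0 _]] := cgraph_near Za; have [b0 [xb0 bb0 _]] := cgraph_near Zb.
have ab0 : special H' (a0^-1 * b0)%g by apply/(special_cosetE b0 xa0).
have [w [wH' wsz wE]] := specialP ab0.
pose v t : W := (a0 * elt e (take (Num.truncn t) w))%g.
have xv t : special H' (x^-1 * v t)%g.
  rewrite mulgA; apply: specialM => //; apply: special_elt.
  by apply/allP => s /mem_take; move/allP: wH'; apply.
(* One unit more than the length of [w]: the times 0 and [l] are distinct even for an empty [w], and
   can be given the values [a] and [b]. *)
pose l : R := (size w).+1%:R.
have l0 : 0 < l by rewrite ltr0n.
pose f t := if t == 0 then a else if t == l then b else psi (vtx (v t)).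
have fv t : mdist (phi (f t)) (vtx (v t)) <= 1.
  rewrite /f; have [->|t0] := eqVneq t 0.
    by rewrite /v truncn0 take0 elt_nil mulg1.
  have [->|tl] := eqVneq t l.
    by rewrite /v /l natrK take_oversize // wE mulVKg.
  rewrite inv ?mdistxx ?ler01 //; apply: sub; exact: cgraph_vtx.
have fZ t : cgraph x H' (phi (f t)).
  rewrite /f; case: ifP => // _; case: ifP => // _.
  by rewrite inv; [|apply: sub]; apply: cgraph_vtx.
exists l, f; split.
- exact: ltW.
- apply: close_quasi_geodesic => // t t'; rewrite /= !in_itv /=.
  move=> /andP[t0 tl] /andP[t'0 t'l]; rewrite -iso.
  have vv : mdist (vtx (v t)) (vtx (v t')) =
    `|(minn (Num.truncn t) (size w))%:R - (minn (Num.truncn t') (size w))%:R|.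
    rewrite vtx_dist /v invgM -mulgA mulKg.
    have takeE n : take n w = take (minn n (size w)) w.
      by rewrite take_min take_size.
    rewrite (takeE (Num.truncn t)) (takeE (Num.truncn t')).
    move: (minn _ _) (minn (Num.truncn t') _) (geq_minr (Num.truncn t) (size w))
      (geq_minr (Num.truncn t') (size w)) => i j iw jw.
    have wl : wlen (elt e w) = size w by rewrite wE.
    have [ij|ji] := leqP i j.
      by rewrite wdist_take ?ij // natrB // distrC ger0_norm // subr_ge0 ler_nat.
    rewrite wdistC wdist_take ?(ltnW ji) // natrB ?(ltnW ji) // ger0_norm //.
    by rewrite subr_ge0 ler_nat ltnW.
  have minE c : 0 <= c <= l -> `|(minn (Num.truncn c) (size w))%:R - (Num.truncn
    c)%:R| <= 1 :> R.
    case/andP=> c0 cl; have : (Num.truncn c <= (size w).+1)%N.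
      by have := le_truncn cl; rewrite /l natrK.
    move=> h; have [cw|cw] := leqP (Num.truncn c) (size w).
      by rewrite subrr normr0.
    have -> : Num.truncn c = (size w).+1 by apply/eqP; rewrite eqn_leq h.
    by rewrite -natr1 opprD addrA subrr sub0r normrN normr1.
  have m1 : `|_| <= 1 := minE t (introT andP (conj t0 tl)).
  have m2 : `|_| <= 1 := minE t' (introT andP (conj t'0 t'l)).
  have /andP[tt1 tt2] := truncn_dist t0 t'0.
  have tri (p q r : X) : mdist p r <= mdist p q + mdist q r := metric_triangle p q
    r.
  have d1 := fv t; have d2 := fv t'.
  have e1 := tri (phi (f t)) (vtx (v t)) (phi (f t')).
  have e2 := tri (vtx (v t)) (vtx (v t')) (phi (f t')).
  have e3 := tri (vtx (v t)) (phi (f t)) (vtx (v t')).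
  have e4 := tri (phi (f t)) (phi (f t')) (vtx (v t')).
  rewrite (metric_sym (vtx (v t)) (phi (f t))) in e3.
  rewrite (metric_sym (vtx (v t')) (phi (f t'))) in e2.
  move: vv m1 m2 tt1 tt2.
  set i : R := (minn (Num.truncn t) _)%:R; set j : R := (minn (Num.truncn t') _)%:R.
  set k : R := _%:R; set k' : R := _%:R => vv m1 m2 tt1 tt2.
  have f1 := ler_distD k i j; have f2 := ler_distD k' k j.
  have f3 := ler_distD i k k'; have f4 := ler_distD j i k'.
  by rewrite (distrC k' j) in f2; rewrite (distrC k i) in f3; apply/andP; split;
    lra.
- by rewrite /f eqxx.
- by rewrite /f eqxx; case: eqVneq => // l00; rewrite l00 ltxx in l0.
- move=> _ [t _ <-]; exists (f t); first exact: fZ.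
  by rewrite ballEmdist /= mdistxx.
Qed.

Lemma coset_word_path g H P x y : special H (g^-1 * x)%g -> P \subset H ->
  special P (x^-1 * y)%g -> exists l : R,
  lip_path [set q | cgraph g H q /\ exists2 z, special P (x^-1 * z)%g &
      mdist (vtx z) q <= 1 /\ (wlen (x^-1 * z)%g <= wlen (x^-1 * y)%g)%N]
    (vtx x) (vtx y) l.
Proof.
move=> gx /fintype.subsetP PH xy; have [u [uP us uE]] := specialP xy.
have yE : y = (x * elt e u)%g by rewrite uE mulVKg.
exists (size u)%:R; rewrite -us [in vtx y]yE; apply: lip_word.
  split; first exact: cgraph_vtx.
  by exists x; rewrite ?mulVg ?wlen1 ?mdistxx ?ler01 //; exact: special1.
move=> u1 s u2 t uE'; move: uP; rewrite uE' all_cat /= => /and3P[u1P sP _].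
have u1H : special P (elt e u1) by exact: special_elt.
split.
  apply: cgraph_edge; last exact: PH.
  by rewrite mulgA; apply: specialM => //; exact: special_sub u1H.
exists (x * elt e u1)%g; first by rewrite mulKg.
rewrite metric_sym; split; first exact: edge_pt_near.
by rewrite mulKg size_cat (leq_trans (wlen_elt _ _)) // leq_addr.
Qed.

Section LinkedCosets.
Context (Y : metricType R) (g : W) (U : {set V}) (phi : Y -> X) (psi : X -> Y).
Context (cls : pred {set V}) (H1 H2 : {set V}) (x y : W).
Hypothesis chart : coset_chart g U phi psi.
Hypothesis cls_sub : forall H, cls H -> H \subset U.
Hypothesis lnk : coset_link e cls U (H1, x) (H2, y).
Hypothesis gx : special U (g^-1 * x)%g.

Let N := metric_nbhd 2 (phi @^-1` cgraph x H1) `&` metric_nbhd 2 (phi @^-1` cgraph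
  y H2).

Let cls1 : H1 \subset U. Proof. by case: lnk => c1 _ _; exact: cls_sub. Qed.
Let cls2 : H2 \subset U. Proof. by case: lnk => _ c2 _; exact: cls_sub. Qed.

Let gy : special U (g^-1 * y)%g.
Proof.
have [o [oU oE]] := coset_link_step lnk.
have -> : (g^-1 * y = (g^-1 * x) * (x^-1 * y))%g by rewrite -mulgA mulVKg.
apply: specialM => //; rewrite oE; case: o oU {oE} => [s sU|_];
  last exact: special1.
exact: special_gen.
Qed.

(** The vertex [x z] lies in the first coset, and [x z (x^-1 y)], at distance at most 1 from it,
    lies in the second. *)
Lemma linked_vtx z : special H1 z ->
  special H2 ((x^-1 * y)^-1 * z * (x^-1 * y))%g -> N (psi (vtx (x * z)%g)).
Proof.
case: (chart) => iso ran inv z1 z2.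
have gxz : special U (g^-1 * (x * z))%g.
  rewrite mulgA; apply: specialM => //.
  by apply: special_sub z1; exact/fintype.subsetP.
have gxzk : cgraph g U (vtx (x * z * (x^-1 * y))%g).
  apply: cgraph_vtx; rewrite mulgA; apply: specialM => //.
  exact: (special_cosetE y gx).1.
split.
  exists (psi (vtx (x * z)%g)); last by rewrite ballEmdist /= mdistxx.
  rewrite /= inv; last exact: cgraph_vtx.
  by apply: cgraph_vtx; rewrite mulKg.
exists (psi (vtx (x * z * (x^-1 * y))%g)).
  rewrite /= inv //; apply: cgraph_vtx.
  have -> : (y^-1 * (x * z * (x^-1 * y)) = (x^-1 * y)^-1 * z * (x^-1 * y))%g.
    by rewrite invgM invgK !mulgA.
  by [].
rewrite ballEmdist /= -iso !inv //; last exact: cgraph_vtx.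
rewrite vtx_dist invgM -(mulgA (_^-1)%g) mulVg mulg1 wlenV.
apply: (@le_lt_trans _ _ 1); last by lra.
rewrite -[1]/(1%:R) ler_nat.
have [[s|] [_ ->]] := coset_link_step lnk; first exact: wlen_gen.
by rewrite wlen1.
Qed.

Lemma linked_base : N (psi (vtx x)).
Proof.
rewrite -[x in vtx x]mulg1; apply: linked_vtx; first exact: special1.
by rewrite mulg1 mulVg; exact: special1.
Qed.

Lemma linked_infinite_diameter : infinite_diameter N.
Proof.
case: (chart) => iso ran inv M.
have [p [q [pq epq altP]]] := coset_link_alt lnk.
exists (psi (vtx x)), (psi (vtx (x * elt e (alt p q (Num.truncn M).+1))%g)).
have [s1 s2] := altP (Num.truncn M).+1.
split; [exact: linked_base|exact: linked_vtx|].
rewrite -iso !inv; first last.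
- exact: cgraph_vtx.
- apply: cgraph_vtx; rewrite mulgA; apply: specialM => //.
  by apply: special_sub s1; exact/fintype.subsetP.
by rewrite vtx_dist mulKg wlen_alt // truncnS_gt.
Qed.

(** A point of [N] is joined inside the coset graph of [W_U] to a vertex of [x W_P], at distance at
    most [D + 2] from the point all along. Two vertices of [x W_P] are joined by edges with labels
    in [P], whose endpoints lie in [N]. *)
Lemma linked_path_connected P D L : P \subset H1 ->
  (forall z, special P z -> special H2 ((x^-1 * y)^-1 * z * (x^-1 * y))%g) ->
  (forall v, (exists2 a, special H1 (x^-1 * a)%g & wlen (a^-1 * v)%g <= 4)%N ->
      (exists2 b, special H2 (y^-1 * b)%g & wlen (b^-1 * v)%g <= 4)%N ->
      exists2 z, special P z & wlen ((x * z)^-1 * v)%g <= D)%N ->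
  D%:R + 3 < L -> path_connected_in L N.
Proof.
case: (chart) => iso ran inv PH1 P2 PD DL a b Na Nb.
have D0 : 0 <= D%:R :> R by [].
have tri (p q r : X) : mdist p r <= mdist p q + mdist q r := metric_triangle p q r.
pose S := [set q : X | cgraph g U q /\ exists2 n, N n & mdist (phi n) q < L].
have PU : P \subset U by exact: fintype.subset_trans PH1 cls1.
have gxP z : special P z -> special U (g^-1 * (x * z))%g.
  move=> zP; rewrite mulgA; apply: specialM => //.
  by apply: special_sub zP; exact/fintype.subsetP.
have NP z : special P z -> N (psi (vtx (x * z)%g)).
  move=> zP; apply: linked_vtx; last exact: P2.
  by apply: special_sub zP; exact/fintype.subsetP.
have toP c : N c -> exists2 z, special P z & exists l : R, lip_path S (phi c) (vtx
  (x * z)%g) l.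
  move=> Nc; have [v [gv cv [l [l1 cv_path]]]] := cgraph_near (ran c).
  have near_coset H (t : W) : cgraph t H `<=` cgraph g U ->
      metric_nbhd 2 (phi @^-1` cgraph t H) c ->
      exists2 d, special H (t^-1 * d)%g & (wlen (d^-1 * v)%g <= 4)%N.
    move=> sub [d td]; rewrite ballEmdist /= => dc.
    have [d0 [td0 dd0 _]] := cgraph_near td; exists d0 => //.
    rewrite -iso in dc; rewrite -(ler_nat R) -vtx_dist.
    have := tri (vtx d0) (phi d) (vtx v); have := tri (phi d) (phi c) (vtx v).
    by rewrite (metric_sym (vtx d0) (phi d)); lra.
  have [z zP zv] := PD v (near_coset _ _ (cgraph_sub gx cls1) Nc.1)
    (near_coset _ _ (cgraph_sub gy cls2) Nc.2).
  have vxz : special U (v^-1 * (x * z))%g by apply/(special_cosetE (x * z)%g gv);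
    exact: gxP.
  have [m vxz_path] := coset_word_path gv (subxx U) vxz.
  exists z => //; exists (l + m); apply: lip_path_cat.
    by apply: lip_path_sub cv_path => q [gq cq]; split=> //; exists c => //; lra.
  apply: lip_path_sub vxz_path => q [gq [w _ [wq ww]]]; split=> //; exists c => //.
  have : mdist (vtx v) (vtx w) <= D%:R.
    by rewrite vtx_dist ler_nat (leq_trans ww) // wdistC.
  by have := tri (phi c) (vtx v) q; have := tri (vtx v) (vtx w) q; lra.
have [za zaP [la a_path]] := toP a Na; have [zb zbP [lb b_path]] := toP b Nb.
have zab : special P ((x * za)^-1 * (x * zb))%g.
  rewrite invgM -mulgA mulKg; apply: specialM => //; exact: specialV.
have [m m_path] := coset_word_path (gxP _ zaP) PU zab.
have ab_path : lip_path S (phi a) (phi b) (la + (m + lb)).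
  apply: lip_path_cat a_path (lip_path_cat _ (lip_path_rev b_path)).
  apply: lip_path_sub m_path => q [gq [w wP [wq _]]]; split=> //.
  exists (psi (vtx w)).
    have -> : w = (x * (x^-1 * w))%g by rewrite mulVKg.
    apply: NP; have -> : (x^-1 * w = za * ((x * za)^-1 * w))%g.
      by rewrite invgM -mulgA mulVKg.
    exact: specialM.
  rewrite inv; first by lra.
  apply: cgraph_vtx; apply/(special_cosetE w (gxP _ zaP)).
  by apply: special_sub wP; exact/fintype.subsetP.
have psi_lip p q : cgraph g U p -> cgraph g U q -> mdist (psi p) (psi q) = mdist p
  q.
  by move=> gp gq; rewrite -iso !inv.
case: ab_path => h [h_lip h0 h1 l0 hS].
exists (fun t => psi (h ((la + (m + lb)) * t))); last first.
  move=> _ [t _ <-]; have [gq [n Nn nq]] := hS ((la + (m + lb)) * t).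
  by exists n => //; rewrite ballEmdist /= -iso inv.
split; [|by rewrite mulr0 h0 (chart_psiK chart)|by rewrite mulr1 h1 (chart_psiK
  chart)].
apply: continuous_subspaceT;
  apply: (@lipschitz_continuous _ _ _ (la + (m + lb))) => t t'.
rewrite psi_lip; [|by have [] := hS ((la + (m + lb)) * t)|by have [] := hS ((la +
  (m + lb)) * t')].
by apply: le_trans (h_lip _ _) _; rewrite -mulrBr normrM (ger0_norm l0).
Qed.

End LinkedCosets.

End Charts.

Section TightNetworks.
Context (R : realType) {V : finType} (e : rel V).
Hypotheses (e_sym : symmetric e) (e_irr : irreflexive e).
Local Notation W := (racg e).
Local Notation X := (cayley R e).
Local Notation vtx := (@cayley_vertex R V e).
Local Notation cgraph := (@cgraph R V e).
Implicit Types (g x y z v : W) (s : V) (H U P : {set V}) (u w : seq V) (t L : R).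

(** The index is the subset itself and not the pair [(H', x)]: a tight network asks for sequences
    that begin and end at given indices, while a chain may end at another base point of the same
    coset. *)
Definition subcoset (E : {set {set V}}) H1 g : Type := {D : set X |
  exists H' x, [/\ good_class e E H1 H', special (hyperclass e E H1) (g^-1 * x)%g
    & D = cgraph x H']}.

Lemma chain_class cls U (a : nat -> {set V} * W) m g :
  (forall i, (i < m)%N -> coset_link e cls U (a i) (a i.+1)) ->
  special U (g^-1 * (a 0%N).2)%g -> forall i, (i <= m)%N ->
  special U (g^-1 * (a i).2)%g /\ (wlen ((a 0%N).2^-1 * (a i).2)%g <= i)%N.
Proof.
move=> am ga; elim=> [|i IHi] im; first by rewrite mulVg wlen1.
have [gi ai] := IHi (ltnW im); have := am i im.
case: (a i) gi ai => Hi xi /= gi ai; case: (a i.+1) => Hi' xi' /= lnk.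
have [o [oU oE]] := coset_link_step lnk.
split.
  have -> : (g^-1 * xi' = (g^-1 * xi) * (xi^-1 * xi'))%g by rewrite -mulgA mulVKg.
  apply: specialM => //; rewrite oE; case: o oU {oE} => [s sU|_];
    last exact: special1.
  exact: special_gen.
apply: leq_trans (wdist_triangle xi _ _) _; rewrite -addn1 leq_add // oE.
by case: o {oU oE} => [s|]; rewrite ?wlen1 ?wlen_gen.
Qed.

Lemma coset_tight E H1 : good_or_strip e E -> H1 \in E -> good e H1 ->
  exists n0 : nat, forall L, n0%:R <= L ->
  forall (Y : metricType R) g (phi : Y -> X) (psi : X -> Y),
  coset_chart g (hyperclass e E H1) phi psi ->
  tight_network 2 L (fun D : subcoset E H1 g => phi @^-1` (sval D)).
Proof.
move=> Egs H1E gH1; set U := hyperclass e E H1; set cls := good_class e E H1.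
have [D DP] := coset_link_near e_sym e_irr;
  have [c cP] := coset_chain e_sym Egs H1E gH1.
(* A ball of radius [3 * 2] gives vertices of the two cosets within 7 of its centre, hence at most
   14 apart and joined by a chain of at most [c * 15] links. [L] has to bound the number of cosets,
   the distance [7 + c * 15] from the centre to base points, and [D + 3]. *)
exists (D + c * 15 + 20)%N => L DL Y g phi psi chart.
have {}DL : D%:R + (c * 15)%N%:R + 20 <= L by rewrite -!natrD.
have D0 : 0 <= D%:R :> R by []; have c0 : 0 <= (c * 15)%N%:R :> R by [].
have cls_sub H' : cls H' -> H' \subset U.
  by case/and3P=> H'E _ H1H'; exact: hyperclass_in.
have cls1 : cls H1 by rewrite /cls /good_class H1E gH1 connect0.
have tri (p q r : X) : mdist p r <= mdist p q + mdist q r := metric_triangle p q r.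
case: (chart) => iso ran inv; split.
- move=> [A AP] /=; have [H' [x [cH' gx ->]]] := AP.
  by apply: coset_quasi_convex chart gx (cls_sub _ cH') _; lra.
- apply/seteqP; split=> // a _.
  have [x [gx ax _]] := cgraph_near (ran a).
  exists (exist _ (cgraph x H1) (ex_intro _ H1 (ex_intro _ x (And3 cls1 gx
    erefl)))) => //.
  exists (psi (vtx x)) => /=.
    rewrite inv; last exact: cgraph_vtx.
    by apply: cgraph_vtx; rewrite mulVg; exact: special1.
  rewrite ballEmdist /= -iso inv; last exact: cgraph_vtx.
  by rewrite metric_sym; lra.
- move=> j k a [b [ab jb]] [b' [ab' kb']].
  rewrite ballEmdist /= -iso in ab; rewrite ballEmdist /= -iso in ab'.
  case: (svalP j) => [K1 [x1 [cK1 gx1 jE]]];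
    case: (svalP k) => [K2 [x2 [cK2 gx2 kE]]].
  rewrite /preimage /= jE in jb; rewrite /preimage /= kE in kb'.
  have [v1 [x1v1 bv1 _]] := cgraph_near jb;
    have [v2 [x2v2 bv2 _]] := cgraph_near kb'.
  have gv x H' v : cls H' -> special U (g^-1 * x)%g -> special H' (x^-1 * v)%g ->
      special U (g^-1 * v)%g.
    move=> cH' gx xv; apply/(special_cosetE v gx).
    by apply: special_sub xv; apply/fintype.subsetP; exact: cls_sub.
  have gv1 := gv _ _ _ cK1 gx1 x1v1; have gv2 := gv _ _ _ cK2 gx2 x2v2.
  have av1 : mdist (phi a) (vtx v1) <= 7 by have := tri (phi a) (phi b) (vtx v1);
    lra.
  have av2 : mdist (phi a) (vtx v2) <= 7 by have := tri (phi a) (phi b') (vtx v2);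
    lra.
  have v12 : special U (v1^-1 * v2)%g by apply/(special_cosetE v2 gv1).
  have [u [uU us uE]] := specialP v12.
  have u14 : (size u <= 14)%N.
    rewrite us -(ler_nat R) -vtx_dist; have := tri (vtx v1) (phi a) (vtx v2).
    by rewrite (metric_sym (vtx v1) (phi a)); lra.
  have := cP K1 K2 u v1 cK1 cK2 uU; rewrite uE mulVKg => K12.
  have [m [f [mc f0 fm fl]]] := chain_fun K12.
  have fP i : (i <= m)%N -> special U (g^-1 * (f i).2)%g /\
      (wlen (v1^-1 * (f i).2)%g <= i)%N.
    by move=> im; have := chain_class fl _ im; rewrite f0 /=; apply.
  have fcls i : (i <= m)%N -> cls (f i).1.
    case: i => [|i] im; first by rewrite f0.
    by have [] := fl i im.
  have m15 : (m <= c * 15)%N by rewrite (leq_trans mc) // leq_mul2l ltnS u14 orbT.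
  have m15R : m%:R <= (c * 15)%N%:R :> R by rewrite ler_nat.
  (* Beyond [m] the sequence takes the default value [j]. *)
  pose F i : subcoset E H1 g := match pselect (i <= m)%N with
    | left im => exist _ (cgraph (f i).2 (f i).1) (ex_intro _ (f i).1
        (ex_intro _ (f i).2 (And3 (fcls i im) (fP i im).1 erefl)))
    | right _ => j end.
  have FE i : (i <= m)%N -> sval (F i) = cgraph (f i).2 (f i).1.
    by rewrite /F; case: pselect.
  have sub_inj (A B : subcoset E H1 g) : sval A = sval B -> A = B.
    case: A B => A Ap [B Bp] /= AB; rewrite AB in Ap *; congr exist.
    exact: Prop_irrelevance.
  exists m, F; split.
  + by rewrite -natr1; lra.
  + by apply: sub_inj; rewrite FE // f0 jE /=; exact: cgraph_eq.
  + by apply: sub_inj; rewrite FE // fm kE /=; exact: cgraph_eq.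
  + move=> i im.
    rewrite !FE //; last exact: ltnW.
    have [gfi vfi] := fP i (ltnW im); have := fl i im.
    case: (f i) gfi vfi => Hi xi /= gxi vxi; case: (f i.+1) => Hi' xi' /= lnk.
    have [P [PHi P2 PD]] := DP _ _ _ _ _ _ lnk.
    split.
    * exact: linked_infinite_diameter chart cls_sub lnk gxi.
    * have DL' : D%:R + 3 < L by lra.
      exact (linked_path_connected chart cls_sub lnk gxi PHi P2 PD DL').
    * exists (psi (vtx xi)); split; first exact: linked_base chart cls_sub lnk gxi.
      rewrite ballEmdist /= -iso inv; last exact: cgraph_vtx.
      have : mdist (vtx v1) (vtx xi) <= i%:R by rewrite vtx_dist ler_nat.
      have : i%:R <= m%:R :> R by rewrite ler_nat ltnW.
      by have := tri (phi a) (vtx v1) (vtx xi); lra.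
Qed.

(* The members of a family are arbitrary metric spaces isometric to coset graphs,
   so that subspaces of subspaces need not be compared with subsets of [X]. *)
Lemma thick_cosets_succ k (n0 : nat) :
  (forall L, n0%:R <= L -> forall (I : Type) (Y : I -> metricType R),
    (forall i, exists H, [/\ H \in Lambda e k, good e H & coset_model e (Y i) H]) ->
    thick_family 2 L k Y) ->
  exists n1 : nat, forall L, n1%:R <= L -> forall (I : Type) (Y : I -> metricType
    R),
    (forall i, exists H, [/\ H \in Lambda e k.+1, good e H & coset_model e (Y i)
      H]) ->
    thick_family 2 L k.+1 Y.
Proof.
move=> IH; have Egs := @Lambda_good_or_strip _ _ e_sym e_irr k.
have [H1|H1 n m nm h H1E gH1 L mL|n nP] := @fin_bound {set V} (fun H1 n =>
  H1 \in Lambda e k -> good e H1 -> forall L, n%:R <= L ->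
  forall (Y : metricType R) g (phi : Y -> X) (psi : X -> Y),
  coset_chart g (hyperclass e (Lambda e k) H1) phi psi ->
  tight_network 2 L (fun D : subcoset (Lambda e k) H1 g => phi @^-1` (sval D))).
- have [/andP[H1E gH1]|no] := boolP ((H1 \in Lambda e k) && good e H1).
    by have [n nP] := coset_tight Egs H1E gH1; exists n.
  by exists 0%N => H1E gH1; rewrite H1E gH1 in no.
- by apply: h => //; apply: le_trans mL; rewrite ler_nat.
exists (n0 + n)%N => L nL I Y HY.
have n0L : n0%:R <= L by apply: le_trans nL; rewrite ler_nat leq_addr.
have {}nL : n%:R <= L by apply: le_trans nL; rewrite ler_nat leq_addl.
have tight i : exists F : {J : Type & J -> set (Y i)},
    tight_network 2 L (projT2 F) /\ forall j, exists H,
      [/\ H \in Lambda e k, good e H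
        & coset_model e (metric_subspace (projT2 F j) : metricType R) H].
  have [H [HL gH [g [phi [psi chart]]]]] := HY i.
  have [H1 [H1E gH1 HE]] := Lambda_good_succ e_sym e_irr HL gH.
  rewrite HE in chart; exists (existT (fun J : Type => J -> set (Y i)) (subcoset
    (Lambda e k) H1 g)
    (fun D => phi @^-1` (sval D))).
  split; first exact: nP H1E gH1 L nL _ _ _ _ chart.
  move=> [A AP] /=; have [H' [x [cH' gx ->]]] := AP; exists H'.
  case/and3P: (cH') => H'E gH' H1H'; split=> //.
  exact: coset_model_subspace chart gx (hyperclass_in H'E H1H').
pose F i := projT1 (cid (tight i)).
exists (fun i => projT1 (F i)), (fun i => projT2 (F i)); split=> [i|].
  by have [] := projT2 (cid (tight i)).
apply: IH => // -[i j] /=.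
by have [_] := projT2 (cid (tight i)); apply.
Qed.

End TightNetworks.

(** * Wide special subgroups *)

Section BiinfiniteGeodesic.
Context (R : realType) {V : finType} (e : rel V).
Hypotheses (e_sym : symmetric e) (e_irr : irreflexive e).
Local Notation W := (racg e).
Local Notation X := (cayley R e).
Local Notation vtx := (@cayley_vertex R V e).
Local Notation cgraph := (@cgraph R V e).
Implicit Types (p q : V) (g x : W) (H : {set V}).

Lemma vtx_dist_alt x p q i j : p != q -> ~~ e p q ->
  mdist (vtx (x * elt e (alt p q i))%g) (vtx (x * elt e (alt p q j))%g)
  = `|i%:R - j%:R|.
Proof.
move=> pq epq; rewrite vtx_dist invgM -mulgA mulKg.
wlog ij : i j / (i <= j)%N => [h|].
  by have [/h //|/ltnW/h] := leqP i j; rewrite wdistC distrC.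
have wl : wlen (elt e (alt p q j)) = size (alt p q j) by rewrite wlen_alt //
  size_alt.
have := wdist_take wl (i := i) (j := j); rewrite size_alt ij leqnn => /(_ isT).
rewrite !take_alt // => ->.
by rewrite natrB // distrC ger0_norm // subr_ge0 ler_nat.
Qed.

Lemma vtx_dist_alt2 x p q i j : p != q -> ~~ e p q ->
  mdist (vtx (x * elt e (alt p q i))%g) (vtx (x * elt e (alt q p j))%g)
  = i%:R + j%:R.
Proof.
move=> pq epq; rewrite vtx_dist invgM -mulgA mulKg -natrD; congr (_%:R).
apply/eqP; rewrite eqn_leq wdist_alt2 // andbT.
by rewrite (leq_trans (wlenM _ _)) // wlenV leq_add // (leq_trans (wlen_elt _ _))
  ?size_alt.
Qed.

Lemma coset_biinfinite_geodesic (Y : metricType R) H (L : R) :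
  coset_model e Y H -> has_nonadj e H -> 5 <= L -> forall y : Y,
  exists2 f : R -> Y, quasi_geodesic_on L [set: R] f & metric_nbhd 2 (range f) y.
Proof.
move=> [g [phi [psi [iso ran inv]]]] /has_nonadjP[p [q [pH qH pq epq]]] L5 y.
have [x [gx yx _]] := cgraph_near (ran y).
have gxa p' q' n : p' \in H -> q' \in H ->
    cgraph g H (vtx (x * elt e (alt p' q' n))%g).
  move=> p'H q'H; apply: cgraph_vtx; rewrite mulgA; apply: specialM => //.
  by apply: special_elt; exact: all_alt.
pose f (t : R) := psi (vtx (x * if 0 <= t then elt e (alt p q (Num.truncn t))
  else elt e (alt q p (Num.truncn (- t))))%g).
exists f; last first.
  exists (f 0); first by exists 0.
  rewrite ballEmdist /= -iso metric_sym /f lexx truncn0 inv; last exact: gxa.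
  by rewrite elt_nil mulg1; lra.
have trunc_lo (t : R) : 0 <= t -> t - 1 <= (Num.truncn t)%:R <= t.
  move=> /truncn_itv/andP[a]; rewrite -natr1 => c; apply/andP; split=> //; lra.
apply: close_quasi_geodesic => // t t' _ _; rewrite -iso /f.
have [t0|t0] := leP 0 t; have [t'0|t'0] := leP 0 t'; rewrite !inv; try exact: gxa.
- rewrite vtx_dist_alt //; have /andP[h1 h2] := truncn_dist t0 t'0.
  by apply/andP; split; lra.
- rewrite vtx_dist_alt2 //.
  have /andP[h1 h2] := trunc_lo _ t0.
  have /andP[h3 h4] : - t' - 1 <= (Num.truncn (- t'))%:R <= - t' by apply:
    trunc_lo; lra.
  by rewrite ger0_norm; last lra; apply/andP; split; lra.
- rewrite vtx_dist_alt2 1?eq_sym 1?e_sym //.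
  have /andP[h1 h2] := trunc_lo _ t'0.
  have /andP[h3 h4] : - t - 1 <= (Num.truncn (- t))%:R <= - t by apply: trunc_lo;
    lra.
  by rewrite ler0_norm; last lra; apply/andP; split; lra.
- rewrite vtx_dist_alt 1?eq_sym 1?e_sym //.
  have t0' : 0 <= - t by lra. have t'0' : 0 <= - t' by lra.
  have := truncn_dist t0' t'0'.
  rewrite (_ : - t - - t' = t' - t) ?(distrC t' t); last by ring.
  by move=> /andP[h1 h2]; apply/andP; split; lra.
Qed.

End BiinfiniteGeodesic.

(** * Ultralimits of wide cosets *)

Section UltralimitOfCosets.
Context (R : realType) {V : finType} (e : rel V).
Hypotheses (e_sym : symmetric e) (e_irr : irreflexive e).
Local Notation W := (racg e).
Local Notation X := (cayley R e).
Local Notation vtx := (@cayley_vertex R V e).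
Local Notation cgraph := (@cgraph R V e).
Context (Y : nat -> metricType R) (w : set_system nat) (wU : UltraFilter w)
  (s : nat -> {posnum R}) (b : forall i, Y i).
Hypothesis s_oo : (s i)%:num @[i --> w] --> +oo.
Context (g : nat -> W) (M : nat -> {set V}) (phi : forall i, Y i -> X)
  (psi : forall i, X -> Y i).
Hypothesis chart : forall i, coset_chart (g i) (M i) (@phi i) (@psi i).
Local Notation ulim := (ultralimit wU s b).
Local Notation sd := (scaled_dist s).

#[local] Instance wP : ProperFilter w. Proof. exact: ultra_proper. Qed.

Let iso i (x y : Y i) : mdist (phi x) (phi y) = mdist x y.
Proof. by case: (chart i). Qed.
Let ran i (x : Y i) : cgraph (g i) (M i) (phi x).
Proof. by case: (chart i). Qed.
Let inv i p : cgraph (g i) (M i) p -> phi (psi i p) = p.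
Proof. by case: (chart i) => _ _; apply. Qed.

Lemma near_small_inv (eps : R) : 0 < eps -> \forall i \near w, ((s i)%:num)^-1 <=
  eps.
Proof.
move=> eps0; apply: filterS (cvgry_ge s_oo eps^-1) => i h.
by rewrite -[eps]invrK lef_pV2 ?posrE ?invr_gt0.
Qed.

Lemma ultra_dist_le (x y : ultra_seq w s b) (c : R) :
  (forall d, 0 < d -> \forall i \near w, sd (sval x) (sval y) i <= c + d) ->
  ultra_dist x y <= c.
Proof.
move=> h; apply/ler_addgt0Pr => d d0.
exact: cvgr_to_le (@cvg_ultra_dist _ _ _ wU _ _ x y) (h d d0).
Qed.

Lemma ultra_dist_ge (x y : ultra_seq w s b) (c : R) :
  (\forall i \near w, c <= sd (sval x) (sval y) i) -> c <= ultra_dist x y.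
Proof. exact: cvgr_to_ge (@cvg_ultra_dist _ _ _ wU _ _ x y). Qed.

Lemma ultra_pi_eq (x y : ultra_seq w s b) : ultra_dist x y = 0 ->
  (\pi x)%qT = (\pi y)%qT :> ulim.
Proof. by move=> xy; apply/eqP; rewrite eqmodE; apply/eqP. Qed.

Definition bounded_seq (x : forall i, Y i) : Prop :=
  exists K : R, \forall i \near w, sd b x i <= K.

Definition pts (v : nat -> W) : forall i, Y i := fun i => psi i (vtx (v i)).

Definition in_cosets (v : nat -> W) := forall i, special (M i) ((g i)^-1 * v i)%g.

Definition vlim (v : nat -> W) (vb : bounded_seq (pts v)) : ulim :=
  (\pi_ulim (exist _ (pts v) vb))%qT.

Lemma sd_pts u v i : in_cosets u -> in_cosets v ->
  sd (pts u) (pts v) i = (wlen ((u i)^-1 * v i)%g)%:R / (s i)%:num.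
Proof.
move=> uM vM; rewrite /scaled_dist /pts -iso !inv ?vtx_dist //; exact: cgraph_vtx.
Qed.

Lemma bounded_pts u v (K : R) : in_cosets u -> in_cosets v -> bounded_seq (pts u) ->
  (\forall i \near w, (wlen ((u i)^-1 * v i)%g)%:R <= K * (s i)%:num) ->
  bounded_seq (pts v).
Proof.
move=> uM vM [K' uK'] uvK; exists (K' + K); apply: filterS2 uK' uvK => i h1 h2.
apply: le_trans (scaled_dist_triangle s b (pts u) (pts v) i) _; apply: lerD => //.
by rewrite sd_pts // ler_pdivrMr.
Qed.

Lemma bounded_pts_dist u v : in_cosets u -> in_cosets v ->
  bounded_seq (pts u) -> bounded_seq (pts v) -> exists2 K : R, 0 <= K &
  \forall i \near w, (wlen ((u i)^-1 * v i)%g)%:R <= K * (s i)%:num.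
Proof.
move=> uM vM [K uK] [K' vK']; exists (`|K| + `|K'|) => //.
apply: filterS2 uK vK' => i h1 h2.
rewrite -ler_pdivrMr // -sd_pts //.
apply: le_trans (scaled_dist_triangle s (pts u) b (pts v) i) _.
rewrite scaled_dist_sym; apply: lerD; apply: le_trans (ler_norm _) => //.
Qed.

Lemma vlim_eq u v ub vb : u =1 v -> vlim (v := u) ub = vlim (v := v) vb.
Proof.
move=> /funext uv; move: ub; rewrite uv => ub; congr (vlim _).
exact: Prop_irrelevance.
Qed.

(** Every point is within 1 of a vertex of the coset, and the rescaled error [1 / s_i] vanishes in
    the limit. *)
Lemma vlim_surj (q : ulim) : exists v, in_cosets v /\
  exists vb : bounded_seq (pts v), q = vlim vb.
Proof.
elim/quotW: q => x.
have /choice[v vP] i : exists v : W, special (M i) ((g i)^-1 * v)%g /\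
    mdist (phi (sval x i)) (vtx v) <= 1.
  by have [v [gv xv _]] := cgraph_near (ran (sval x i)); exists v.
have vM : in_cosets v by move=> i; case: (vP i).
have xv i : sd (sval x) (pts v) i <= (s i)%:num^-1.
  rewrite /scaled_dist -iso inv; last exact: cgraph_vtx.
  by rewrite ler_pdivrMr // mulVf //; case: (vP i).
exists v; split=> //.
have vb : bounded_seq (pts v).
  have [K xK] := svalP x; exists (K + 1).
  apply: filterS2 xK (near_small_inv ltr01) => i h1 h2.
  apply: le_trans (scaled_dist_triangle s b (sval x) (pts v) i) _;
    apply: lerD => //.
  exact: le_trans (xv i) h2.
exists vb; apply: ultra_pi_eq; apply/eqP; rewrite eq_le ultra_dist_ge0 andbT.
apply: ultra_dist_le => d d0; rewrite add0r;
  apply: filterS (near_small_inv d0) => i h.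
exact: le_trans (xv i) h.
Qed.

Definition joined_avoiding (p q q' : ulim) : Prop :=
  exists C : set ulim, [/\ connected C, C `<=` ~` [set p], C q & C q'].

Lemma joined_avoiding_trans p q r t :
  joined_avoiding p q r -> joined_avoiding p r t -> joined_avoiding p q t.
Proof.
move=> [C [Cc Cp Cq Cr]] [D [Dc Dp Dr Dt]]; exists (C `|` D); split.
- by apply: connectedU => //; exists r.
- by move=> x [/Cp|/Dp].
- by left.
- by right.
Qed.

(** The limits of [u] and [v] differ already in the [A]-factor. *)
Definition far_in (A : nat -> {set V}) (u v : nat -> W) : Prop :=
  exists2 eps : R, 0 < eps & \forall i \near w,
    eps * (s i)%:num <= (wlen (kill e (A i) ((u i)^-1 * v i)%g))%:R.

(* Along a path in the [B]-direction the [A]-component does not change, and it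
   keeps the path away from [z]. *)
Lemma joined_along (A B : nat -> {set V}) z y y' (zb : bounded_seq (pts z))
    (yb : bounded_seq (pts y)) (y'b : bounded_seq (pts y')) :
  (forall i, M i = A i :|: B i)%SET -> (forall i, joined e (B i) (A i)) ->
  in_cosets z -> in_cosets y -> (forall i, special (B i) ((y i)^-1 * y' i)%g) ->
  far_in A z y -> joined_avoiding (vlim zb) (vlim yb) (vlim y'b).
Proof.
move=> ME BA zM yM yy' [eps eps0 far].
have BM i (v : W) : special (B i) v -> special (M i) v.
  by apply: special_sub => t; rewrite ME finset.inE orbC => ->.
have y'M : in_cosets y'.
  by move=> i; apply/(special_cosetE (y' i) (yM i)); exact: BM.
have [K K0 yK] := bounded_pts_dist yM y'M yb y'b.
have /choice[u uP] i : exists u, [/\ all (mem (B i)) u,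
    size u = wlen ((y i)^-1 * y' i)%g & elt e u = ((y i)^-1 * y' i)%g].
  exact: specialP (yy' i).
(* [v t i] is the point at proportion [t] on a geodesic from [y i] to [y' i] with letters in [B i].
   Its length is at most [K s_i], and rounding changes distances by at most 1, so the limit is
   [K]-Lipschitz in [t]. *)
pose n (t : R) i := Num.truncn (clamp t * (size (u i))%:R).
pose v t i := (y i * elt e (take (n t i) (u i)))%g.
have nu t i : (n t i <= size (u i))%N.
  have /andP[t0 t1] := clamp_itv t.
  by rewrite -[leqRHS](@natrK R) le_truncn // ler_piMl.
have takeB t i : special (B i) (elt e (take (n t i) (u i))).
  apply: special_elt; have [uB _ _] := uP i.
  by apply/allP => c /mem_take; move/allP: uB; apply.
have vM t : in_cosets (v t).
  by move=> i; rewrite /v mulgA; apply: specialM => //; apply: BM.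
have vb t : bounded_seq (pts (v t)).
  apply: (bounded_pts yM (vM t) yb (K := K)); apply: filterS yK => i h.
  apply: le_trans h; rewrite /v mulKg ler_nat; have [_ <- _] := uP i.
  by rewrite (leq_trans (wlen_elt _ _)) // size_takel.
pose F t := vlim (vb t).
have FL t t' : mdist (F t) (F t') <= K * `|t - t'|.
  rewrite -[mdist _ _]/(ultralimit_dist _ _) ultralimit_distE.
  apply: ultra_dist_le => d d0;
    apply: filterS2 yK (near_small_inv d0) => i h1 h2 /=.
  rewrite sd_pts // /v invgM -mulgA mulKg.
  have [uB us uE] := uP i.
  have wl : wlen (elt e (u i)) = size (u i) by rewrite uE us.
  have -> : (wlen ((elt e (take (n t i) (u i)))^-1 * elt e (take (n t' i) (u
    i)))%g)%:R
      = `|(n t i)%:R - (n t' i)%:R| :> R.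
    have [tt'|t't] := leqP (n t i) (n t' i).
      rewrite wdist_take ?tt' ?nu // natrB // distrC ger0_norm //.
      by rewrite subr_ge0 ler_nat.
    rewrite wdistC wdist_take ?(ltnW t't) ?nu // natrB ?(ltnW t't) // ger0_norm //.
    by rewrite subr_ge0 ler_nat ltnW.
  have /andP[t0 t1] := clamp_itv t; have /andP[t'0 t'1] := clamp_itv t'.
  have := @truncn_dist R (clamp t * (size (u i))%:R) (clamp t' * (size (u i))%:R).
  rewrite !mulr_ge0 // => /(_ isT isT)/andP[_ h].
  rewrite ler_pdivrMr //; apply: le_trans h _; rewrite mulrDl; apply: lerD;
    last first.
    by rewrite -ler_pdivrMr // mul1r.
  rewrite -mulrBl normrM [X in _ * X]ger0_norm // us mulrC mulrAC.
  by apply: ler_pM => //; exact: clamp_lip.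
exists (F @` `[0, 1]); split.
- apply: connected_continuous_connected; first exact: segment_connected.
  by apply: continuous_subspaceT; exact: lipschitz_continuous FL.
- move=> _ [t _ <-] /= Fz.
  suff : eps <= mdist (F t) (vlim zb) by rewrite Fz mdistxx leNgt eps0.
  rewrite -[mdist _ _]/(ultralimit_dist _ _) ultralimit_distE.
  apply: ultra_dist_ge; apply: filterS far => i h /=.
  rewrite scaled_dist_sym sd_pts // ler_pdivlMr //; apply: le_trans h _.
  rewrite ler_nat; apply: leq_trans (wlen_kill (A i) _).
  rewrite /v mulgA (killM _ _ (elt e _)).
  have -> : kill e (A i) (elt e (take (n t i) (u i))) = 1%g.
    by apply: kill_joined (takeB t i) => c; exact: joined_notin (BA i).
  by rewrite mulg1.
- exists 0; first by rewrite /= in_itv /= lexx ler01.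
  apply: vlim_eq => i; rewrite /v /n clamp_id ?lexx ?ler01 // mul0r truncn0 take0.
  by rewrite elt_nil mulg1.
- exists 1; first by rewrite /= in_itv /= lexx ler01.
  apply: vlim_eq => i; rewrite /v /n clamp_id ?lexx ?ler01 // mul1r natrK take_size.
  by have [_ _ ->] := uP i; rewrite mulVKg.
Qed.

(** The length of the alternating word exceeds [s_i], so its rescaled length is at least 1. *)
Lemma far_alt (A : nat -> {set V}) (p q : nat -> V) z y :
  (forall i, p i != q i) -> (forall i, ~~ e (p i) (q i)) ->
  (forall i, kill e (A i) ((z i)^-1 * y i)%g =
    elt e (alt (p i) (q i) (Num.truncn (s i)%:num).+1)) -> far_in A z y.
Proof.
move=> pq epq zy; exists 1 => //; apply: nearW => i; rewrite mul1r zy wlen_alt //.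
exact/ltW/truncnS_gt.
Qed.

(** Every point other than the candidate [[z]] is joined to one hub [[z a0 b0]], with [a0] and [b0]
    alternating words of length about [s_i] in the two factors. From [[z al be]] with [al] far from
    1, [be] is changed into [b0], and then, protected by [b0], [al] into [a0]; the other case is
    symmetric. *)
Lemma ultralimit_no_cut_points (A B : nat -> {set V}) :
  (forall i, M i = A i :|: B i)%SET -> (forall i, joined e (A i) (B i)) ->
  (forall i, has_nonadj e (A i)) -> (forall i, has_nonadj e (B i)) ->
  has_no_cut_points ulim.
Proof.
move=> ME AB nA nB p0; have [z [zM [zb ->]]] := vlim_surj p0.
have BA i : joined e (B i) (A i) by move=> c d cB dA; rewrite e_sym; exact: (AB i).
have ME' i : (M i = B i :|: A i)%SET by rewrite finset.setUC.
have AM i (v : W) : special (A i) v -> special (M i) v.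
  by apply: special_sub => t; rewrite ME finset.inE => ->.
have BM i (v : W) : special (B i) v -> special (M i) v.
  by apply: special_sub => t; rewrite ME finset.inE orbC => ->.
pose len i := (Num.truncn (s i)%:num).+1.
have lenP : \forall i \near w, (len i)%:R <= 2 * (s i)%:num.
  apply: filterS (cvgry_ge s_oo 1) => i h; rewrite /len -natr1.
  have : (Num.truncn (s i)%:num)%:R <= (s i)%:num by rewrite truncn_le.
  by lra.
have alts (C : nat -> {set V}) : (forall i, has_nonadj e (C i)) ->
    exists p q : nat -> V, [/\ forall i, p i != q i, forall i, ~~ e (p i) (q i)
      & forall i, special (C i) (elt e (alt (p i) (q i) (len i)))].
  move=> nC; have /choice[pq pqP] i : exists pq : V * V,
      [/\ pq.1 \in C i, pq.2 \in C i, pq.1 != pq.2 & ~~ e pq.1 pq.2].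
    by have /has_nonadjP[p [q h]] := nC i; exists (p, q).
  exists (fun i => (pq i).1), (fun i => (pq i).2); split=> i;
    have [h1 h2 h3 h4] := pqP i => //.
  by apply: special_elt; exact: all_alt.
have [pA [qA [pqA epqA altA]]] := alts A nA;
  have [pB [qB [pqB epqB altB]]] := alts B nB.
pose a0 i := elt e (alt (pA i) (qA i) (len i)).
pose b0 i := elt e (alt (pB i) (qB i) (len i)).
have killAB i x : special (B i) x -> kill e (A i) x = 1%g.
  by apply: kill_joined => c; exact: joined_notin (BA i).
have killBA i x : special (A i) x -> kill e (B i) x = 1%g.
  by apply: kill_joined => c; exact: joined_notin (AB i).
have inC (u v : nat -> W) : (forall i, special (A i) (u i)) ->
    (forall i, special (B i) (v i)) -> in_cosets (fun i => z i * u i * v i)%g.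
  move=> uA vB i; rewrite !mulgA; apply: specialM; last exact: BM.
  by apply: specialM; [exact: zM|exact: AM].
have bd (u v : nat -> W) (K : R) : (forall i, special (A i) (u i)) ->
    (forall i, special (B i) (v i)) ->
    (\forall i \near w, (wlen (u i))%:R + (wlen (v i))%:R <= K * (s i)%:num) ->
    bounded_seq (pts (fun i => z i * u i * v i)%g).
  move=> uA vB uvK; apply: (bounded_pts zM (inC _ _ uA vB) zb (K := K)).
  apply: filterS uvK => i; apply: le_trans; rewrite -mulgA mulKg -natrD ler_nat.
  exact: wlenM.
have a0len i : wlen (a0 i) = len i by rewrite /a0 wlen_alt.
have b0len i : wlen (b0 i) = len i by rewrite /b0 wlen_alt.
have q0b : bounded_seq (pts (fun i => z i * a0 i * b0 i)%g).
  apply: (bd _ _ 4 altA altB); apply: filterS lenP => i h.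
  by rewrite a0len b0len; lra.
have comm i (u v : W) : special (A i) u -> special (B i) v -> (u * v = v * u)%g.
  by move=> uA vB; exact: joined_commute (AB i) uA vB.
have diffB (u v v' : W) i : ((z i * u * v)^-1 * (z i * u * v') = v^-1 * v')%g.
  by rewrite !invgM -!mulgA !mulKg.
have diffA i (u u' v : W) : special (A i) u -> special (A i) u' -> special (B i) v
  ->
    ((z i * u * v)^-1 * (z i * u' * v) = u^-1 * u')%g.
  move=> uA u'A vB; rewrite -!mulgA (comm i u v) // (comm i u' v) //.
  by rewrite !invgM -!mulgA !mulKg.
have toq0 q : q <> vlim zb -> joined_avoiding (vlim zb) q (vlim q0b).
  have [y [yM [yb ->]]] := vlim_surj q => yz.
  pose al i := kill e (A i) ((z i)^-1 * y i)%g.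
  pose be i := kill e (B i) ((z i)^-1 * y i)%g.
  have alA i : special (A i) (al i) by exact: special_kill.
  have beB i : special (B i) (be i) by exact: special_kill.
  have zyE i : ((z i)^-1 * y i = al i * be i)%g.
    apply: special_join => //; rewrite -ME; apply/(special_cosetE (y i) (zM i)).
    exact: yM.
  have yE i : y i = (z i * al i * be i)%g by rewrite -mulgA -zyE mulVKg.
  have [K K0 yK] := bounded_pts_dist zM yM zb yb.
  have b0_bd (u : nat -> W) : (forall i, (wlen (u i) <= wlen ((z i)^-1 * y i)%g)%N)
    ->
      \forall i \near w, (wlen (u i))%:R + (len i)%:R <= (K + 2) * (s i)%:num.
    move=> uy; apply: filterS2 yK lenP => i h1 h2; rewrite mulrDl;
      apply: lerD => //.
    by apply: le_trans h1; rewrite ler_nat.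
  have [d d0 dP] : exists2 d : R, 0 < d & \forall i \near w,
      d * (s i)%:num <= (wlen (al i))%:R + (wlen (be i))%:R.
    have yz0 : 0 < mdist (vlim zb) (vlim yb).
      by rewrite mdist_gt0; apply/eqP => zy; apply: yz.
    exists (mdist (vlim zb) (vlim yb) / 2); first by rewrite divr_gt0.
    have := @cvg_ultra_dist _ _ _ wU s b (exist _ _ zb) (exist _ _ yb).
    rewrite -(ultralimit_distE wU) -[ultralimit_dist _ _]/(mdist (vlim zb) (vlim
      yb)).
    move=> /cvgr_ge/(_ (mdist (vlim zb) (vlim yb) / 2)).
    rewrite ltr_pdivrMr // ltr_pMr // ltr1n => /(_ isT).
    apply: filterS => i; rewrite /= sd_pts // ler_pdivlMr // => h.
    by apply: le_trans h _; rewrite -natrD ler_nat zyE; exact: wlenM.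
  have far_al (C : nat -> {set V}) :
      w [set i | d / 2 * (s i)%:num <= (wlen (kill e (C i) ((z i)^-1 * y i)%g))%:R]
        ->
      far_in C z y.
    by exists (d / 2); rewrite ?divr_gt0.
  (* The ultrafilter decides which factor is used: if [al] is not of length at least [d s_i / 2]
     almost everywhere, then [be] is, since the two lengths add up to at least [d s_i]. *)
  case: (in_ultra_setVsetC [set i | d / 2 * (s i)%:num <= (wlen (al i))%:R] wU) =>
    h.
    have y1b : bounded_seq (pts (fun i => z i * al i * b0 i)%g).
      apply: (bd _ _ (K + 2) alA altB).
      under eq_near do rewrite b0len.
      by apply: b0_bd => i; exact: wlen_kill.
    apply: (@joined_avoiding_trans _ _ (vlim y1b)).
      apply: (joined_along _ _ _ ME BA zM yM); last exact: far_al.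
      move=> i; rewrite yE diffB; apply: specialM; [exact: specialV|exact: altB].
    apply: (joined_along _ _ _ ME' AB zM (inC _ _ alA altB)).
      move=> i; rewrite diffA //; apply: specialM; [exact: specialV|exact: altA].
    apply: (far_alt pqB epqB) => i.
    rewrite -mulgA mulKg killM (killBA i _ (alA i)) mul1g; exact/specialE.
  have y2b : bounded_seq (pts (fun i => z i * a0 i * be i)%g).
    apply: (bd _ _ (K + 2) altA beB).
    under eq_near do rewrite a0len addrC.
    by apply: b0_bd => i; exact: wlen_kill.
  apply: (@joined_avoiding_trans _ _ (vlim y2b)).
    apply: (joined_along _ _ _ ME' AB zM yM).
      move=> i; rewrite yE diffA //; apply: specialM; [exact: specialV|exact: altA].
    apply: far_al; apply: filterS2 h dP => i /= /negP;
      rewrite -ltNge /al /be => h1 h2.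
    by lra.
  apply: (joined_along _ _ _ ME BA zM (inC _ _ altA beB)).
    move=> i; rewrite diffB; apply: specialM; [exact: specialV|exact: altB].
  apply: (far_alt pqA epqA) => i.
  rewrite -mulgA mulKg killM (killAB i _ (beB i)) mulg1; exact/specialE.
pose good_set (C : set ulim) := [/\ connected C, C `<=` ~` [set vlim zb] & C (vlim
  q0b)].
have -> : ~` [set vlim zb] = \bigcup_(C in good_set) C.
  apply/seteqP; split=> [q qz|q [C [_ CS _] Cq]]; last exact: CS.
  by have [C [Cc CS Cq Cq0]] := toq0 q qz; exists C.
by apply: bigcup_connected => [|C []//]; exists (vlim q0b) => C [].
Qed.

End UltralimitOfCosets.

(** * Thickness of families of coset graphs *)

Section Thickness.
Context (R : realType) {V : finType} (e : rel V).
Hypotheses (e_sym : symmetric e) (e_irr : irreflexive e).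
Local Notation W := (racg e).
Local Notation X := (cayley R e).

Lemma uniformly_wide_cosets (L : R) (I : Type) (Y : I -> metricType R) :
  (forall i, exists2 M, M \in Omega e & coset_model e (Y i) M) -> 5 <= L ->
  uniformly_wide 2 L Y.
Proof.
move=> YO L5; split=> [i|a w wU s b _ s_oo].
  have [M /Omega_wide Mw model] := YO i.
  have nM : has_nonadj e M.
    have [A [B [-> _ nA _]]] := wide_formP _ _ Mw.
    by apply: has_nonadj_sub nA; exact: finset.subsetUl.
  by move=> y; exact: (coset_biinfinite_geodesic e_sym model nM L5 y).
pose data i := ({set V} * {set V} * W * (Y (a i) -> X) * (X -> Y (a i)))%type.
have model i : exists d : data i, [/\ coset_chart d.1.1.2 (d.1.1.1.1 :|:
  d.1.1.1.2)%SET d.1.2 d.2,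
    joined e d.1.1.1.1 d.1.1.1.2, has_nonadj e d.1.1.1.1 & has_nonadj e d.1.1.1.2].
  have [M /Omega_wide/wide_formP[A [B [-> AB nA nB]]] [g [phi [psi chart]]]] := YO
    (a i).
  by exists (A, B, g, phi, psi).
pose d i := projT1 (cid (model i)).
have dP i := projT2 (cid (model i)).
have chart i : coset_chart (d i).1.1.2 ((d i).1.1.1.1 :|: (d i).1.1.1.2)%SET
    (d i).1.2 (d i).2 by case: (dP i).
have AB i : joined e (d i).1.1.1.1 (d i).1.1.1.2 by case: (dP i).
have nA i : has_nonadj e (d i).1.1.1.1 by case: (dP i).
have nB i : has_nonadj e (d i).1.1.1.2 by case: (dP i).
exact (ultralimit_no_cut_points e_sym e_irr s_oo chart (fun i => erefl) AB nA nB).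
Qed.

Lemma thick_cosets k : exists n0 : nat, forall L, n0%:R <= L ->
  forall (I : Type) (Y : I -> metricType R),
  (forall i, exists H, [/\ H \in Lambda e k, good e H & coset_model e (Y i) H]) ->
  thick_family 2 L k Y.
Proof.
elim: k => [|k [n0 IHk]]; last exact: thick_cosets_succ IHk.
exists 5%N => L L5 I Y YL; apply: uniformly_wide_cosets => // i.
by have [H [HL gH model]] := YL i; exists H => //; exact: Lambda0_good.
Qed.

End Thickness.

Theorem theorem2 (R : realType) (V : finType) (e : rel V)
    (e_sym : symmetric e) (e_irr : irreflexive e)
    (h : nat) (Wh : has_hypergraph_index e h) :
  thick_of_order_at_most h (cayley R e) /\
  divergence_bounded_by_degree (cayley R e) h.+1.
Proof.
case/and3P: Wh => /finset.set0Pn[M MO] /existsP[H /andP[HL]];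
  rewrite finset.subTset.
move=> /eqP HT _; rewrite {}HT in HL.
(* A non-empty [Omega] ensures that the full hyperedge is good and not a strip. *)
have gV : good e [set: V].
  by apply: good_sub (Omega_good MO); exact: finset.subsetT.
split; last first.
  have [K KP] := div_bound_Lambda e_sym e_irr HL gV.
  exact: cayley_divergence KP.
have [n0 n0P] := thick_cosets R e_sym e_irr h.
exists 2, (n0%:R + 1); split; [by []|by rewrite ltr_wpDl|].
apply: n0P => [|[]]; first by rewrite lerDl.
by exists [set: V]%SET; split=> //; exact: coset_modelT.
Qed.
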